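(* Let $b$ be a non-constant contractive multiplier of $H^2_d$. Then the following are equivalent: (i) $z_j\mathcal H(b)\subset\mathcal H(b)$ for all $j=1,\dots,d$; (ii) $b\in\mathcal H(b)$; (iii) $b$ is not quasi-extreme.
   Context: Fix an integer $d\ge 1$; $\mathbb B^d$ is the open unit ball of $\mathbb C^d$, $\lambda^*$ denotes the complex conjugate of a scalar, and $zw^*=\sum_{j=1}^d z_jw_j^*$. $H^2_d$ (Drury–Arveson space) is the reproducing kernel Hilbert space on $\mathbb B^d$ with kernel $\frac1{1-zw^*}$. A contractive multiplier $b$ is a holomorphic function on $\mathbb B^d$ with $bf\in H^2_d$ and $\|bf\|\le\|f\|$ for all $f\in H^2_d$; $\mathcal H(b)$ is the reproducing kernel Hilbert space with kernel $k^b(z,w)=\frac{1-b(z)b(w)^*}{1-zw^*}$. $z_j\mathcal H(b)$ denotes the set of functions $z\mapsto z_jf(z)$, $f\in\mathcal H(b)$. $\mathbb F_d^+$ is the free semigroup of finite words in $1,\dots,d$ (including the empty word); on $\ell^2(\mathbb F_d^+)$ with orthonormal basis $\{\xi_w\}$ put $L_i\xi_w=\xi_{iw}$, so $L_i^*L_j=\delta_{ij}I$. For $\mathbf n\in\mathbb N^d$ (nonnegative integers), $|\mathbf n|=\sum n_i$, $L^{(\mathbf n)}$ is the sum of all distinct words (products) in the $L_i$ containing exactly $n_i$ factors $L_i$ for each $i$; $L^{(\mathbf 0)}=I$. $\mathcal S$ is the norm-closed linear span of all $L^{(\mathbf n)}$, $\mathcal S^*$ the set of adjoints of its elements, and $\mathcal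 S_0=\mathrm{span}\{L^{(\mathbf n)}:|\mathbf n|\ge1\}$. Put $z\mathbf L^*=\sum_j z_jL_j^*$. A state on $\mathcal S+\mathcal S^*$ means a positive linear functional (not necessarily normalized), identified with its unique positive extension to the norm closure, which contains $q^*p$ for all $p,q\in\mathcal S$. The state $\mu$ represents $b$ if $$\frac{1+b(z)}{1-b(z)}=\mu\big((I+z\mathbf L^* )(I-z\mathbf L^* )^{-1}\big)+i\,\mathrm{Im}\Big(\frac{1+b(0)}{1-b(0)}\Big),\quad z\in\mathbb B^d;$$ such a $\mu$ exists and is unique. $P^2(\mu)$ is the Hilbert space obtained from $\mathcal S$ with the pre-inner product $\langle p,q\rangle=\mu(q^*p)$ by quotienting null vectors and completing; $[p]$ is the class of $p$. $P^2_0(\mu)$ is the closed span of $\{[p]:p\in\mathcal S_0\}$. The state $\mu$ is quasi-extreme if $P^2_0(\mu)=P^2(\mu)$, and $b$ is quasi-extreme if the state $\mu$ representing it is quasi-extreme. *)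

(* Defs.v *)
From HB Require Import structures.
From mathcomp Require Import all_boot all_order all_algebra.
From mathcomp Require Import complex ring.
From mathcomp Require Import boolp classical_sets functions cardinality.
From mathcomp Require Import fsbigop reals ereal topology normedtype sequences.
From mathcomp Require Import esum numfun.

Set Implicit Arguments.
Unset Strict Implicit.
Unset Printing Implicit Defensive.

Import Order.TTheory GRing.Theory Num.Theory.
Import numFieldNormedType.Exports.
Import ComplexField.Normc.

Local Open Scope classical_set_scope.
Local Open Scope ring_scope.

Section Ball.
Variables (R : realType) (d : nat).
Local Notation C := R[i].

(* z w^* *)
Definition cdot (z w : 'rV[C]_d) : C := \sum_j z 0 j * (w 0 j)^*.

Definition enorm (z : 'rV[C]_d) : R := Num.sqrt (complex.Re (cdot z z)).

Definition cball : Type := {z : 'rV[C]_d | enorm z < 1}.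

Definition pt (z : cball) : 'rV[C]_d := sval z.

Fact enorm0_lt1 : enorm 0 < 1.
Proof.
rewrite /enorm /cdot big1 => [|j _]; last by rewrite mxE mul0r.
by rewrite sqrtr0 ltr01.
Qed.

Definition cball0 : cball := exist _ 0 enorm0_lt1.

(* complex Frechet differentiability at every point; the ball is open, so the
   difference quotients may be taken along points of the ball *)
Definition holomorphic (f : cball -> C) : Prop :=
  forall z : cball, exists a : 'I_d -> C,
  forall e : R, 0 < e -> exists2 r : R, 0 < r &
  forall w : cball, enorm (pt w - pt z) < r ->
    normc (f w - f z - \sum_j a j * (pt w 0 j - pt z 0 j))
      <= e * enorm (pt w - pt z).

End Ball.

(* A Hilbert space of functions on X (a subspace of X -> C with a complete
   inner product, linear in the first variable) in which k^~ w represents the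
   evaluation at w.  The values of fip outside the space are irrelevant.  By
   Moore-Aronszajn, k determines the space and its inner product. *)
Record rkhs (R : realType) (X : Type) (k : X -> X -> R[i]) := RKHS {
  fspace : set (X -> R[i]);
  fip : (X -> R[i]) -> (X -> R[i]) -> R[i];
  fspace0 : fspace (fun=> 0);
  fspaceP : forall (c : R[i]) f g, fspace f -> fspace g ->
    fspace (fun x => c * f x + g x);
  fip_linear : forall (c : R[i]) f g h, fspace f -> fspace g -> fspace h ->
    fip (fun x => c * f x + g x) h = c * fip f h + fip g h;
  fip_conj : forall f g, fspace f -> fspace g -> fip g f = (fip f g)^*;
  fip_ge0 : forall f, fspace f -> 0 <= fip f f;
  fip_eq0 : forall f, fspace f -> fip f f = 0 -> f = (fun=> 0);
  fspace_complete : forall u : nat -> X -> R[i], (forall n, fspace (u n)) ->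
    let dist f g :=
      Num.sqrt (complex.Re (fip (fun x => f x - g x) (fun x => f x - g x))) in
    (forall e : R, 0 < e -> exists N : nat,
      forall m n, (N <= m)%N -> (N <= n)%N -> dist (u m) (u n) < e) ->
    exists2 f, fspace f & forall e : R, 0 < e -> exists N : nat,
      forall n, (N <= n)%N -> dist (u n) f < e;
  fspace_kernel : forall w, fspace (fun z => k z w);
  fip_kernel : forall f w, fspace f -> fip f (fun z => k z w) = f w
}.

Definition fnorm (R : realType) (X : Type) (k : X -> X -> R[i]) (H : rkhs k)
  (f : X -> R[i]) : R := Num.sqrt (complex.Re (fip H f f)).

Section Multipliers.
Variables (R : realType) (d : nat).
Local Notation C := R[i].
Local Notation cball := (cball R d).

Definition drury_arveson_kernel (z w : cball) : C :=
  (1 - cdot (pt z) (pt w))^-1.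

Definition dbr_kernel (b : cball -> C) (z w : cball) : C :=
  (1 - b z * (b w)^*) / (1 - cdot (pt z) (pt w)).

Definition contractive_multiplier (H2 : rkhs drury_arveson_kernel)
    (b : cball -> C) : Prop :=
  holomorphic b /\
  forall f, fspace H2 f ->
    fspace H2 (fun z => b z * f z) /\
    fnorm H2 (fun z => b z * f z) <= fnorm H2 f.

End Multipliers.

Section L2.
Variables (R : realType) (d : nat).
Local Notation C := R[i].

Local Notation word := (seq 'I_d).

Definition sq_summable (f : word -> C) : Prop :=
  (\esum_(w in [set: word]) ((normc (f w)) ^+ 2)%:E < +oo)%E.

Definition sq_summableb : {pred word -> C} := fun f => `[< sq_summable f >].

Fact sq_summable_submod : submod_closed sq_summableb.
Proof.
have n0 (x : C) : 0 <= normc x by case: x => a a'; rewrite sqrtr_ge0.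
have sq_ge0 (r : R) : (0 <= (r ^+ 2)%:E)%E by rewrite lee_fin sqr_ge0.
split=> [|c f g /asboolP ff /asboolP fg]; apply/asboolP; rewrite /sq_summable.
  rewrite esum1 ?ltry // => w _.
  by rewrite [X in normc X](_ : _ = 0) // normc0 expr0n.
pose a (h : word -> C) w := ((normc (h w)) ^+ 2)%:E.
have nn h w : (0 <= a h w)%E by apply: sq_ge0.
have fcf : (\esum_(w in [set: word]) a (c *: f)%R w < +oo)%E.
  rewrite (@eq_esum _ _ _ _ (fun w => (normc c ^+ 2)%:E * a f w)%E); last first.
    by move=> w _; rewrite /a -EFinM -exprMn -normcM.
  apply: (@le_lt_trans _ _ ((normc c ^+ 2)%:E * \esum_(w in setT) a f w)%E).
    apply: ge_ereal_sup => _ [X XT <-]; rewrite -ge0_mule_fsumr; last exact: nn.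
    by rewrite lee_wpmul2l //; apply: esum_ge; exists X.
  by apply: lte_mul_pinfty.
apply: (@le_lt_trans _ _ (\esum_(w in [set: word])
   ((a (c *: f)%R w + a (c *: f)%R w) + (a g w + a g w)))%E).
  apply: le_esum => w _; rewrite /a -!EFinD lee_fin.
  set x := normc ((c *: f) w); set y := normc (g w).
  apply: (@le_trans _ _ ((x + y) ^+ 2)).
    rewrite lerXn2r ?nnegrE ?addr_ge0 ?n0 //.
    exact: (le_normcD ((c *: f) w) (g w)).
  rewrite -!mulr2n -subr_ge0.
  have -> : x ^+ 2 *+ 2 + y ^+ 2 *+ 2 - (x + y) ^+ 2 = (x - y) ^+ 2.
    by ring.
  exact: sqr_ge0.
by rewrite !esumD //= ?lte_add_pinfty // => w _; rewrite adde_ge0.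
Qed.

HB.instance Definition _ := GRing.isSubmodClosed.Build C (word -> C)
  sq_summableb sq_summable_submod.

Record l2 := L2 { l2fun :> word -> C; l2P : l2fun \in sq_summableb }.

HB.instance Definition _ := [isSub for l2fun].
HB.instance Definition _ := [Choice of l2 by <:].
HB.instance Definition _ := [SubChoice_isSubLmodule of l2 by <:].

(* unordered sums of absolutely summable families *)
Definition rsum (f : word -> R) : R :=
  fine (\esum_(w in [set: word]) (EFin \o f)^\+ w
        - \esum_(w in [set: word]) (EFin \o f)^\- w)%E.

Definition csum (f : word -> C) : C :=
  Complex (rsum (fun w => complex.Re (f w))) (rsum (fun w => complex.Im (f w))).

Definition l2dot (f g : l2) : C := csum (fun w => f w * (g w)^*).

Definition l2norm (f : l2) : R := Num.sqrt (complex.Re (l2dot f f)).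

Fact xi_subproof (w : word) :
  (fun v : word => (v == w)%:R : C) \in sq_summableb.
Proof.
apply/asboolP; rewrite /sq_summable.
rewrite (_ : (fun _ => _) = (fun v : word => if v \in [set w] then 1%E else 0%E)).
  by rewrite -esum_mkcond esum_set1 ?ltry.
have vE v : (v \in [set w]) = (v == w).
  by apply/idP/eqP => [/set_mem|->] //; apply/mem_set.
apply/funext => v; rewrite vE; case: eqP => _.
  by rewrite normc1 expr1n.
by rewrite normc0 expr0n.
Qed.

Definition xi (w : word) : l2 := L2 (xi_subproof w).

(* linearity and boundedness are imposed by bounded_operator *)
Local Notation op := (l2 -> l2).

Definition opnorm_le (A : op) (M : R) : Prop :=
  forall f : l2, l2norm (A f) <= M * l2norm f.

Definition bounded_operator (A : op) : Prop :=
  (forall (c : C) (f g : l2), A (c *: f + g) = c *: A f + A g) /\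
  exists M : R, opnorm_le A M.

Definition is_adjoint (A B : op) : Prop :=
  forall f g : l2, l2dot (A f) g = l2dot f (B g).

Definition adj (A : op) : op := xget 0 [set B | is_adjoint A B].

Definition op1 : op := idfun.

Definition opinv (A : op) : op :=
  xget 0 [set B : op | A \o B = op1 /\ B \o A = op1].

Definition opspan (G : set op) : set op :=
  [set A | exists (n : nat) (c : 'I_n -> C) (B : 'I_n -> op),
     (forall k, G (B k)) /\ A = \sum_k c k *: B k].

Definition opclosure (P : set op) : set op :=
  [set A | bounded_operator A /\
     forall e : R, 0 < e -> exists2 B, P B & opnorm_le (A - B) e].

Definition Lfun (i : 'I_d) (f : word -> C) (v : word) : C :=
  if v is j :: w then if j == i then f w else 0 else 0.

Fact Lop_subproof (i : 'I_d) (f : l2) : Lfun i f \in sq_summableb.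
Proof.
apply/asboolP; rewrite /sq_summable.
rewrite (_ : (fun _ => _) = (fun v => if v \in range (cons i)
  then (normc (Lfun i f v) ^+ 2)%:E else 0%E)).
  rewrite -esum_mkcond esum_image; last by move=> u v _ _ [].
  rewrite (eq_esum (b := fun w => (normc (f w) ^+ 2)%:E)) => [|w _].
    exact/asboolP/l2P.
  by rewrite /= eqxx.
apply/funext => -[|j w]; case: ifPn => // nr; rewrite /Lfun.
  by rewrite normc0 expr0n.
case: eqP => [ji|_]; last by rewrite normc0 expr0n.
by move: nr; rewrite notin_setE; case; exists w; rewrite ?ji.
Qed.

Definition Lop (i : 'I_d) : op := fun f => L2 (Lop_subproof i f).

Lemma Lop_xi (i : 'I_d) (w : word) : Lop i (xi w) = xi (i :: w).
Proof.
apply/val_inj/funext => -[|j v] //=; rewrite eqseq_cons.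
by case: eqP.
Qed.

Definition Lword (w : word) : op := foldr (fun i A => Lop i \o A) op1 w.

Definition mweight (n : {ffun 'I_d -> nat}) : nat := (\sum_i n i)%N.

(* L^(n): a word is recorded by its length |n| and its letter counts *)
Definition Lsym (n : {ffun 'I_d -> nat}) : op :=
  \sum_(w : (mweight n).-tuple 'I_d |
           [forall i, count_mem i (val w) == n i]) Lword w.

Definition symop : set op := opclosure (opspan (range Lsym)).

Definition symop0 : set op :=
  opspan [set A | exists2 n, (1 <= mweight n)%N & A = Lsym n].

(* z L^* *)
Definition zLadj (z : 'rV[C]_d) : op := \sum_j z 0 j *: adj (Lop j).

(* the norm closure of S + S^*, where S is symop; it contains adj q \o p for
   p, q in S *)
Definition SSadj : set op :=
  opclosure [set A | exists p q, [/\ symop p, symop q & A = p + adj q]].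

Definition positive_operator (A : op) : Prop :=
  forall f : l2, 0 <= l2dot (A f) f.

(* A positive linear functional on the closure of S + S^*, not necessarily
   normalized; its values on other operators are irrelevant *)
Definition is_state (mu : op -> C) : Prop :=
  (forall (c : C) (A B : op), SSadj A -> SSadj B ->
     mu (c *: A + B) = c * mu A + mu B) /\
  (forall A : op, SSadj A -> positive_operator A -> 0 <= mu A).

Definition cayley (b : cball R d -> C) (z : cball R d) : C :=
  (1 + b z) / (1 - b z).

Definition represents (mu : op -> C) (b : cball R d -> C) : Prop :=
  forall z : cball R d,
    cayley b z =
      mu ((op1 + zLadj (pt z)) \o opinv (op1 - zLadj (pt z)))
      + 'i * 'Im (cayley b (cball0 R d)).

Definition Sdot (mu : op -> C) (p q : op) : C := mu (adj q \o p).

Definition Snorm (mu : op -> C) (p : op) : R :=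
  Num.sqrt (complex.Re (Sdot mu p p)).

(* The completion of symop modulo null vectors is represented by the Cauchy
   sequences of symop for the seminorm Snorm; two of them define the same
   element when their P2dist is 0 *)
Definition P2 (mu : op -> C) : set (nat -> op) :=
  [set u | (forall n, symop (u n)) /\
     forall e : R, 0 < e -> exists N : nat,
       forall m n, (N <= m)%N -> (N <= n)%N -> Snorm mu (u m - u n) < e].

Definition P2dist (mu : op -> C) (u v : nat -> op) : R :=
  limn (fun n => Snorm mu (u n - v n)).

Definition P2class (p : op) : nat -> op := fun=> p.

Definition P20 (mu : op -> C) : set (nat -> op) :=
  [set u | P2 mu u /\
     forall e : R, 0 < e -> exists2 p, symop0 p & P2dist mu u (P2class p) < e].

Definition quasi_extreme_state (mu : op -> C) : Prop := P20 mu = P2 mu.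

Definition quasi_extreme (b : cball R d -> C) : Prop :=
  exists mu : op -> C,
    [/\ is_state mu, represents mu b & quasi_extreme_state mu].

End L2.

(* Main.v *)
From HB Require Import structures.
From mathcomp Require Import all_boot all_order all_algebra.
From mathcomp Require Import complex ring lra zify.
From mathcomp Require Import boolp classical_sets functions cardinality.
From mathcomp Require Import fsbigop reals ereal topology normedtype sequences.
From mathcomp Require Import esum numfun.
Require Import Defs.

(** Let [G = (1 + b) / (1 - b)].  The kernels of H(b), rescaled to represent
    [f |-> f w / (1 - b w)], form a family [nkernel w] whose Gram matrix is
    [K z w = (G z + conj (G w)) / 2 / (1 - <z, w>)].  All three conditions say that
    [1 - b] belongs to H(b); for [b] itself this is [fspace_b_iff].  The function
    [1 - b] enters because, up to a factor, it is the only candidate for a vector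
    orthogonal to all the differences [ndiff w = nkernel w - nkernel 0].

    Multiplication by the coordinates.  The kernel satisfies
    [(1 - <z, w>) K z w = K z 0 + K 0 w - K 0 0] ([clark_gleason]).  Read as an
    identity of functions of [z], it exhibits a nonzero multiple of [1 - b] as a
    combination of kernels and of kernels multiplied by coordinates
    ([fspace_1b_of_shift_invariant]).  Read as an identity of Gram matrices, it
    says that [ndiff w |-> (conj (w_j) nkernel w)_j] is isometric.  If [1 - b] is
    in H(b), then the sum of the coefficients is a bounded functional on
    combinations of the [nkernel w], so the adjoint of multiplication by [z_j] is
    bounded on them, and the Riesz theorem produces [z_j f]
    ([shift_invariant_of_1b]).

    Quasi-extremity.  Let [k_w] be the inverse of [1 - Lrow w], where [Lrow w] is
    the sum of the [conj (w_j) L_j].  Because the [L_j] are isometries with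
    orthogonal ranges, the product of the adjoint of [k_z] with [k_w] is a linear
    combination of these two operators and the identity ([adj_resolvent_comp]).
    It follows that for every state representing [b] the Gram matrix of the
    classes of the [k_w] is again [K] ([Sdot_resolvent]).  The [k_w] span a dense
    subspace of the operator space ([symopE]), so the Hilbert space of the state
    is a copy of H(b) in which the unit corresponds to [nkernel 0] and the
    operators without constant term to the closed span of the [ndiff w].  Thus the state is
    not quasi-extreme exactly when something is orthogonal to all the [ndiff w],
    that is, when [1 - b] is in H(b) ([not_quasi_extreme_of_1b],
    [quasi_extreme_of_dense]).

    Existence of the state when [1 - b] is not in H(b).  The [ndiff w] then span a
    dense subspace and the isometry above extends to a column isometry
    [(B_j)_j] on H(b) ([isometric_extension]).  Applying the [B_j] along a word [a],
    starting from [nkernel 0], gives vectors [x a] with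
    [\sum_j <x (a j), x (c j)> = <x a, x c>].  The functional
    [L_a |-> <x nil, x a>] is the limit of the Fejer means
    [N^-1 \sum_(|u|, |v| < N) <A xi_u, xi_v> <x u, x v>], which are positive by
    Schur's product theorem, hence it is a state; expanding [K w 0] along words
    shows that it represents [b] ([exists_state]). *)

Set Implicit Arguments.
Unset Strict Implicit.
Unset Printing Implicit Defensive.

Import Order.TTheory GRing.Theory Num.Theory.
Import numFieldNormedType.Exports.
Import ComplexField.Normc.

Local Open Scope classical_set_scope.
Local Open Scope ring_scope.

(** * Complex numbers and real estimates *)
Section ComplexFacts.
Variable R : realType.
Local Notation C := R[i].
Implicit Types x y : C.

Lemma ReD x y : complex.Re (x + y) = complex.Re x + complex.Re y.
Proof. by case: x; case: y. Qed.

Lemma ReN x : complex.Re (- x) = - complex.Re x.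
Proof. by case: x. Qed.

Lemma ImB x y : complex.Im (x - y) = complex.Im x - complex.Im y.
Proof. by case: x; case: y. Qed.

Lemma ReB x y : complex.Re (x - y) = complex.Re x - complex.Re y.
Proof. by case: x; case: y. Qed.

Lemma ReJ x : complex.Re x^* = complex.Re x.
Proof. by case: x. Qed.

Lemma conjCD x y : (x + y)^* = x^* + y^*.
Proof. exact: rmorphD. Qed.

Lemma conjCN x : (- x)^* = - x^*.
Proof. exact: rmorphN. Qed.

Lemma conjCB x y : (x - y)^* = x^* - y^*.
Proof. exact: rmorphB. Qed.

Lemma conjCM x y : (x * y)^* = x^* * y^*.
Proof. exact: rmorphM. Qed.

Lemma conjCV x : (x^-1)^* = (x^*)^-1.
Proof. exact: fmorphV. Qed.

Lemma conjC_real (r : R) : (r%:C%C)^* = r%:C%C :> C.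
Proof. exact: (conjc_real r). Qed.

Lemma conjC_sum I (s : seq I) (P : pred I) (F : I -> C) :
  (\sum_(i <- s | P i) F i)^* = \sum_(i <- s | P i) (F i)^*.
Proof. exact: rmorph_sum. Qed.

Lemma ReZ (r : R) x : complex.Re (r%:C%C * x) = r * complex.Re x.
Proof. by case: x => a b /=; rewrite mul0r subr0. Qed.

Lemma Re_sum I (s : seq I) (P : pred I) (F : I -> C) :
  complex.Re (\sum_(i <- s | P i) F i) = \sum_(i <- s | P i) complex.Re (F i).
Proof. by apply: (big_morph (@complex.Re R) ReD). Qed.

Lemma normc_ge0 x : 0 <= normc x.
Proof. by case: x => a b; apply: sqrtr_ge0. Qed.

Lemma normc_real (r : R) : normc r%:C%C = `|r|.
Proof. by rewrite /= expr0n /= addr0 sqrtr_sqr. Qed.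

Lemma normcJ x : normc x^* = normc x.
Proof. by case: x => a b /=; rewrite sqrrN. Qed.

Lemma mul_conj x : x * x^* = (normc x ^+ 2)%:C%C.
Proof.
case: x => a b /=; rewrite sqr_sqrtr ?addr_ge0 ?sqr_ge0 //.
by apply/eqP; rewrite eq_complex /=; apply/andP; split; apply/eqP; ring.
Qed.

Lemma Re_le_normc x : `|complex.Re x| <= normc x.
Proof.
case: x => a b /=; rewrite -sqrtr_sqr ler_wsqrtr // lerDl; exact: sqr_ge0.
Qed.

Lemma Im_le_normc x : `|complex.Im x| <= normc x.
Proof.
case: x => a b /=; rewrite -sqrtr_sqr ler_wsqrtr // lerDr; exact: sqr_ge0.
Qed.

Lemma normc_le_ReIm x : normc x <= `|complex.Re x| + `|complex.Im x|.
Proof.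
case: x => a b /=.
rewrite -[leRHS]ger0_norm ?addr_ge0 // -sqrtr_sqr ler_wsqrtr //.
rewrite sqrrD -[a ^+ 2]real_normK ?num_real // -[b ^+ 2]real_normK ?num_real //.
by rewrite lerD2r lerDl mulrn_wge0 // mulr_ge0.
Qed.

Lemma ge0_complexE x : 0 <= x -> x = (complex.Re x)%:C%C /\ 0 <= complex.Re x.
Proof. by case: x => a b; rewrite lecE /= => /andP[/eqP -> ->]. Qed.

Lemma normcB x y : normc (x - y) = normc (y - x).
Proof. by rewrite -normcN opprB. Qed.

Lemma normc_sum I (s : seq I) (P : pred I) (F : I -> C) :
  normc (\sum_(i <- s | P i) F i) <= \sum_(i <- s | P i) normc (F i).
Proof.
elim/big_rec2: _ => [|i y x _ le_xy]; first by rewrite normc0.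
by apply: le_trans (le_normcD _ _) _; rewrite lerD2l.
Qed.

Lemma le0_eps (x c : R) : (forall e, 0 < e -> x <= c * e) -> x <= 0.
Proof.
move=> xe; rewrite leNgt; apply/negP => x0.
have c1 : 0 < `|c| + 1 by rewrite ltr_wpDl.
have := xe (x / (`|c| + 1) / 2) (divr_gt0 (divr_gt0 x0 c1) (ltr0n _ 2)).
apply/negP; rewrite -ltNge -mulrA mulrCA -[ltRHS]mulr1 ltr_pM2l //.
rewrite mulrA ltr_pdivrMr ?ltr0n // mul1r ltr_pdivrMr //.
have := ler_norm c; have := normr_ge0 c; lra.
Qed.

(** The discriminant criterion, scaled so that it also covers [b = 0]: this is
    the form that Cauchy-Schwarz for a degenerate inner product needs. *)
Lemma real_discriminant (a b n : R) : 0 <= b -> 0 <= n ->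
  (forall r, 0 <= a - 2 * r * n + r ^+ 2 * n * b) -> n <= a * b.
Proof.
rewrite le_eqVlt => /orP[/eqP <-|b0] n0 key; rewrite ?mulr0.
  rewrite leNgt; apply/negP => n1; have := key ((a + 1) / (2 * n)).
  rewrite mulr0 addr0 (_ : a - 2 * ((a + 1) / (2 * n)) * n = - 1).
    by rewrite lerNr oppr0 ler10.
  by field; rewrite gt_eqF.
have := key b^-1; rewrite (_ : _ + _ = a - n / b).
  by rewrite subr_ge0 ler_pdivrMr.
by field; rewrite gt_eqF.
Qed.

Lemma small_inv (e : R) : 0 < e ->
  exists N : nat, forall n, (N <= n)%N -> (n.+1%:R^-1 : R) < e.
Proof.
move=> e0; have := archi_boundP (ltW (_ : 0 < e^-1)); rewrite invr_gt0 e0.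
move=> /(_ isT) h; exists (Num.bound e^-1) => n le_n.
rewrite invf_plt ?posrE ?ltr0n //; apply: lt_le_trans h _.
by rewrite ler_nat; apply: leq_trans le_n _.
Qed.

Lemma geometric_small (x D e : R) : 0 <= x -> x < 1 -> 0 < e ->
  exists n : nat, x ^+ n.+1 * D <= e.
Proof.
move=> x0 x1 e0.
have /cvgrPdist_lt/(_ (e / (`|D| + 1))) : (fun n => x ^+ n) @ \oo --> (0 : R).
  by apply: cvg_expr; rewrite ger0_norm.
have D1 : 0 < `|D| + 1 by rewrite ltr_wpDl.
move=> /(_ (divr_gt0 e0 D1))[N _ /(_ N.+1 (leqnSn _))] /=.
rewrite sub0r normrN ger0_norm ?exprn_ge0 // ltr_pdivlMr // => h; exists N.
apply: le_trans (ltW h); rewrite ler_wpM2l ?exprn_ge0 //.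
by have := ler_norm D; lra.
Qed.

Lemma sum_CauchySchwarz (I : Type) (r : seq I) (a c : I -> R) :
  (\sum_(i <- r) a i * c i) ^+ 2 <= (\sum_(i <- r) a i ^+ 2) * (\sum_(i <- r) c i ^+ 2).
Proof.
have c0 : 0 <= \sum_(i <- r) c i ^+ 2 by apply: sumr_ge0 => i _; apply: sqr_ge0.
apply: real_discriminant c0 (sqr_ge0 _) _ => t.
set S := \sum_(i <- r) a i * c i.
have key (u : R) : \sum_(i <- r) (a i - u * c i) ^+ 2 =
    \sum_(i <- r) a i ^+ 2 - 2 * u * S + u ^+ 2 * \sum_(i <- r) c i ^+ 2.
  rewrite /S !mulr_sumr -sumrN -!big_split.
  by apply: eq_bigr => i _ /=; ring.
have -> : \sum_(i <- r) a i ^+ 2 - 2 * t * S ^+ 2 + t ^+ 2 * S ^+ 2 * \sum_(i <- r) c i ^+ 2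
    = \sum_(i <- r) (a i - t * S * c i) ^+ 2 by rewrite key; ring.
by apply: sumr_ge0 => i _; apply: sqr_ge0.
Qed.

End ComplexFacts.

(** * Semi-inner products *)
Section SemiInner.
Variables (R : realType) (V : lmodType R[i]).
Local Notation C := R[i].

(** The form may be degenerate and is only constrained on the subspace [sdom]:
    the space H(b), the Fock space and the pre-Hilbert space of a state on the
    operator system are all instances. *)
Record sip := Sip {
  sdom : set V;
  sdot : V -> V -> C;
  sdom0 : sdom 0;
  sdomP : forall (c : C) f g, sdom f -> sdom g -> sdom (c *: f + g);
  sdot_linear : forall (c : C) f g h, sdom f -> sdom g -> sdom h ->
    sdot (c *: f + g) h = c * sdot f h + sdot g h;
  sdotC : forall f g, sdom f -> sdom g -> sdot g f = (sdot f g)^*;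
  sdot_ge0 : forall f, sdom f -> 0 <= sdot f f
}.

Variable s : sip.
Local Notation D := (sdom s).
Local Notation "<< f , g >>" := (sdot s f g).

Definition snorm f : R := Num.sqrt (complex.Re <<f, f>>).

Lemma sdomZ c f : D f -> D (c *: f).
Proof. by move=> Df; rewrite -[_ *: _]addr0; apply/sdomP/sdom0. Qed.

Lemma sdomD f g : D f -> D g -> D (f + g).
Proof. by move=> Df Dg; rewrite -[f]scale1r; apply: sdomP. Qed.

Lemma sdomN f : D f -> D (- f).
Proof. by move=> Df; rewrite -scaleN1r; apply: sdomZ. Qed.

Lemma sdomB f g : D f -> D g -> D (f - g).
Proof. by move=> Df Dg; apply: sdomD => //; apply: sdomN. Qed.

Lemma sdom_sum I (r : seq I) (P : pred I) (F : I -> V) :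
  (forall i, P i -> D (F i)) -> D (\sum_(i <- r | P i) F i).
Proof.
move=> DF; elim/big_rec: _ => [|i y Pi Dy]; first exact: sdom0.
by apply: sdomD => //; apply: DF.
Qed.

Lemma sdotDl f g h : D f -> D g -> D h -> <<f + g, h>> = <<f, h>> + <<g, h>>.
Proof. by move=> *; rewrite -{1}[f]scale1r sdot_linear // mul1r. Qed.

Lemma sdot0l h : D h -> <<0, h>> = 0.
Proof.
move=> Dh; have D0 := sdom0 s.
by apply: (addrI <<0, h>>); rewrite -sdotDl // !addr0.
Qed.

Lemma sdotZl c f h : D f -> D h -> <<c *: f, h>> = c * <<f, h>>.
Proof.
move=> Df Dh; have D0 := sdom0 s.
by rewrite -[c *: f]addr0 sdot_linear // sdot0l // addr0.
Qed.

Lemma sdotNl f h : D f -> D h -> <<- f, h>> = - <<f, h>>.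
Proof. by move=> *; rewrite -scaleN1r sdotZl // mulN1r. Qed.

Lemma sdotBl f g h : D f -> D g -> D h -> <<f - g, h>> = <<f, h>> - <<g, h>>.
Proof. by move=> *; rewrite sdotDl ?sdotNl //; apply: sdomN. Qed.

Lemma sdot_suml I (r : seq I) (P : pred I) (F : I -> V) h :
  (forall i, P i -> D (F i)) -> D h ->
  <<\sum_(i <- r | P i) F i, h>> = \sum_(i <- r | P i) <<F i, h>>.
Proof.
move=> DF Dh.
suff [] : D (\sum_(i <- r | P i) F i) /\
   <<\sum_(i <- r | P i) F i, h>> = \sum_(i <- r | P i) <<F i, h>> by [].
elim/big_rec2: _ => [|i y x Pi [Dx <-]]; first by split;[exact: sdom0|exact: sdot0l].
by split; [apply: sdomD => //; apply: DF|rewrite sdotDl //; apply: DF].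
Qed.

Lemma sdotDr f g h : D f -> D g -> D h -> <<h, f + g>> = <<h, f>> + <<h, g>>.
Proof.
move=> Df Dg Dh; rewrite sdotC ?sdotDl //; last exact: sdomD.
by rewrite rmorphD /= -!sdotC.
Qed.

Lemma sdotZr c f h : D f -> D h -> <<h, c *: f>> = c^* * <<h, f>>.
Proof.
move=> Df Dh; rewrite sdotC ?sdotZl //; last exact: sdomZ.
by rewrite rmorphM /= -sdotC.
Qed.

Lemma sdot0r h : D h -> <<h, 0>> = 0.
Proof. by move=> Dh; rewrite sdotC ?sdot0l ?rmorph0 //; apply: sdom0. Qed.

Lemma sdotNr f h : D f -> D h -> <<h, - f>> = - <<h, f>>.
Proof. by move=> *; rewrite -scaleN1r sdotZr // rmorphN1 mulN1r. Qed.

Lemma sdotBr f g h : D f -> D g -> D h -> <<h, f - g>> = <<h, f>> - <<h, g>>.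
Proof. by move=> *; rewrite sdotDr ?sdotNr //; apply: sdomN. Qed.

Lemma sdot_sumr I (r : seq I) (P : pred I) (F : I -> V) h :
  (forall i, P i -> D (F i)) -> D h ->
  <<h, \sum_(i <- r | P i) F i>> = \sum_(i <- r | P i) <<h, F i>>.
Proof.
move=> DF Dh; rewrite sdotC ?sdot_suml //; last exact: sdom_sum.
by rewrite rmorph_sum; apply: eq_bigr => i Pi; rewrite /= -sdotC //; apply: DF.
Qed.

Lemma snorm_ge0 f : 0 <= snorm f. Proof. exact: sqrtr_ge0. Qed.

Lemma snormE f : D f -> <<f, f>> = (snorm f ^+ 2)%:C%C.
Proof.
by move=> Df; have [-> h] := ge0_complexE (sdot_ge0 Df); rewrite sqr_sqrtr.
Qed.

Lemma snorm_sqr f : D f -> snorm f ^+ 2 = complex.Re <<f, f>>.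
Proof. by move=> Df; rewrite snormE. Qed.

Lemma snormDsqr f g : D f -> D g ->
  snorm (f + g) ^+ 2 = snorm f ^+ 2 + snorm g ^+ 2 + 2 * complex.Re <<f, g>>.
Proof.
move=> Df Dg; have Dfg : D (f + g) by apply: sdomD.
rewrite !snorm_sqr // sdotDl // !sdotDr // (sdotC Df Dg) !ReD ReJ; ring.
Qed.

Lemma snormZ c f : D f -> snorm (c *: f) = normc c * snorm f.
Proof.
move=> Df; rewrite /snorm sdotZl ?sdotZr //; last exact: sdomZ.
rewrite mulrA mul_conj ReZ sqrtrM ?sqr_ge0 // sqrtr_sqr.
by rewrite ger0_norm // normc_ge0.
Qed.

Lemma snormN f : D f -> snorm (- f) = snorm f.
Proof. by move=> Df; rewrite -scaleN1r snormZ // normcN normc1 mul1r. Qed.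

Lemma snorm0 : snorm 0 = 0.
Proof. by rewrite /snorm sdot0l ?sqrtr0 //; apply: sdom0. Qed.

Lemma CauchySchwarz f g : D f -> D g ->
  normc <<f, g>> <= snorm f * snorm g.
Proof.
move=> Df Dg; set c := <<f, g>>.
have key (r : R) : 0 <= snorm f ^+ 2 - 2 * r * normc c ^+ 2
                        + r ^+ 2 * normc c ^+ 2 * snorm g ^+ 2.
  have Dt : D ((- r%:C%C * c) *: g) by apply: sdomZ.
  have := sqr_ge0 (snorm (f + (- r%:C%C * c) *: g)).
  rewrite snormDsqr // snormZ // sdotZr // -/c conjCM conjCN conjC_real -mulrA.
  rewrite [c^* * c]mulrC mul_conj.
  rewrite !mulNr normcN normcM normc_real ReN ReZ !exprMn real_normK ?num_real //.

  by rewrite [complex.Re _]/=; congr (_ <= _); ring.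
rewrite -ler_sqr ?nnegrE ?mulr_ge0 ?snorm_ge0 ?normc_ge0 // exprMn.
by apply: real_discriminant key; rewrite sqr_ge0.
Qed.

Lemma ler_snormD f g : D f -> D g -> snorm (f + g) <= snorm f + snorm g.
Proof.
move=> Df Dg; rewrite -ler_sqr ?nnegrE ?addr_ge0 ?snorm_ge0 //.
rewrite snormDsqr // sqrrD.
have := le_trans (ler_norm _) (le_trans (Re_le_normc _) (CauchySchwarz Df Dg)).
rewrite -mulr_natl; lra.
Qed.

Lemma ler_snormB f g : D f -> D g -> snorm (f - g) <= snorm f + snorm g.
Proof. by move=> Df Dg; rewrite -(snormN Dg) ler_snormD //; apply: sdomN. Qed.

Lemma snormC f g : D f -> D g -> snorm (f - g) = snorm (g - f).
Proof. by move=> Df Dg; rewrite -opprB snormN //; apply: sdomB. Qed.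

Lemma snorm_dist f g h : D f -> D g -> D h ->
  snorm (f - h) <= snorm (f - g) + snorm (g - h).
Proof.
by move=> *; rewrite -[f - h](subrKA g) ler_snormD //; apply: sdomB.
Qed.

Lemma parallelogram f g : D f -> D g ->
  snorm (f - g) ^+ 2 = 2 * snorm f ^+ 2 + 2 * snorm g ^+ 2 - snorm (f + g) ^+ 2.
Proof.
move=> Df Dg; rewrite !snormDsqr //; last exact: sdomN.
rewrite snormN // sdotNr // ReN; ring.
Qed.

End SemiInner.

(** * Riesz representation and Gram matrices *)
Section Riesz.
Variables (R : realType) (V : lmodType R[i]) (s : sip V).
Local Notation C := R[i].
Local Notation D := (sdom s).
Local Notation "<< f , g >>" := (sdot s f g).
Local Notation "`[ f ]" := (snorm s f).

Definition complete_sip := forall u : nat -> V, (forall n, D (u n)) ->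
  (forall e : R, 0 < e -> exists N : nat,
     forall m n, (N <= m)%N -> (N <= n)%N -> `[u m - u n] < e) ->
  exists2 f, D f & forall e : R, 0 < e -> exists N : nat,
     forall n, (N <= n)%N -> `[u n - f] < e.

Section Comb.
Variable I : Type.

Definition lincomb (e : I -> V) (r : seq (C * I)) : V :=
  \sum_(p <- r) p.1 *: e p.2.

Definition lval (l : I -> C) (r : seq (C * I)) : C :=
  \sum_(p <- r) p.1 * l p.2.

Definition cscale (c : C) (r : seq (C * I)) := [seq (c * p.1, p.2) | p <- r].

Lemma lincomb_cat e r1 r2 : lincomb e (r1 ++ r2) = lincomb e r1 + lincomb e r2.
Proof. exact: big_cat. Qed.

Lemma lval_cat l r1 r2 : lval l (r1 ++ r2) = lval l r1 + lval l r2.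
Proof. exact: big_cat. Qed.

Lemma lincomb_scale e c r : lincomb e (cscale c r) = c *: lincomb e r.
Proof.
by rewrite /lincomb big_map scaler_sumr; apply: eq_bigr => p _; rewrite scalerA.
Qed.

Lemma lval_scale l c r : lval l (cscale c r) = c * lval l r.
Proof.
by rewrite /lval big_map mulr_sumr; apply: eq_bigr => p _; rewrite mulrA.
Qed.

Lemma lincomb1 e c i : lincomb e [:: (c, i)] = c *: e i.
Proof. exact: big_seq1. Qed.

Lemma lval1 l c i : lval l [:: (c, i)] = c * l i.
Proof. exact: big_seq1. Qed.

Lemma sdom_lincomb e r : (forall i, D (e i)) -> D (lincomb e r).
Proof. by move=> De; apply: sdom_sum => i _; apply: sdomZ. Qed.

Lemma sdot_lincombl e r h : (forall i, D (e i)) -> D h ->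
  <<lincomb e r, h>> = lval (fun i => <<e i, h>>) r.
Proof.
move=> De Dh; rewrite sdot_suml // => [|p _]; last exact: sdomZ.
by apply: eq_bigr => p _; rewrite sdotZl.
Qed.

End Comb.

(** A minimizing sequence of [|v|^2 - 2 Re (l v)] over the combinations [v] of
    the [e i] is Cauchy by the parallelogram law, and its limit represents [l].
    As [l] is given on coefficient lists, the bound is also what makes it well
    defined on the span. *)
Lemma riesz I (e : I -> V) (l : I -> C) (M : R) : complete_sip ->
  (forall i, D (e i)) ->
  (forall r, normc (lval l r) <= M * `[lincomb e r]) ->
  exists f, [/\ D f, forall i, <<e i, f>> = l i &
    forall ep, 0 < ep -> exists r, `[f - lincomb e r] < ep].
Proof.
move=> compl De lM; pose v r := lincomb e r.
have Dv r : D (v r) by apply: sdom_lincomb.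
pose J r := `[v r] ^+ 2 - 2 * complex.Re (lval l r).
pose A := [set J r | r in setT].
have Jge r : - M ^+ 2 <= J r.
  rewrite /J; have := le_trans (le_trans (ler_norm _) (Re_le_normc _)) (lM r).
  have := sqr_ge0 (`[v r] - M); rewrite sqrrB -/(v r) -mulr_natl; lra.
have infA : has_inf A.
  split; first by exists (J [::]), [::].
  by exists (- M ^+ 2) => _ [r _ <-].
have Jinf r : inf A <= J r by apply: ge_inf; [exact: infA.2|exists r].
have /choice[r rP] : forall n, exists r, J r < inf A + n.+1%:R^-1.
  move=> n; have [|_ [r _ <-] lt] := @inf_adherent _ A n.+1%:R^-1 _ infA.
    by rewrite invr_gt0.
  by exists r.
have dist m n : `[v (r m) - v (r n)] ^+ 2 <= 2 * m.+1%:R^-1 + 2 * n.+1%:R^-1.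
  rewrite parallelogram //.
  have := Jinf (cscale 2^-1 (r m ++ r n)); have := rP m; have := rP n.
  rewrite /J /v lincomb_scale lval_scale lincomb_cat lval_cat.
  rewrite snormZ; last by apply: sdomD; apply: Dv.
  have -> : (2^-1 : C) = (2^-1 : R)%:C%C by rewrite fmorphV rmorph_nat.
  rewrite ReZ normc_real exprMn real_normK ?num_real // ReD.
  rewrite (_ : 2^-1 ^+ 2 = 4^-1 :> R); last by field.
  move: (m.+1%:R^-1) (n.+1%:R^-1) (inf A) => ? ? ?; lra.
have [||f Df fP] := compl (v \o r) => [n|ep ep0|]; first exact: Dv.
  have [N NP] : exists N, forall n, (N <= n)%N -> (n.+1%:R^-1 : R) < ep ^+ 2 / 4.
    by apply: small_inv; rewrite divr_gt0 ?exprn_gt0.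
  exists N => m n /NP hm /NP hn; rewrite -ltr_sqr ?nnegrE ?snorm_ge0 ?(ltW ep0) //.
  apply: le_lt_trans (dist m n) _; move: hm hn.
  move: (m.+1%:R^-1) (n.+1%:R^-1) => ? ? ? ?; lra.
exists f; split=> // [i|ep ep0]; last first.
  have [N /(_ N (leqnn _)) lt_ep] := fP ep ep0.
  by exists (r N); rewrite snormC //; apply: Dv.
pose dl := <<e i, f>> - l i.
have key c : 0 <= normc c ^+ 2 * `[e i] ^+ 2 + 2 * complex.Re (c * dl).
  rewrite -oppr_le0; apply: (@le0_eps _ _ (1 + 2 * (normc c * `[e i]))) => ep ep0.
  have [N1 h1] := small_inv ep0; have [N2 h2] := fP ep ep0.
  pose n := maxn N1 N2.
  have {}h1 := h1 n (leq_maxl _ _); have {}h2 := h2 n (leq_maxr _ _).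
  have := Jinf (r n ++ [:: (c, i)]); have := rP n.
  have Dvn : D (lincomb e (r n)) by apply: Dv.
  have Dci : D (c *: e i) by apply: sdomZ.
  rewrite /J /v lincomb_cat lval_cat lincomb1 lval1 snormDsqr // snormZ //.
  rewrite sdotZr //.
  have h3 : complex.Re (c^* * << lincomb e (r n), e i>>) - complex.Re (c * l i)
      <= complex.Re (c * dl) + normc c * `[e i] * ep.
    have -> : complex.Re (c^* * << lincomb e (r n), e i>>)
        = complex.Re (c * <<e i, lincomb e (r n)>>).
      by rewrite -ReJ conjCM conjCK -sdotC.
    have -> : c * <<e i, lincomb e (r n)>> =
        c * dl + c * l i + c * <<e i, lincomb e (r n) - f>>.
      by rewrite sdotBr // /dl; ring.
    rewrite !ReD -!addrA lerD2l addrCA subrr addr0.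
    apply: le_trans (ler_norm _) _; apply: le_trans (Re_le_normc _) _.
    rewrite normcM -mulrA ler_wpM2l ?normc_ge0 //.
    apply: le_trans (CauchySchwarz _ _) _ => //; first exact: sdomB.
    by rewrite ler_wpM2l ?snorm_ge0 // ltW.
  rewrite !ReD exprMn; move: h1 h3; move: (n.+1%:R^-1) => ? ? ? ? ?; lra.
apply/eqP; rewrite -subr_eq0; apply/eqP; rewrite -/dl.
apply: eq0_normc; apply/eqP; rewrite -sqrf_eq0 eq_le sqr_ge0 andbT.
pose t := (`[e i] ^+ 2 + 1)^-1.
have t0 : 0 < t by rewrite invr_gt0 ltr_wpDl ?sqr_ge0.
have := key (- t%:C%C * dl^*).
rewrite normcM normcN normc_real normcJ -[X in complex.Re X]mulrA.
rewrite [dl^* * _]mulrC mul_conj.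
rewrite mulNr ReN ReZ exprMn real_normK ?num_real //=.
have tE : t * `[e i] ^+ 2 = 1 - t.
  by rewrite /t; field; rewrite gt_eqF // ltr_wpDl ?sqr_ge0.
have -> : t ^+ 2 * normc dl ^+ 2 * `[e i] ^+ 2 = t * normc dl ^+ 2 * (1 - t).
  by rewrite -tE; ring.
have -> : t * normc dl ^+ 2 * (1 - t) + 2 * - (t * normc dl ^+ 2) =
  - (t * (1 + t) * normc dl ^+ 2) by ring.
by rewrite oppr_ge0 pmulr_rle0 // mulr_gt0 // addr_gt0.
Qed.

(** A Gram matrix is a sum of rank one positive matrices: split off the
    projection onto the first vector and recurse on the orthogonal parts. *)
Lemma gram_factor (I : eqType) (x : I -> V) (r : seq I) : (forall u, D (x u)) ->
  exists Bs : seq (I -> C), {in r &, forall u v,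
    <<x u, x v>> = \sum_(B <- Bs) B u * (B v)^*}.
Proof.
elim: r x => [|u0 r IH] x Dx; first by exists [::].
pose n2 : C := <<x u0, x u0>>; pose c u : C := <<x u, x u0>> / n2.
have n2E : n2 = (`[x u0] ^+ 2)%:C%C by apply: snormE.
have cP u : c u * n2 = <<x u, x u0>>.
  (* if [x u0] has norm 0, both sides vanish, the right one by Cauchy-Schwarz *)
  have [n0|n0] := eqVneq n2 0; last by rewrite divfK.
  rewrite n0 mulr0; apply/esym/eq0_normc/eqP.
  rewrite eq_le normc_ge0 andbT; apply: le_trans (CauchySchwarz _ _) _ => //.
  move: n0; rewrite n2E => /complexI/eqP; rewrite sqrf_eq0.
  by move/eqP ->; rewrite mulr0.
have n2J : n2^* = n2 by rewrite n2E conjC_real.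
pose y u := x u - c u *: x u0.
have Dy u : D (y u) by apply: sdomB => //; apply: sdomZ.
have [Bs BsP] := IH y Dy.
pose B0 u := c u * (`[x u0])%:C%C.
pose ext (B : I -> C) u := if u == u0 then 0 else B u.
exists (B0 :: map ext Bs) => u v; rewrite !inE => hu hv.
rewrite big_cons big_map.
have B0E : B0 u * (B0 v)^* = c u * (c v)^* * n2.
  rewrite /B0 conjCM conjC_real n2E rmorphXn /=; ring.
rewrite B0E.
have xE : <<x u, x v>> = <<y u, y v>> + c u * (c v)^* * n2.
  have DZ w : D (c w *: x u0) by apply: sdomZ.
  rewrite (sdotBl (Dx u) (DZ u) (Dy v)) sdotZl //.
  rewrite (sdotBr (Dx v) (DZ v) (Dx u)) (sdotBr (Dx v) (DZ v) (Dx u0)).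
  rewrite !sdotZr // (sdotC (Dx v) (Dx u0)) -(cP u) -(cP v) conjCM n2J -/n2; ring.
have y0 w : (<<y u0, y w>> = 0) /\ (<<y w, y u0>> = 0).
  have [n0|n0] := eqVneq n2 0.
    have yn : `[y u0] = 0.
      have -> : y u0 = x u0 by rewrite /y /c -/n2 n0 invr0 mulr0 scale0r subr0.
      by rewrite /snorm -/n2 n0 sqrtr0.
    split; apply/eq0_normc/eqP; rewrite eq_le normc_ge0 andbT;
      apply: le_trans (CauchySchwarz _ _) _ => //; by rewrite yn ?mul0r ?mulr0.
  have -> : y u0 = 0 by rewrite /y /c -/n2 divff // scale1r subrr.
  by rewrite sdot0l ?sdot0r.
rewrite addrC xE; congr (_ + _); rewrite /ext.
case: eqP => [->|/eqP uu0].
  by rewrite (y0 _).1 big1 // => B _; rewrite mul0r.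
case: eqP => [->|/eqP vu0].
  by rewrite (y0 _).2 big1 // => B _; rewrite conjC0 mulr0.
by apply: BsP; [move: hu|move: hv]; rewrite ?(negbTE uu0) ?(negbTE vu0).
Qed.

End Riesz.

(** * Extension of column isometries *)
Section Isometry.
Variables (R : realType) (V : lmodType R[i]) (s : sip V) (d : nat).
Local Notation C := R[i].
Local Notation D := (sdom s).
Local Notation "<< f , g >>" := (sdot s f g).
Local Notation "`[ f ]" := (snorm s f).

Lemma sdot_close f g f' g' (e : R) : D f -> D g -> D f' -> D g' ->
  0 <= e -> e <= 1 -> `[f - f'] <= e -> `[g - g'] <= e ->
  normc (<<f, g>> - <<f', g'>>) <= (`[f] + `[g] + 1) * e.
Proof.
move=> Df Dg Df' Dg' e0 e1 ff' gg'.
have Dff : D (f - f') by apply: sdomB.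
have Dgg : D (g - g') by apply: sdomB.
have -> : <<f, g>> - <<f', g'>> = <<f - f', g>> + <<f', g - g'>>.
  by rewrite sdotBl // sdotBr // addrA subrK.
have h1 := CauchySchwarz Dff Dg; have h2 := CauchySchwarz Df' Dgg.
have h3 : `[f'] <= `[f] + 1.
  have := ler_snormB Df Dff; rewrite opprB addrC subrK; lra.
have h4 := le_normcD <<f - f', g>> <<f', g - g'>>.
have h5 : `[f - f'] * `[g] <= e * `[g] by rewrite ler_wpM2r ?snorm_ge0.
have h6 : `[f'] * `[g - g'] <= (`[f] + 1) * e by rewrite ler_pM ?snorm_ge0.
lra.
Qed.

Section Family.
Variable I : Type.
Implicit Types (r t : seq (C * I)).

Lemma sdot_lincomb2 (e e' : I -> V) r t : (forall i, D (e i)) -> (forall i, D (e' i)) ->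
  <<lincomb e r, lincomb e' t>> =
  \sum_(p <- r) \sum_(q <- t) p.1 * (q.1)^* * <<e p.2, e' q.2>>.
Proof.
move=> De De'; rewrite sdot_lincombl //; last exact: sdom_lincomb.
apply: eq_bigr => p _; rewrite sdot_sumr // => [|q _]; last exact: sdomZ.
by rewrite mulr_sumr; apply: eq_bigr => q _; rewrite sdotZr // mulrA.
Qed.

Lemma lincomb_shift (e : I -> V) e0 r :
  lincomb (fun i => e i - e0) r = lincomb e r - lval (fun=> 1) r *: e0.
Proof.
rewrite /lincomb /lval scaler_suml -sumrB; apply: eq_bigr => p _.
by rewrite scalerBr mulr1.
Qed.

Variables (E : I -> V) (F : 'I_d -> I -> V).
Hypothesis DE : forall i, D (E i).
Hypothesis DF : forall j i, D (F j i).
Hypothesis EF : forall i i', \sum_(j < d) <<F j i, F j i'>> = <<E i, E i'>>.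

(** The map [E i |-> (F j i)_j] is isometric, hence well defined, on the span
    of the [E i]. *)
Lemma lincomb_isometric r t :
  \sum_(j < d) <<lincomb (F j) r, lincomb (F j) t>> = <<lincomb E r, lincomb E t>>.
Proof.
rewrite sdot_lincomb2 //.
under eq_bigr => j _ do rewrite sdot_lincomb2 //.
rewrite exchange_big; apply: eq_bigr => p _.
rewrite exchange_big; apply: eq_bigr => q _.
by rewrite -mulr_sumr EF.
Qed.

Lemma lincomb_contractive j r : `[lincomb (F j) r] <= `[lincomb E r].
Proof.
have DEr : D (lincomb E r) by apply: sdom_lincomb.
have DFr k : D (lincomb (F k) r) by apply: sdom_lincomb.
rewrite -ler_sqr ?nnegrE ?snorm_ge0 // [leRHS]snorm_sqr // -lincomb_isometric Re_sum.
rewrite (bigD1 j) //= -snorm_sqr // lerDl sumr_ge0 // => k _.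
by rewrite -snorm_sqr // sqr_ge0.
Qed.

(** By completeness the densely defined column isometry has limits everywhere:
    the [B j f] are chosen vector by vector, together with combinations that
    approximate [f] and all the [B j f] at once, and both identities pass to the
    limit along such combinations. *)
Lemma isometric_extension : complete_sip s ->
  (forall f, D f -> forall e, 0 < e -> exists r, `[f - lincomb E r] < e) ->
  exists B : 'I_d -> V -> V, [/\ forall j f, D f -> D (B j f),
    forall f g, D f -> D g -> \sum_(j < d) <<B j f, B j g>> = <<f, g>> &
    forall f i, D f -> \sum_(j < d) <<B j f, F j i>> = <<f, E i>>].
Proof.
move=> compl dense.
have DEr r : D (lincomb E r) by apply: sdom_lincomb.
have DFr j r : D (lincomb (F j) r) by apply: sdom_lincomb.
have /choice[B BP] : forall f, exists g : 'I_d -> V, D f ->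
    (forall j, D (g j)) /\ forall e, 0 < e -> exists r,
    `[f - lincomb E r] <= e /\ forall j, `[g j - lincomb (F j) r] <= e.
  move=> f; have [Df|] := pselect (D f); last by exists (fun=> 0).
  have /choice[r rP] : forall n, exists r, `[f - lincomb E r] < n.+1%:R^-1.
    by move=> n; apply: dense => //; rewrite invr_gt0.
  have cauchy j : exists g, D g /\ forall e : R, 0 < e -> exists N : nat,
      forall n, (N <= n)%N -> `[lincomb (F j) (r n) - g] < e.
    suff [g Dg gP] : exists2 g, D g & forall e : R, 0 < e -> exists N : nat,
      forall n, (N <= n)%N -> `[lincomb (F j) (r n) - g] < e by exists g.
    apply: compl => // e e0; have e2 : 0 < e / 2 by rewrite divr_gt0.
    have [N hN] := small_inv e2; exists N => m n /hN hm /hN hn.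
    have -> : lincomb (F j) (r m) - lincomb (F j) (r n) =
        lincomb (F j) (r m ++ cscale (-1) (r n)).
      by rewrite lincomb_cat lincomb_scale scaleN1r.
    apply: le_lt_trans (lincomb_contractive _ _) _.
    rewrite lincomb_cat lincomb_scale scaleN1r.
    have := snorm_dist (DEr (r m)) Df (DEr (r n)).
    rewrite (snormC (DEr (r m)) Df); have := rP m; have := rP n; move: hm hn.
    move: (m.+1%:R^-1) (n.+1%:R^-1) => ? ?; lra.
  have /choice[g gP] := cauchy.
  exists g => _; split=> [j|e e0]; first exact: (gP j).1.
  have /choice[N NP] : forall j, exists N : nat,
      forall n, (N <= n)%N -> `[lincomb (F j) (r n) - g j] < e.
    by move=> j; apply: (gP j).2.
  have [N0 N0P] := small_inv e0.
  pose n := maxn N0 (\max_(j < d) N j); exists (r n); split=> [|j].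
    by apply/ltW/(lt_trans (rP n)); apply: N0P; apply: leq_maxl.
  rewrite snormC //; last exact: (gP j).1.
  apply/ltW/NP; apply: leq_trans (leq_maxr _ _); exact: (leq_bigmax j).
have DB j f : D f -> D (B f j) by move=> /BP[].
exists (fun j f => B f j); split=> // [f g Df Dg|f i Df].
  apply/eqP; rewrite -subr_eq0; apply/eqP/eq0_normc/eqP.
  rewrite eq_le normc_ge0 andbT.
  pose K := \sum_(j < d) (`[B f j] + `[B g j] + 1) + (`[f] + `[g] + 1).
  apply: (@le0_eps _ _ K) => e0 e00; pose e := Num.min 1 e0.
  have e1 : e <= 1 by rewrite ge_min lexx.
  have ep : 0 < e by rewrite lt_min ltr01.
  have [r [fr Br]] := (BP f Df).2 e ep; have [t [gt Bt]] := (BP g Dg).2 e ep.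
  have -> : \sum_(j < d) <<B f j, B g j>> - <<f, g>> =
    \sum_(j < d) (<<B f j, B g j>> - <<lincomb (F j) r, lincomb (F j) t>>)
    - (<<f, g>> - <<lincomb E r, lincomb E t>>).
    by rewrite sumrB lincomb_isometric opprB addrA subrK.
  have K0 : 0 <= K.
    by rewrite addr_ge0 ?sumr_ge0 // => *; rewrite !addr_ge0 ?snorm_ge0.
  apply: (@le_trans _ _ (K * e)); last by rewrite ler_wpM2l // ge_min lexx orbT.
  apply: le_trans (le_normcD _ _) _; rewrite normcN mulrDl lerD //; last first.
    by apply: sdot_close => //; apply: ltW.
  apply: le_trans (normc_sum _ _ _) _; rewrite mulr_suml; apply: ler_sum => j _.
  by apply: sdot_close => //; [apply: DB..|apply: ltW].
apply/eqP; rewrite -subr_eq0; apply/eqP/eq0_normc/eqP.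
rewrite eq_le normc_ge0 andbT.
pose K := \sum_(j < d) `[F j i] + `[E i].
apply: (@le0_eps _ _ K) => e ep; have [r [fr Br]] := (BP f Df).2 e ep.
have EE : \sum_(j < d) <<lincomb (F j) r, F j i>> = <<lincomb E r, E i>>.
  have := lincomb_isometric r [:: (1, i)]; rewrite !lincomb1 !scale1r => <-.
  by apply: eq_bigr => j _; rewrite lincomb1 scale1r.
have -> : \sum_(j < d) <<B f j, F j i>> - <<f, E i>> =
    \sum_(j < d) <<B f j - lincomb (F j) r, F j i>> - <<f - lincomb E r, E i>>.
  under [in RHS]eq_bigr => j _ do rewrite (sdotBl (DB j f Df) (DFr j r) (DF j i)).
  by rewrite sumrB EE (sdotBl Df (DEr r) (DE i)) opprB addrA subrK.
apply: le_trans (le_normcD _ _) _; rewrite normcN mulrDl lerD //; last first.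
  have DfE : D (f - lincomb E r) by apply: sdomB.
  apply: le_trans (CauchySchwarz DfE (DE i)) _.
  by rewrite mulrC ler_wpM2l ?snorm_ge0.
apply: le_trans (normc_sum _ _ _) _; rewrite mulr_suml; apply: ler_sum => j _.
have DBF : D (B f j - lincomb (F j) r) by apply: sdomB => //; apply: DB.
apply: le_trans (CauchySchwarz DBF (DF j i)) _.
by rewrite mulrC ler_wpM2l ?snorm_ge0.
Qed.

End Family.
End Isometry.

Lemma snorm_lincomb_eq (R : realType) (V V' : lmodType R[i]) (s : sip V) (s' : sip V')
    (I : Type) (e : I -> V) (e' : I -> V') r :
  (forall i, sdom s (e i)) -> (forall i, sdom s' (e' i)) ->
  (forall i j, sdot s (e i) (e j) = sdot s' (e' i) (e' j)) ->
  snorm s (lincomb e r) = snorm s' (lincomb e' r).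
Proof.
move=> De De' ee'; rewrite /snorm; congr (Num.sqrt (complex.Re _)).
rewrite !sdot_lincomb2 //; apply: eq_bigr => p _; apply: eq_bigr => q _.
by rewrite ee'.
Qed.

(** * Limits of complex sequences *)

Section Clim.
Variable R : realType.
Local Notation C := R[i].
Implicit Types (u v : nat -> C) (x y l : C).

(** Convergence is stated with real tolerances because all the estimates below
    are on [normc]. *)
Definition clim u l := forall e : R, 0 < e ->
  exists N : nat, forall n, (N <= n)%N -> normc (u n - l) < e.

Lemma clim_unique u l l' : clim u l -> clim u l' -> l = l'.
Proof.
move=> ul ul'; apply/eqP; rewrite -subr_eq0; apply/eqP/eq0_normc/eqP.
rewrite eq_le normc_ge0 andbT; apply: (@le0_eps _ _ 2) => e e0.
have [N hN] := ul e e0; have [N' hN'] := ul' e e0.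
have := hN (maxn N N') (leq_maxl _ _); have := hN' (maxn N N') (leq_maxr _ _).
set w := u _; rewrite [normc (w - l)]normcB => h h'.
have := le_normcD (l - w) (w - l'); rewrite subrKA; lra.
Qed.

Lemma clim_cst x : clim (fun=> x) x.
Proof. by move=> e e0; exists 0%N => n _; rewrite subrr normc0. Qed.

Lemma climD u v l l' : clim u l -> clim v l' -> clim (fun n => u n + v n) (l + l').
Proof.
move=> ul vl e e0; have e2 : 0 < e / 2 by rewrite divr_gt0.
have [N hN] := ul _ e2; have [N' hN'] := vl _ e2.
exists (maxn N N') => n; rewrite geq_max => /andP[/hN h /hN' h'].
rewrite opprD addrACA; have := le_normcD (u n - l) (v n - l'); lra.
Qed.

Lemma clim_dom u v l l' (c : R) : (forall n, normc (v n - l') <= c * normc (u n - l)) ->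
  clim u l -> clim v l'.
Proof.
move=> vu ul e e0; have c1 : 0 < `|c| + 1 by rewrite ltr_wpDl.
have [N hN] := ul _ (divr_gt0 e0 c1); exists N => n /hN h.
apply: le_lt_trans (vu n) _; apply: (@le_lt_trans _ _ ((`|c| + 1) * normc (u n - l))).
  rewrite ler_wpM2r ?normc_ge0 //; have := ler_norm c; lra.
by rewrite mulrC -ltr_pdivlMr.
Qed.

Lemma climZ x u l : clim u l -> clim (fun n => x * u n) (x * l).
Proof. by apply: (@clim_dom _ _ _ _ (normc x)) => n; rewrite -mulrBr normcM. Qed.

Lemma climJ u l : clim u l -> clim (fun n => (u n)^*) (l^*).
Proof. by apply: (@clim_dom _ _ _ _ 1) => n; rewrite -conjCB normcJ mul1r. Qed.

Lemma clim_sum I (r : seq I) (u : I -> nat -> C) (l : I -> C) :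
  (forall i, clim (u i) (l i)) ->
  clim (fun n => \sum_(i <- r) u i n) (\sum_(i <- r) l i).
Proof.
move=> ul; elim: r => [|i r IH].
  rewrite big_nil (_ : (fun n => _) = fun=> 0); first exact: clim_cst.
  by apply/funext => n; rewrite big_nil.
rewrite big_cons (_ : (fun n => _) = fun n => u i n + \sum_(i <- r) u i n).
  exact: climD.
by apply/funext => n; rewrite big_cons.
Qed.

Lemma clim_shift u l (k : nat) : clim (fun n => u (n + k)%N) l <-> clim u l.
Proof.
split=> ul e /ul[N hN]; last by exists N => n le; apply: hN; apply: leq_trans le (leq_addr _ _).
exists (N + k)%N => n le; rewrite -(subnK (leq_trans (leq_addl _ _) le)).
by apply: hN; rewrite leq_subRL ?(leq_trans (leq_addl _ _) le) // addnC.
Qed.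

Lemma clim_ReIm u l :
  (fun n => complex.Re (u n)) @ \oo --> complex.Re l ->
  (fun n => complex.Im (u n)) @ \oo --> complex.Im l -> clim u l.
Proof.
move=> /cvgrPdist_lt uRe /cvgrPdist_lt uIm e e0.
have e2 : 0 < e / 2 by rewrite divr_gt0.
have [N _ hN] := uRe _ e2; have [N' _ hN'] := uIm _ e2.
exists (maxn N N') => n; rewrite geq_max => /andP[/hN /= h /hN' /= h'].
rewrite normcB; have := normc_le_ReIm (l - u n).
rewrite ReB ImB; lra.
Qed.

Lemma clim_Re u l : clim u l -> (fun n => complex.Re (u n)) @ \oo --> complex.Re l.
Proof.
move=> ul; apply/cvgrPdist_lt => e /ul[N hN]; exists N => // n /hN /=.
apply: le_lt_trans; rewrite normcB -ReN -ReD; exact: Re_le_normc.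
Qed.

Lemma clim_ge0 u l : clim u l -> (forall n, 0 <= u n) -> 0 <= l.
Proof.
move=> ul u0; have ulI : clim (fun n => u n - (u n)^*) (l - l^*).
  apply: climD => //; rewrite -mulN1r (_ : (fun n => _) = fun n => -1 * (u n)^*).
    exact/climZ/climJ.
  by apply/funext => n; rewrite mulN1r.
have : (l - l^*) = 0.
  apply: clim_unique ulI _; rewrite (_ : (fun n => _) = fun=> 0); first exact: clim_cst.
  by apply/funext => n; have [-> _] := ge0_complexE (u0 n); rewrite conjC_real subrr.
have Re0 : 0 <= complex.Re l.
  rewrite -oppr_le0; apply: (@le0_eps _ _ 1) => e /ul[N /(_ N (leqnn _))].
  have [_] := ge0_complexE (u0 N); have := Re_le_normc (u N - l).
  rewrite ReD ReN ler_norml => /andP[]; lra.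
case: (l) Re0 => a b /= a0 /eqP; rewrite eq_complex /= => /andP[_ /eqP b0].
by rewrite lecE /= a0 andbT; apply/eqP; lra.
Qed.

Lemma clim_complete u :
  (forall e : R, 0 < e -> exists N : nat, forall m n,
     (N <= m)%N -> (N <= n)%N -> normc (u m - u n) < e) -> exists l, clim u l.
Proof.
move=> cu.
have cv (f : C -> R) : (forall x y, `|f x - f y| <= normc (x - y)) ->
    cvgn (f \o u).
  move=> fl; apply/cauchy_cvgP/cauchy_exP => e e0.
  have [N hN] := cu _ e0.
  exists (f (u N)); exists N => // n /= hn.
  by rewrite -ball_normE /=; apply: le_lt_trans (fl _ _) _; apply: hN.
have cR : cvgn (fun n => complex.Re (u n)).
  by apply: (cv (@complex.Re R)) => x y; rewrite -ReB Re_le_normc.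
have cI : cvgn (fun n => complex.Im (u n)).
  by apply: (cv (@complex.Im R)) => x y; rewrite -ImB Im_le_normc.
exists (Complex (limn (fun n => complex.Re (u n))) (limn (fun n => complex.Im (u n)))).
exact: clim_ReIm.
Qed.

Lemma clim_geometric (q c : R) u : 0 <= q -> q < 1 ->
  (forall n, normc (u n) <= q ^+ n * c) -> clim u 0.
Proof.
move=> q0 q1 uq e e0; have e2 : 0 < e / 2 by rewrite divr_gt0.
have [N hN] := geometric_small `|c| q0 q1 e2; exists N.+1 => n Nn.
rewrite subr0; apply: le_lt_trans (uq n) _; apply: (@le_lt_trans _ _ (e / 2)); last lra.
apply: le_trans hN; apply: (@le_trans _ _ (q ^+ n * `|c|)).
  by rewrite ler_wpM2l ?exprn_ge0 // ler_norm.
by rewrite ler_wpM2r // ler_wiXn2l // ltW.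
Qed.

End Clim.

(** * Words *)

Section Words.
Variable d : nat.
Local Notation word := (seq 'I_d).

Fixpoint words n : seq word :=
  if n is m.+1 then flatten [seq [seq i :: w | w <- words m] | i <- enum 'I_d]
  else [:: [::]].

(** The words of length less than [n].  These finite sets exhaust all words, so
    unordered sums over words become limits of sequences along them. *)
Fixpoint wordsB n : seq word :=
  if n is m.+1 then
    [::] :: flatten [seq [seq i :: w | w <- wordsB m] | i <- enum 'I_d]
  else [::].

Lemma mem_cons_flatten (X : seq word) i w :
  (i :: w \in flatten [seq [seq i :: w | w <- X] | i <- enum 'I_d]) = (w \in X).
Proof.
apply/flatten_mapP/idP => [[j _ /mapP[v Xv [_ ->]]] //|Xw].
by exists i; [rewrite mem_enum|apply/mapP; exists w].
Qed.

Lemma nil_cons_flatten (X : seq word) :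
  ([::] \in flatten [seq [seq i :: w | w <- X] | i <- enum 'I_d]) = false.
Proof. by apply/flatten_mapP => -[j _ /mapP[]]. Qed.

Lemma uniq_cons_flatten (X : seq word) : uniq X ->
  uniq (flatten [seq [seq i :: w | w <- X] | i <- enum 'I_d]).
Proof.
move=> uX; apply: (allpairs_uniq (enum_uniq _) uX).
by move=> [i v] [j w] _ _ /= [-> ->].
Qed.

Lemma mem_words n w : (w \in words n) = (size w == n).
Proof.
by elim: n w => [|n IH] [|i w] //=; rewrite ?nil_cons_flatten // mem_cons_flatten IH.
Qed.

Lemma mem_wordsB n w : (w \in wordsB n) = (size w < n)%N.
Proof.
by elim: n w => [|n IH] [|i w] //=; rewrite inE mem_cons_flatten IH.
Qed.

Lemma uniq_words n : uniq (words n).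
Proof. by elim: n => // n IH; apply: uniq_cons_flatten. Qed.

Lemma uniq_wordsB n : uniq (wordsB n).
Proof.
by elim: n => //= n IH; rewrite nil_cons_flatten uniq_cons_flatten.
Qed.

Section Sums.
Variable Z : nmodType.
Implicit Type F : word -> Z.

Lemma sum_cons_flatten (X : seq word) F :
  \sum_(w <- flatten [seq [seq i :: w | w <- X] | i <- enum 'I_d]) F w =
  \sum_(i < d) \sum_(w <- X) F (i :: w).
Proof.
rewrite big_flatten big_map big_enum; apply: eq_bigr => i _; exact: big_map.
Qed.

Lemma sum_words0 F : \sum_(w <- words 0) F w = F [::].
Proof. exact: big_seq1. Qed.

Lemma sum_wordsS n F :
  \sum_(w <- words n.+1) F w = \sum_(i < d) \sum_(w <- words n) F (i :: w).
Proof. exact: sum_cons_flatten. Qed.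

(** Operators act on the first letters of words, while the column isometry will
    act on the last ones: both decompositions are needed. *)
Lemma sum_words_rcons n F :
  \sum_(w <- words n.+1) F w = \sum_(w <- words n) \sum_(i < d) F (rcons w i).
Proof.
elim: n F => [|n IH] F.
  by rewrite sum_wordsS sum_words0; apply: eq_bigr => i _; rewrite sum_words0.
rewrite sum_wordsS [RHS]sum_wordsS; apply: eq_bigr => i _.
exact: (IH (fun w => F (i :: w))).
Qed.

Lemma sum_wordsB0 F : \sum_(w <- wordsB 0) F w = 0.
Proof. exact: big_nil. Qed.

Lemma sum_wordsBS n F : \sum_(w <- wordsB n.+1) F w =
  F [::] + \sum_(i < d) \sum_(w <- wordsB n) F (i :: w).
Proof. by rewrite big_cons sum_cons_flatten. Qed.

Lemma sum_wordsB n F :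
  \sum_(w <- wordsB n) F w = \sum_(m < n) \sum_(w <- words m) F w.
Proof.
elim: n F => [|n IH] F; first by rewrite sum_wordsB0 big_ord0.
rewrite sum_wordsBS big_ord_recl sum_words0; congr (_ + _).
under eq_bigr => i _ do rewrite IH.
by rewrite exchange_big; apply: eq_bigr => m _; rewrite sum_wordsS.
Qed.

Lemma sum_wordsB_delta n v F : \sum_(w <- wordsB n | w == v) F w =
  if (size v < n)%N then F v else 0.
Proof.
rewrite -mem_wordsB -big_filter; case: ifP => vn.
  by rewrite (filter_pred1_uniq (uniq_wordsB n) vn) big_seq1.
rewrite big_filter big1_seq // => w /andP[/eqP -> vn'].
by rewrite vn' in vn.
Qed.

Lemma sum_tuple n F : \sum_(t : n.-tuple 'I_d) F (val t) = \sum_(w <- words n) F w.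
Proof.
rewrite -(big_map val predT F); apply: perm_big; apply: uniq_perm.
- by rewrite map_inj_uniq ?index_enum_uniq //; apply: val_inj.
- exact: uniq_words.
- move=> w; rewrite mem_words; apply/mapP/eqP => [[t _ ->]|wn].
    exact: size_tuple.
  by exists (Tuple (introT eqP wn)); first exact: mem_index_enum.
Qed.

End Sums.

End Words.

(** * The Fock space *)

Section WordSums.
Variables (R : realType) (d : nat).
Local Notation C := R[i].
Local Notation word := (seq 'I_d).
Implicit Types (p : word -> R).

Lemma wsum_mono p m n : (forall w, 0 <= p w) -> (m <= n)%N ->
  \sum_(w <- wordsB d m) p w <= \sum_(w <- wordsB d n) p w.
Proof.
move=> p0; elim: n m p p0 => [|n IH] [|m] p p0 // le.
  by rewrite sum_wordsB0 sumr_ge0.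
rewrite !sum_wordsBS lerD2l; apply: ler_sum => i _.
by apply: (IH m (fun w => p (i :: w))).
Qed.

Lemma le_esum_wsum p (M : R) : (forall w, 0 <= p w) ->
  (forall n, \sum_(w <- wordsB d n) p w <= M) ->
  (\esum_(w in [set: word]) (p w)%:E <= M%:E)%E.
Proof.
move=> p0 pM; apply: ge_ereal_sup => _ [A [finA _] <-].
have [X0 XA] := (finite_seqP A).1 finA; pose X := undup X0.
have {A finA XA} -> : A = [set` X].
  by rewrite XA; apply/seteqP; split => w /=; rewrite mem_undup.
have uX : uniq X by apply: undup_uniq.
rewrite -fsbig_seq // sumEFin lee_fin; apply: le_trans (pM (\max_(w <- X) size w).+1).
have Xsub w : w \in X -> w \in wordsB d (\max_(w <- X) size w).+1.
  by rewrite mem_wordsB ltnS => wX; apply: leq_bigmax_seq.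
set B := wordsB _ _ in Xsub *.
rewrite [leRHS](bigID [in X]) /= -[Y in _ <= Y + _]big_filter.
rewrite [Y in _ <= Y + _](perm_big X) ?lerDl ?sumr_ge0 //.
apply: uniq_perm; rewrite ?filter_uniq ?uniq_wordsB // => w.
by rewrite mem_filter; apply: andb_idr; apply: Xsub.
Qed.

Lemma wsum_le_esum p n : (forall w, 0 <= p w) ->
  ((\sum_(w <- wordsB d n) p w)%:E <= \esum_(w in [set: word]) (p w)%:E)%E.
Proof.
move=> p0; apply: esum_ge; exists [set` wordsB d n].
  by split => //; apply: finite_seq.
by rewrite -fsbig_seq ?uniq_wordsB // sumEFin.
Qed.

Lemma esum_wsum_cvg p (M : R) : (forall w, 0 <= p w) ->
  (forall n, \sum_(w <- wordsB d n) p w <= M) ->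
  (fun n => \sum_(w <- wordsB d n) p w) @ \oo -->
    fine (\esum_(w in [set: word]) (p w)%:E)%E.
Proof.
move=> p0 pM; have le := le_esum_wsum p0 pM.
have ge n := wsum_le_esum n p0.
move: le ge; case E : (\esum_(w in _) _)%E => [s| |] //= le ge; last first.
  by have := ge 0%N; rewrite leeNy_eq.
apply/cvgrPdist_lt => e e0.
suff [N hN] : exists N, s - e < \sum_(w <- wordsB d N) p w.
  exists N => // n /= Nn; have := ge n; rewrite lee_fin => gen.
  rewrite ger0_norm ?subr_ge0 //; have := wsum_mono p0 Nn; lra.
apply/not_existsP => h; have : (s%:E <= (s - e)%:E)%E.
  rewrite -E; apply: le_esum_wsum => // n; rewrite leNgt; exact/negP/h.
rewrite lee_fin; lra.
Qed.

Lemma rsum_cvg p q (M : R) : (forall w, `|p w| <= q w) ->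
  (forall n, \sum_(w <- wordsB d n) q w <= M) ->
  (fun n => \sum_(w <- wordsB d n) p w) @ \oo --> rsum p.
Proof.
move=> pq qM; rewrite /rsum.
pose pp w := Num.max (p w) 0; pose pn w := Num.max (- p w) 0.
have -> : (fun w => ((EFin \o p)^\+ w)%E) = (fun w => (pp w)%:E).
  by apply/funext => w; rewrite funeposE /= -EFin_max.
have -> : (fun w => ((EFin \o p)^\- w)%E) = (fun w => (pn w)%:E).
  by apply/funext => w; rewrite funenegE /= -EFin_max.
have pp0 w : 0 <= pp w by rewrite le_max lexx orbT.
have pn0 w : 0 <= pn w by rewrite le_max lexx orbT.
have ppq w : pp w <= q w.
  have := pq w; rewrite ler_norml => /andP[]; rewrite ge_max; lra.
have pnq w : pn w <= q w.
  have := pq w; rewrite ler_norml => /andP[]; rewrite ge_max; lra.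
have ppM n : \sum_(w <- wordsB d n) pp w <= M.
  by apply: le_trans (qM n); apply: ler_sum.
have pnM n : \sum_(w <- wordsB d n) pn w <= M.
  by apply: le_trans (qM n); apply: ler_sum.
have fin r : (forall w, 0 <= r w) -> (forall n, \sum_(w <- wordsB d n) r w <= M) ->
    (\esum_(w in [set: word]) (r w)%:E \is a fin_num)%E.
  move=> r0 rM; rewrite ge0_fin_numE; last by apply: esum_ge0 => w _; rewrite lee_fin.
  exact: le_lt_trans (le_esum_wsum r0 rM) (ltry _).
rewrite fineB ?fin //.
rewrite (_ : (fun n => _) = fun n =>
  \sum_(w <- wordsB d n) pp w - \sum_(w <- wordsB d n) pn w).
  by apply: cvgB; [exact: (esum_wsum_cvg pp0 ppM)|exact: (esum_wsum_cvg pn0 pnM)].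
apply/funext => n; rewrite -sumrB; apply: eq_bigr => w _.
rewrite /pp /pn /Order.max; case: (ltP (p w) 0); case: (ltP (- p w) 0); lra.
Qed.

End WordSums.

Section L2Facts.
Variables (R : realType) (d : nat).
Local Notation C := R[i].
Local Notation word := (seq 'I_d).
Local Notation l2 := (l2 R d).
Implicit Types (f g h : l2).

Lemma sq_summablebP (F : word -> C) :
  reflect (exists M, forall n, \sum_(w <- wordsB d n) normc (F w) ^+ 2 <= M)
    (F \in @sq_summableb R d).
Proof.
have F0 w : 0 <= normc (F w) ^+ 2 by apply: sqr_ge0.
apply: (iffP (asboolP _)) => [fin|[M FM]]; last first.
  exact: le_lt_trans (le_esum_wsum F0 FM) (ltry _).
exists (fine (\esum_(w in [set: word]) (normc (F w) ^+ 2)%:E)%E) => n.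
rewrite -lee_fin fineK ?wsum_le_esum // ge0_fin_numE //.
by apply: esum_ge0 => w _; rewrite lee_fin.
Qed.

Lemma l2_bounded f : exists M, forall n, \sum_(w <- wordsB d n) normc (f w) ^+ 2 <= M.
Proof. exact/sq_summablebP/l2P. Qed.

Lemma l2dot_lim f g : clim (fun n => \sum_(w <- wordsB d n) f w * (g w)^*) (l2dot f g).
Proof.
have [M fM] := l2_bounded f; have [N gN] := l2_bounded g.
pose q w := normc (f w) ^+ 2 + normc (g w) ^+ 2.
have qM n : \sum_(w <- wordsB d n) q w <= M + N by rewrite big_split lerD.
have le w : normc (f w * (g w)^*) <= q w.
  rewrite normcM normcJ /q; have := sqr_ge0 (normc (f w) - normc (g w)).
  have := mulr_ge0 (normc_ge0 (f w)) (normc_ge0 (g w)).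
  rewrite sqrrB -mulr_natl; lra.
apply: clim_ReIm.
  rewrite -[complex.Re (l2dot f g)]/(rsum (fun w => complex.Re (f w * (g w)^*))).
  rewrite (_ : (fun n => complex.Re _) =
     fun n => \sum_(w <- wordsB d n) complex.Re (f w * (g w)^*)).
    by apply: rsum_cvg qM => w; apply: le_trans (le w); apply: Re_le_normc.
  by apply/funext => n; rewrite Re_sum.
rewrite -[complex.Im (l2dot f g)]/(rsum (fun w => complex.Im (f w * (g w)^*))).
rewrite (_ : (fun n => complex.Im _) =
     fun n => \sum_(w <- wordsB d n) complex.Im (f w * (g w)^*)).
  by apply: rsum_cvg qM => w; apply: le_trans (le w); apply: Im_le_normc.
apply/funext => n; apply: (big_morph (@complex.Im R)) => // x y.
by case: x; case: y.
Qed.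

Lemma l2_ext f g : (forall w, f w = g w) -> f = g.
Proof. by move=> fg; apply/val_inj/funext. Qed.

Lemma l2DE f g w : (f + g) w = f w + g w. Proof. by []. Qed.
Lemma l2NE f w : (- f) w = - f w. Proof. by []. Qed.
Lemma l2ZE c f w : (c *: f) w = c * f w. Proof. by []. Qed.
Lemma l2_sumE I (r : seq I) (P : pred I) (F : I -> l2) w :
  (\sum_(i <- r | P i) F i) w = \sum_(i <- r | P i) F i w.
Proof. by apply: (big_morph (fun f : l2 => f w)). Qed.

Lemma l2dot_linear c f g h : l2dot (c *: f + g) h = c * l2dot f h + l2dot g h.
Proof.
apply: (clim_unique (l2dot_lim _ _)).
rewrite (_ : (fun n => _) = fun n => c * (\sum_(w <- wordsB d n) f w * (h w)^*) +
   \sum_(w <- wordsB d n) g w * (h w)^*).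
  by apply: climD; [apply: climZ|]; apply: l2dot_lim.
apply/funext => n; rewrite mulr_sumr -big_split; apply: eq_bigr => w _.
by rewrite l2DE l2ZE mulrDl mulrA.
Qed.

Lemma l2dotC f g : l2dot g f = (l2dot f g)^*.
Proof.
apply: (clim_unique (l2dot_lim _ _)).
rewrite (_ : (fun n => _) = fun n => (\sum_(w <- wordsB d n) f w * (g w)^*)^*).
  exact/climJ/l2dot_lim.
apply/funext => n; rewrite conjC_sum; apply: eq_bigr => w _.
by rewrite conjCM conjCK mulrC.
Qed.

Lemma l2dot_ge0 f : 0 <= l2dot f f.
Proof.
apply: clim_ge0 (l2dot_lim f f) _ => n; apply: sumr_ge0 => w _.
by rewrite mul_conj ler0c sqr_ge0.
Qed.

Definition l2sip : sip l2 :=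
  @Sip R l2 [set: l2] (@l2dot R d) I (fun _ _ _ _ _ => I)
    (fun c f g h _ _ _ => l2dot_linear c f g h) (fun f g _ _ => l2dotC f g)
    (fun f _ => l2dot_ge0 f).

Local Notation T := (I : sdom l2sip _).

Lemma l2normE f : l2norm f = snorm l2sip f. Proof. by []. Qed.

Lemma l2norm_ge0 f : 0 <= l2norm f. Proof. exact: sqrtr_ge0. Qed.

Lemma l2dotDl f g h : l2dot (f + g) h = l2dot f h + l2dot g h.
Proof. exact: (sdotDl T T T). Qed.

Lemma l2dot0l h : l2dot 0 h = 0. Proof. exact: (sdot0l T). Qed.
Lemma l2dot0r h : l2dot h 0 = 0. Proof. exact: (sdot0r T). Qed.

Lemma l2dotZl c f h : l2dot (c *: f) h = c * l2dot f h.
Proof. exact: (sdotZl _ T T). Qed.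

Lemma l2dotBl f g h : l2dot (f - g) h = l2dot f h - l2dot g h.
Proof. exact: (sdotBl T T T). Qed.

Lemma l2dot_suml I (r : seq I) (P : pred I) (F : I -> l2) h :
  l2dot (\sum_(i <- r | P i) F i) h = \sum_(i <- r | P i) l2dot (F i) h.
Proof. exact: (@sdot_suml _ _ l2sip). Qed.

Lemma l2dotDr f g h : l2dot h (f + g) = l2dot h f + l2dot h g.
Proof. exact: (sdotDr T T T). Qed.

Lemma l2dotZr c f h : l2dot h (c *: f) = c^* * l2dot h f.
Proof. exact: (sdotZr _ T T). Qed.

Lemma l2dotBr f g h : l2dot h (f - g) = l2dot h f - l2dot h g.
Proof. exact: (sdotBr T T T). Qed.

Lemma l2dot_sumr I (r : seq I) (P : pred I) (F : I -> l2) h :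
  l2dot h (\sum_(i <- r | P i) F i) = \sum_(i <- r | P i) l2dot h (F i).
Proof. exact: (@sdot_sumr _ _ l2sip). Qed.

Lemma l2_CauchySchwarz f g : normc (l2dot f g) <= l2norm f * l2norm g.
Proof. exact: (CauchySchwarz T T). Qed.

Lemma ler_l2normD f g : l2norm (f + g) <= l2norm f + l2norm g.
Proof. exact: (ler_snormD T T). Qed.

Lemma l2normBsqr f g :
  l2norm (f - g) ^+ 2 = l2norm f ^+ 2 + l2norm g ^+ 2 - 2 * complex.Re (l2dot f g).
Proof.
by rewrite !l2normE (snormDsqr T T) (snormN T) (sdotNr T T) ReN mulrN.
Qed.

Lemma l2normZ c f : l2norm (c *: f) = normc c * l2norm f.
Proof. exact: (snormZ _ T). Qed.

Lemma l2normN f : l2norm (- f) = l2norm f.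
Proof. exact: (snormN T). Qed.

Lemma l2dotE f : l2dot f f = (l2norm f ^+ 2)%:C%C.
Proof. exact: (snormE T). Qed.

Lemma l2norm_sqr_cvg f :
  (fun n => \sum_(w <- wordsB d n) normc (f w) ^+ 2) @ \oo --> l2norm f ^+ 2.
Proof.
rewrite l2normE (snorm_sqr T) (_ : (fun n => _) = fun n =>
   complex.Re (\sum_(w <- wordsB d n) f w * (f w)^*)).
  exact/clim_Re/l2dot_lim.
by apply/funext => n; rewrite Re_sum; apply: eq_bigr => w _; rewrite mul_conj.
Qed.

Lemma wsum_le_l2norm f n : \sum_(w <- wordsB d n) normc (f w) ^+ 2 <= l2norm f ^+ 2.
Proof.
rewrite leNgt; apply/negP => lt.
have /cvgrPdist_lt/(_ (\sum_(w <- wordsB d n) normc (f w) ^+ 2 - l2norm f ^+ 2)) :=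
  l2norm_sqr_cvg (f := f).
rewrite subr_gt0 => /(_ lt)[N _ /(_ (maxn n N) (leq_maxr _ _))] /=.
have := @wsum_mono R d _ _ _ (fun w => sqr_ge0 (normc (f w))) (leq_maxl n N).
move=> le; rewrite distrC ger0_norm ?subr_ge0 ?(le_trans (ltW lt)) //; lra.
Qed.

Lemma l2norm_le f M : 0 <= M ->
  (forall n, \sum_(w <- wordsB d n) normc (f w) ^+ 2 <= M ^+ 2) -> l2norm f <= M.
Proof.
move=> M0 fM; rewrite -ler_sqr ?nnegrE ?l2norm_ge0 //.
rewrite leNgt; apply/negP => lt.
have /cvgrPdist_lt/(_ (l2norm f ^+ 2 - M ^+ 2)) := l2norm_sqr_cvg (f := f).
rewrite subr_gt0 => /(_ lt)[N _ /(_ N (leqnn _))] /=.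
have := fM N => le; rewrite ger0_norm ?subr_ge0 ?(le_trans le (ltW lt)) //; lra.
Qed.

Lemma l2dot_xi f v : l2dot f (xi R v) = f v.
Proof.
apply: (clim_unique (l2dot_lim _ _)); apply/(@clim_shift _ _ _ (size v).+1).
rewrite (_ : (fun n => _) = fun=> f v); first exact: clim_cst.
apply/funext => n; transitivity (\sum_(w <- wordsB d (n + (size v).+1) | w == v) f w).
  rewrite [RHS]big_mkcond; apply: eq_bigr => w _ /=.
  by case: eqP => _; rewrite ?conjC1 ?conjC0 ?mulr1 ?mulr0.
by rewrite sum_wordsB_delta addnS ltnS leq_addl.
Qed.

Lemma xiE (v w : word) : xi R v w = (w == v)%:R. Proof. by []. Qed.

Definition trunc (n : nat) f : l2 := \sum_(w <- wordsB d n) f w *: xi R w.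

Lemma l2dot_fin_sumr f n (c : word -> C) :
  l2dot f (\sum_(w <- wordsB d n) c w *: xi R w) = \sum_(w <- wordsB d n) (c w)^* * f w.
Proof.
by rewrite l2dot_sumr; apply: eq_bigr => w _; rewrite l2dotZr l2dot_xi.
Qed.

Lemma fin_sumE n (c : word -> C) v :
  (\sum_(w <- wordsB d n) c w *: xi R w) v = if (size v < n)%N then c v else 0.
Proof.
rewrite l2_sumE -sum_wordsB_delta [RHS]big_mkcond; apply: eq_bigr => w _.
by rewrite l2ZE xiE eq_sym; case: eqP; rewrite ?mulr1 ?mulr0.
Qed.

Lemma l2norm_fin_sum n (c : word -> C) :
  l2norm (\sum_(w <- wordsB d n) c w *: xi R w) ^+ 2 =
  \sum_(w <- wordsB d n) normc (c w) ^+ 2.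
Proof.
apply: (@complexI R); rewrite -l2dotE l2dot_fin_sumr rmorph_sum.
by apply: eq_big_seq => w; rewrite fin_sumE -mem_wordsB => ->; rewrite mulrC mul_conj.
Qed.

Lemma trunc_cvg f (e : R) : 0 < e ->
  exists N, forall n, (N <= n)%N -> l2norm (f - trunc n f) < e.
Proof.
move=> e0; have /cvgrPdist_lt/(_ (e ^+ 2)) := l2norm_sqr_cvg (f := f).
rewrite exprn_gt0 // => /(_ isT)[N _ hN]; exists N => n /hN /=.
have := wsum_le_l2norm f n => le; rewrite ger0_norm ?subr_ge0 // => lt.
rewrite -ltr_sqr ?nnegrE ?l2norm_ge0 ?(ltW e0) //.
rewrite l2normBsqr /trunc; rewrite l2norm_fin_sum l2dot_fin_sumr Re_sum.
suff -> : \sum_(w <- wordsB d n) complex.Re ((f w)^* * f w) =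
  \sum_(w <- wordsB d n) normc (f w) ^+ 2 by lra.
by apply: eq_bigr => w _; rewrite mulrC mul_conj.
Qed.

Lemma l2norm_eq0 f : l2norm f = 0 -> f = 0.
Proof.
move=> f0; apply: l2_ext => w; rewrite -[LHS]l2dot_xi.
apply/eq0_normc/eqP; rewrite eq_le normc_ge0 andbT.
by apply: le_trans (CauchySchwarz T T) _; rewrite -l2normE f0 mul0r.
Qed.

Lemma l2dot_inj f g : (forall h, l2dot f h = l2dot g h) -> f = g.
Proof. by move=> fg; apply: l2_ext => w; rewrite -!l2dot_xi fg. Qed.

Lemma l2norm_xi (v : word) : l2norm (xi R v) = 1.
Proof. by rewrite /l2norm l2dot_xi xiE eqxx sqrtr1. Qed.

End L2Facts.

(** * Bounded operators on the Fock space *)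

Section Operators.
Variables (R : realType) (d : nat).
Local Notation C := R[i].
Local Notation word := (seq 'I_d).
Local Notation l2 := (l2 R d).
Local Notation op := (l2 -> l2).
Implicit Types (A B D : op) (f g : l2).

Lemma opDE A B f : (A + B) f = A f + B f. Proof. by []. Qed.
Lemma opZE c A f : (c *: A) f = c *: A f. Proof. by []. Qed.
Lemma opNE A f : (- A) f = - A f. Proof. by []. Qed.
Lemma op_sumE I (r : seq I) (P : pred I) (F : I -> op) f :
  (\sum_(i <- r | P i) F i) f = \sum_(i <- r | P i) F i f.
Proof. by apply: (big_morph (fun A : op => A f)). Qed.

Section Linear.
Variables (A : op) (bA : bounded_operator A).

Lemma bopD f g : A (f + g) = A f + A g.
Proof. by have := bA.1 1 f g; rewrite !scale1r. Qed.

Lemma bop_0 : A 0 = 0.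
Proof. by apply: (addrI (A 0)); rewrite -bopD !addr0. Qed.

Lemma bopZ c f : A (c *: f) = c *: A f.
Proof. by have := bA.1 c f 0; rewrite bop_0 !addr0. Qed.

Lemma bopN f : A (- f) = - A f.
Proof. by rewrite -scaleN1r bopZ scaleN1r. Qed.

Lemma bopB f g : A (f - g) = A f - A g.
Proof. by rewrite bopD bopN. Qed.

Lemma bop_sum I (r : seq I) (P : pred I) (F : I -> l2) :
  A (\sum_(i <- r | P i) F i) = \sum_(i <- r | P i) A (F i).
Proof. by apply: (big_morph A bopD bop_0). Qed.

Lemma bop_norm : exists2 M, 0 <= M & opnorm_le A M.
Proof.
case: bA => _ [M AM]; exists (Num.max M 0); rewrite ?le_max ?lexx ?orbT // => f.
by apply: le_trans (AM f) _; rewrite ler_wpM2r ?l2norm_ge0 // le_max lexx.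
Qed.

End Linear.

Lemma opnormD A B M N : opnorm_le A M -> opnorm_le B N -> opnorm_le (A + B) (M + N).
Proof.
move=> AM BN f; rewrite opDE mulrDl.
by apply: le_trans (ler_l2normD _ _) _; rewrite lerD.
Qed.

Lemma opnormZ A M c : opnorm_le A M -> opnorm_le (c *: A) (normc c * M).
Proof. by move=> AM f; rewrite opZE l2normZ -mulrA ler_wpM2l ?normc_ge0. Qed.

Lemma opnormN A M : opnorm_le A M -> opnorm_le (- A) M.
Proof. by move=> AM f; rewrite opNE l2normN. Qed.

Lemma opnorm_comp A B M N : 0 <= M -> opnorm_le A M -> opnorm_le B N ->
  opnorm_le (A \o B) (M * N).
Proof.
by move=> M0 AM BN f; apply: le_trans (AM _) _; rewrite -mulrA ler_wpM2l.
Qed.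

Lemma opnorm_le_trans A M N : M <= N -> opnorm_le A M -> opnorm_le A N.
Proof.
by move=> MN AM f; apply: le_trans (AM f) _; rewrite ler_wpM2r ?l2norm_ge0.
Qed.

Lemma opnorm0 : opnorm_le (0 : op) 0.
Proof.
move=> f; rewrite mul0r (_ : l2norm _ = 0) //; exact: (snorm0 (l2sip R d)).
Qed.

Lemma opnorm1 : opnorm_le (@op1 R d) 1.
Proof. by move=> f; rewrite mul1r. Qed.

Lemma opnorm_sum I (r : seq I) (P : pred I) (F : I -> op) (M : I -> R) :
  (forall i, P i -> opnorm_le (F i) (M i)) ->
  opnorm_le (\sum_(i <- r | P i) F i) (\sum_(i <- r | P i) M i).
Proof.
move=> FM; elim/big_rec2: _ => [|i m A Pi Am]; first exact: opnorm0.
by apply: opnormD => //; apply: FM.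
Qed.

Definition subsp (P : set op) :=
  P 0 /\ forall c A B, P A -> P B -> P (c *: A + B).

Section Subsp.
Variables (P : set op) (sP : subsp P).

Lemma subspZ c A : P A -> P (c *: A).
Proof. by move=> PA; have := sP.2 c A 0 PA sP.1; rewrite addr0. Qed.

Lemma subspD A B : P A -> P B -> P (A + B).
Proof. by move=> PA PB; have := sP.2 1 A B PA PB; rewrite scale1r. Qed.

Lemma subspN A : P A -> P (- A).
Proof. by move=> PA; rewrite -scaleN1r; apply: subspZ. Qed.

Lemma subspB A B : P A -> P B -> P (A - B).
Proof. by move=> PA PB; apply: subspD => //; apply: subspN. Qed.

Lemma subsp_sum I (r : seq I) (Q : pred I) (F : I -> op) :
  (forall i, Q i -> P (F i)) -> P (\sum_(i <- r | Q i) F i).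
Proof.
move=> PF; elim/big_rec: _ => [|i A Qi PA]; first exact: sP.1.
by apply: subspD => //; apply: PF.
Qed.

End Subsp.

Lemma bop_subsp : subsp (@bounded_operator R d).
Proof.
split=> [|c A B bA bB].
  by split; [move=> c f g; rewrite scaler0 addr0|exists 0; apply: opnorm0].
split=> [a f g|].
  by rewrite !opDE !opZE bA.1 bB.1 !scalerDr !scalerA mulrC addrACA.
case: bA => _ [M AM]; case: bB => _ [N BN].
by exists (normc c * M + N); apply: opnormD => //; apply: opnormZ.
Qed.

Lemma bop1 : bounded_operator (@op1 R d).
Proof. by split=> //; exists 1; apply: opnorm1. Qed.

Lemma bop_comp A B : bounded_operator A -> bounded_operator B ->
  bounded_operator (A \o B).
Proof.
move=> bA bB; split=> [c f g|]; first by rewrite /= bB.1 bA.1.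
have [M M0 AM] := bop_norm bA; have [N _ BN] := bop_norm bB.
by exists (M * N); apply: opnorm_comp.
Qed.

Lemma comp_linr c A B D : bounded_operator D ->
  D \o (c *: A + B) = c *: (D \o A) + (D \o B).
Proof. by move=> bD; apply/funext => f; rewrite /= bD.1. Qed.

Lemma is_adjoint_uniq A B B' : is_adjoint A B -> is_adjoint A B' -> B = B'.
Proof.
move=> AB AB'; apply/funext => g; apply: l2dot_inj => h.
by rewrite l2dotC -AB AB' -l2dotC.
Qed.

Lemma adjE A B : is_adjoint A B -> adj A = B.
Proof.
move=> AB; rewrite /adj; case: xgetP => [B' _ AB'|/(_ B)]; last by [].
exact: is_adjoint_uniq AB' AB.
Qed.

(** The adjoint is forced on coordinates by [B g v = <g, A (xi v)>]; testing
    [A] on the truncations of this family shows that it is square summable, and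
    truncating the other argument that it is an adjoint. *)
Lemma adj_ex A : bounded_operator A -> exists B, is_adjoint A B.
Proof.
move=> bA; have [M M0 AM] := bop_norm bA.
pose c g w := l2dot g (A (xi R w)).
have cl2 g : c g \in @sq_summableb R d.
  apply/sq_summablebP; exists ((l2norm g * M) ^+ 2) => n.
  set S := \sum_(w <- _) _.
  have S0 : 0 <= S by apply: sumr_ge0 => w _; apply: sqr_ge0.
  pose h : l2 := \sum_(w <- wordsB d n) c g w *: xi R w.
  have hS : l2norm h ^+ 2 = S by rewrite l2norm_fin_sum.
  have gh : l2dot g (A h) = S%:C%C.
    rewrite /h bop_sum // l2dot_sumr /S rmorph_sum; apply: eq_bigr => w _.
    by rewrite bopZ // l2dotZr mulrC mul_conj.
  have le : S <= l2norm g * M * l2norm h.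
    have := l2_CauchySchwarz g (A h); rewrite gh normc_real ger0_norm // => le.
    by apply: le_trans le _; rewrite -mulrA ler_wpM2l ?l2norm_ge0.
  have [h0|h0] := eqVneq (l2norm h) 0.
    by rewrite -hS h0 expr0n sqr_ge0.
  have hp : 0 < l2norm h by rewrite lt_def h0 l2norm_ge0.
  move: le; rewrite -hS expr2 ler_pM2r // => le.
  by rewrite -expr2 ler_sqr // nnegrE ?l2norm_ge0 ?mulr_ge0 ?l2norm_ge0.
pose B g : l2 := L2 (cl2 g).
exists B => f g; apply/eqP; rewrite -subr_eq0; apply/eqP/eq0_normc/eqP.
rewrite eq_le normc_ge0 andbT.
apply: (@le0_eps _ _ (M * l2norm g + l2norm (B g))) => e e0.
have [n /(_ n (leqnn _)) fn] := trunc_cvg f e0.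
have tE : l2dot (A (trunc n f)) g = l2dot (trunc n f) (B g).
  rewrite /trunc bop_sum // !l2dot_suml; apply: eq_bigr => w _.
  by rewrite bopZ // !l2dotZl [in RHS]l2dotC l2dot_xi /= /c -l2dotC.
have -> : l2dot (A f) g - l2dot f (B g) =
  l2dot (A (f - trunc n f)) g - l2dot (f - trunc n f) (B g).
  by rewrite bopB // !l2dotBl tE opprB addrA subrK.
apply: le_trans (le_normcD _ _) _; rewrite normcN mulrDl; apply: lerD.
  apply: le_trans (l2_CauchySchwarz _ _) _; rewrite mulrAC.
  rewrite ler_wpM2r ?l2norm_ge0 //; apply: le_trans (AM _) _.
  by rewrite ler_wpM2l // ltW.
apply: le_trans (l2_CauchySchwarz _ _) _; rewrite mulrC.
by rewrite ler_wpM2l ?l2norm_ge0 // ltW.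
Qed.

Lemma adjP A : bounded_operator A -> is_adjoint A (adj A).
Proof. by move=> /adj_ex[B AB]; rewrite (adjE AB). Qed.

Lemma is_adjointC A B : is_adjoint A B -> is_adjoint B A.
Proof. by move=> AB f g; rewrite l2dotC -AB -l2dotC. Qed.

Lemma adj_opnorm A M : bounded_operator A -> 0 <= M -> opnorm_le A M ->
  opnorm_le (adj A) M.
Proof.
move=> bA M0 AM g; set h := adj A g.
have [h0|h0] := eqVneq (l2norm h) 0; first by rewrite h0 mulr_ge0 ?l2norm_ge0.
have hp : 0 < l2norm h by rewrite lt_def h0 l2norm_ge0.
rewrite -(ler_pM2r hp) -expr2.
have := l2_CauchySchwarz (A h) g; rewrite adjP // -/h l2dotE normc_real.
rewrite ger0_norm ?sqr_ge0 // => le; apply: le_trans le _.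
by rewrite mulrAC ler_wpM2r ?l2norm_ge0.
Qed.

Lemma bop_adj A : bounded_operator A -> bounded_operator (adj A).
Proof.
move=> bA; split=> [c f g|].
  apply: l2dot_inj => h; rewrite l2dotDl l2dotZl.
  by rewrite !(is_adjointC (adjP bA)) l2dotDl l2dotZl.
by have [M M0 AM] := bop_norm bA; exists M; apply: adj_opnorm.
Qed.

Lemma adjK A : bounded_operator A -> adj (adj A) = A.
Proof. by move=> bA; apply/adjE/is_adjointC/adjP. Qed.

Lemma adj_lin c A B : bounded_operator A -> bounded_operator B ->
  adj (c *: A + B) = c^* *: adj A + adj B.
Proof.
move=> bA bB; apply: adjE => f g.
by rewrite !opDE !opZE l2dotDl l2dotZl l2dotDr l2dotZr conjCK !adjP.
Qed.

Lemma adj0 : adj (0 : op) = 0.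
Proof.
apply: adjE => f g.
by rewrite -[(0 : op) f]/(0 : l2) -[(0 : op) g]/(0 : l2) l2dot0l l2dot0r.
Qed.

Lemma adj1 : adj (@op1 R d) = @op1 R d. Proof. exact: adjE. Qed.

Lemma adj_comp A B : bounded_operator A -> bounded_operator B ->
  adj (A \o B) = adj B \o adj A.
Proof. by move=> bA bB; apply: adjE => f g; rewrite /= !adjP. Qed.

Lemma adjD A B : bounded_operator A -> bounded_operator B ->
  adj (A + B) = adj A + adj B.
Proof. by move=> bA bB; have := adj_lin 1 bA bB; rewrite conjC1 !scale1r. Qed.

Lemma adjZ c A : bounded_operator A -> adj (c *: A) = c^* *: adj A.
Proof.
by move=> bA; have := adj_lin c bA bop_subsp.1; rewrite adj0 !addr0.
Qed.

Lemma adjB A B : bounded_operator A -> bounded_operator B ->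
  adj (A - B) = adj A - adj B.
Proof.
move=> bA bB; rewrite adjD //; last exact: (subspN bop_subsp).
by rewrite -scaleN1r adjZ // conjCN conjC1 scaleN1r.
Qed.

Lemma adj_sum I (r : seq I) (P : pred I) (F : I -> op) :
  (forall i, P i -> bounded_operator (F i)) ->
  adj (\sum_(i <- r | P i) F i) = \sum_(i <- r | P i) adj (F i).
Proof.
move=> bF; apply: adjE => f g; rewrite !op_sumE l2dot_suml l2dot_sumr.
by apply: eq_bigr => i Pi; rewrite adjP //; apply: bF.
Qed.

Lemma opspan_subsp (G : set op) : subsp (opspan G).
Proof.
split.
  exists 0%N, (fun=> 0), (fun=> 0); split; first by case.
  by rewrite big_ord0.
move=> a _ _ [n [c [A [GA ->]]]] [m [c' [B [GB ->]]]].
exists (n + m)%N,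
  (fun k => match fintype.split k with inl i => a * c i | inr j => c' j end),
  (fun k => match fintype.split k with inl i => A i | inr j => B j end).
split=> [k|]; first by case: (fintype.split k).
rewrite big_split_ord scaler_sumr; congr (_ + _); apply: eq_bigr => i _.
  by rewrite -[lshift _ _]/(unsplit (inl i)) unsplitK scalerA.
by rewrite -[rshift _ _]/(unsplit (inr i)) unsplitK.
Qed.

Lemma opspan_incl (G : set op) A : G A -> opspan G A.
Proof.
move=> GA; exists 1%N, (fun=> 1), (fun=> A); split=> //.
by rewrite big_ord1 scale1r.
Qed.

Lemma opspan_min (G P : set op) : subsp P -> G `<=` P -> opspan G `<=` P.
Proof.
move=> sP GP _ [n [c [A [GA ->]]]]; apply: (subsp_sum sP) => k _.
by apply: subspZ => //; apply: GP.
Qed.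

Lemma opclosure_bop (P : set op) A : opclosure P A -> bounded_operator A.
Proof. by case. Qed.

Lemma opclosure_incl (P : set op) A : bounded_operator A -> P A -> opclosure P A.
Proof.
move=> bA PA; split=> // e e0; exists A => //; rewrite subrr.
by apply: opnorm_le_trans (ltW e0) opnorm0.
Qed.

Lemma opclosure_subsp (P : set op) : subsp P -> subsp (opclosure P).
Proof.
move=> sP; split.
  by apply: opclosure_incl; [exact: bop_subsp.1|exact: sP.1].
move=> c A B [bA clA] [bB clB]; split; first exact: bop_subsp.2.
move=> e e0; pose k := normc c + 1.
have k0 : 0 < k by rewrite ltr_wpDl ?normc_ge0.
have e2 : 0 < e / 2 by rewrite divr_gt0.
have [A' PA' AA'] := clA _ (divr_gt0 e2 k0); have [B' PB' BB'] := clB _ e2.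
exists (c *: A' + B'); first exact: sP.2.
rewrite (_ : _ - _ = c *: (A - A') + (B - B')); last first.
  by rewrite scalerBr opprD addrACA.
apply: opnorm_le_trans (opnormD (opnormZ c AA') BB').
rewrite -lerBrDr (_ : e - e / 2 = k * (e / 2 / k)); last first.
  by field; rewrite gt_eqF.
by rewrite ler_wpM2r ?ltW ?divr_gt0 // ltrDl.
Qed.

Lemma opclosure_closed (P : set op) A : bounded_operator A ->
  (forall e : R, 0 < e -> exists2 B, opclosure P B & opnorm_le (A - B) e) ->
  opclosure P A.
Proof.
move=> bA clA; split=> // e e0; have e2 : 0 < e / 2 by rewrite divr_gt0.
have [B [_ /(_ _ e2)[B' PB' BB']] AB] := clA _ e2; exists B' => //.
rewrite -(subrKA B) [e in opnorm_le _ e](_ : e = e / 2 + e / 2); last by field.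
exact: opnormD.
Qed.

Lemma opclosure_min (P Q : set op) : P `<=` opclosure Q ->
  opclosure P `<=` opclosure Q.
Proof.
move=> PQ A [bA clA]; apply: opclosure_closed => // e /clA[B PB AB].
by exists B => //; apply: PQ.
Qed.

End Operators.

(** * The free semigroup operators and their resolvents *)

Section Ball.
Variables (R : realType) (d : nat).
Local Notation C := R[i].
Implicit Types (z w : 'rV[C]_d).

Lemma cdotC z w : cdot w z = (cdot z w)^*.
Proof.
by rewrite /cdot conjC_sum; apply: eq_bigr => j _; rewrite conjCM conjCK mulrC.
Qed.

Lemma cdot_self w : cdot w w = (enorm w ^+ 2)%:C%C.
Proof.
have -> : cdot w w = (\sum_j normc (w 0 j) ^+ 2)%:C%C.
  by rewrite rmorph_sum; apply: eq_bigr => j _; rewrite mul_conj.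
rewrite /enorm /cdot; congr (_%:C%C); rewrite sqr_sqrtr.
  by rewrite Re_sum; apply: eq_bigr => j _; rewrite mul_conj.
by rewrite Re_sum sumr_ge0 // => j _; rewrite mul_conj sqr_ge0.
Qed.

Lemma enorm_ge0 w : 0 <= enorm w. Proof. exact: sqrtr_ge0. Qed.

Lemma enorm_sqr w : enorm w ^+ 2 = \sum_j normc (w 0 j) ^+ 2.
Proof.
apply: (@complexI R); rewrite -cdot_self rmorph_sum.
by apply: eq_bigr => j _; rewrite mul_conj.
Qed.

Lemma enormZ (t : R) w : 0 <= t -> enorm (t%:C%C *: w) = t * enorm w.
Proof.
move=> t0; apply/eqP; rewrite -(@eqrXn2 _ 2) ?enorm_ge0 ?mulr_ge0 ?enorm_ge0 //.
rewrite exprMn !enorm_sqr mulr_sumr; apply/eqP/eq_bigr => j _.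
by rewrite mxE normcM normc_real exprMn ger0_norm.
Qed.

Lemma cdot_0l w : cdot 0 w = 0.
Proof. by rewrite /cdot big1 // => j _; rewrite mxE mul0r. Qed.

Lemma cdot_0r w : cdot w 0 = 0.
Proof. by rewrite cdotC cdot_0l conjC0. Qed.

Lemma pt0 : pt (cball0 R d) = 0. Proof. by []. Qed.

Lemma pt_lt1 (z : cball R d) : enorm (pt z) < 1. Proof. exact: (svalP z). Qed.

End Ball.

Section Fock.
Variables (R : realType) (d : nat).
Local Notation C := R[i].
Local Notation word := (seq 'I_d).
Local Notation l2 := (l2 R d).
Local Notation op := (l2 -> l2).
Local Notation op1 := (@op1 R d).
Implicit Types (A B D : op) (f g : l2) (z w : 'rV[C]_d).

Lemma Lop_cons i f j v : Lop i f (j :: v) = if j == i then f v else 0.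
Proof. by []. Qed.

Lemma opnorm_Lop i : opnorm_le (@Lop R d i) 1.
Proof.
move=> f; rewrite mul1r; apply: l2norm_le => [|[|n]]; first exact: l2norm_ge0.
  by rewrite sum_wordsB0 sqr_ge0.
rewrite sum_wordsBS [X in X + _](_ : _ = 0) ?add0r; last first.
  by rewrite [Lop i f [::]]/(0 : C) normc0 expr0n.
rewrite (eq_bigr (fun j => if j == i then \sum_(v <- wordsB d n) normc (f v) ^+ 2
  else 0)) => [|j _]; first by rewrite -big_mkcond big_pred1_eq wsum_le_l2norm.
case: eqP => [->|/eqP/negPf ji].
  by apply: eq_bigr => v _; rewrite Lop_cons eqxx.
by apply: big1 => v _; rewrite Lop_cons ji normc0 expr0n.
Qed.

Lemma bop_Lop i : bounded_operator (@Lop R d i).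
Proof.
split; last by exists 1; apply: opnorm_Lop.
move=> c f g; apply: l2_ext => -[|j v]; rewrite l2DE l2ZE.
  by rewrite [LHS]/(0 : C) [Lop i f [::]]/(0 : C) mulr0 add0r.
by rewrite !Lop_cons l2DE l2ZE; case: eqP; rewrite // mulr0 addr0.
Qed.

Lemma opnorm_Lword s : opnorm_le (@Lword R d s) 1.
Proof.
elim: s => [|i s IH] f; first by rewrite mul1r.
by apply: le_trans (opnorm_Lop _ _) _; rewrite mul1r; apply: IH.
Qed.

Lemma bop_Lword s : bounded_operator (@Lword R d s).
Proof.
elim: s => [|i s IH]; first exact: bop1.
by apply: bop_comp => //; apply: bop_Lop.
Qed.

Lemma Lword_xi s u : @Lword R d s (xi R u) = xi R (s ++ u).
Proof. by elim: s => //= i s ->; rewrite Lop_xi. Qed.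

(** The operator written L w^* in the literature. *)
Definition Lrow w : op := \sum_j (w 0 j)^* *: Lop j.

Lemma bop_Lrow w : bounded_operator (Lrow w).
Proof.
apply: (subsp_sum (@bop_subsp R d)) => j _.
exact/(subspZ (@bop_subsp R d))/bop_Lop.
Qed.

Lemma Lrow_nil w f : Lrow w f [::] = 0.
Proof. by rewrite /Lrow op_sumE l2_sumE big1 // => j _; rewrite opZE l2ZE mulr0. Qed.

Lemma Lrow_cons w f i v : Lrow w f (i :: v) = (w 0 i)^* * f v.
Proof.
rewrite /Lrow op_sumE l2_sumE.
rewrite (eq_bigr (fun j => if j == i then (w 0 i)^* * f v else 0)) => [|j _].
  by rewrite -big_mkcond big_pred1_eq.
by rewrite opZE l2ZE Lop_cons eq_sym; case: eqP => [->|]; rewrite ?mulr0.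
Qed.

(** The ranges of the [Lop j] are orthogonal, so the composition of the adjoint
    of [Lrow z] with [Lrow w] is a scalar. *)
Lemma l2dot_Lrow z w f g : l2dot (Lrow w f) (Lrow z g) = cdot z w * l2dot f g.
Proof.
apply: clim_unique (l2dot_lim _ _) _; apply/(@clim_shift _ _ _ 1).
rewrite (_ : (fun n => _) =
  fun n => cdot z w * \sum_(v <- wordsB d n) f v * (g v)^*).
  exact/climZ/l2dot_lim.
apply/funext => n; rewrite addn1 sum_wordsBS Lrow_nil mul0r add0r.
rewrite /cdot mulr_suml; apply: eq_bigr => j _; rewrite mulr_sumr.
by apply: eq_bigr => v _; rewrite !Lrow_cons conjCM conjCK; ring.
Qed.

Lemma l2norm_Lrow w f : l2norm (Lrow w f) = enorm w * l2norm f.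
Proof.
apply/eqP; rewrite -(@eqrXn2 _ 2) ?l2norm_ge0 ?mulr_ge0 ?enorm_ge0 ?l2norm_ge0 //.
apply/eqP/(@complexI R); rewrite -l2dotE l2dot_Lrow cdot_self l2dotE.
by rewrite -rmorphM exprMn.
Qed.

Lemma zLadjE z : zLadj z = adj (Lrow z).
Proof.
rewrite adj_sum => [|j _]; last exact/(subspZ (@bop_subsp R d))/bop_Lop.
by apply: eq_bigr => j _; rewrite adjZ ?conjCK //; apply: bop_Lop.
Qed.

Definition Lpow w m : op := iter m (fun A => Lrow w \o A) op1.

Definition wpow w (s : word) : C := \prod_(i <- s) w 0 i.

Lemma LpowS w m : Lpow w m.+1 = Lrow w \o Lpow w m. Proof. by []. Qed.

Lemma bop_Lpow w m : bounded_operator (Lpow w m).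
Proof.
elim: m => [|m IH]; first exact: bop1.
by rewrite LpowS; apply: bop_comp => //; apply: bop_Lrow.
Qed.

Lemma LpowC w m f : Lpow w m (Lrow w f) = Lrow w (Lpow w m f).
Proof. by elim: m => // m IH; rewrite LpowS /= IH. Qed.

Lemma opnorm_Lpow w m : opnorm_le (Lpow w m) (enorm w ^+ m).
Proof.
elim: m => [|m IH] f; first by rewrite mul1r.
by rewrite LpowS /= l2norm_Lrow exprS -mulrA ler_wpM2l ?enorm_ge0.
Qed.

Lemma LpowE w m : Lpow w m = \sum_(s <- words d m) (wpow w s)^* *: Lword s.
Proof.
elim: m => [|m IH]; first by rewrite sum_words0 /wpow big_nil conjC1 scale1r.
apply/funext => f; rewrite LpowS /= IH sum_wordsS /Lrow !op_sumE.
apply: eq_bigr => j _; rewrite !op_sumE opZE (bop_sum (bop_Lop j)) scaler_sumr.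
apply: eq_bigr => s _; rewrite !opZE (bopZ (bop_Lop j)) scalerA.
by rewrite /wpow big_cons conjCM.
Qed.

Lemma wpow_rcons w a j : wpow w (rcons a j) = wpow w a * w 0 j.
Proof. by rewrite /wpow -cats1 big_cat big_seq1. Qed.

Lemma sum_wpow w n :
  \sum_(a <- words d n) normc (wpow w a) ^+ 2 = (enorm w ^+ n) ^+ 2.
Proof.
elim: n => [|n IH]; first by rewrite sum_words0 /wpow big_nil normc1 expr0.
rewrite sum_words_rcons (exprSr (enorm w) n) exprMn -IH mulr_suml; apply: eq_bigr => a _.
rewrite enorm_sqr mulr_sumr; apply: eq_bigr => j _.
by rewrite wpow_rcons normcM exprMn.
Qed.

Lemma LpowZ (t : R) w m : Lpow (t%:C%C *: w) m = (t ^+ m)%:C%C *: Lpow w m.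
Proof.
rewrite !LpowE scaler_sumr; apply: eq_big_seq => s.
rewrite mem_words => /eqP sm; rewrite scalerA; congr (_ *: _).
rewrite -sm /wpow; elim: s {sm} => [|i s IH].
  by rewrite !big_nil expr0 conjC1 mulr1.
by rewrite !big_cons !conjCM IH mxE conjCM conjC_real exprS rmorphM /=; ring.
Qed.

(** The inverse of [1 - Lrow w]: solving [g - Lrow w g = f] determines [g]
    letter by letter, since [Lrow w] only shifts words. *)
Fixpoint resolvent_fun w (f : word -> C) (v : word) : C :=
  if v is j :: u then f v + (w 0 j)^* * resolvent_fun w f u else f [::].

Lemma l2norm_trunc n f : l2norm (trunc n f) <= l2norm f.
Proof.
rewrite -ler_sqr ?nnegrE ?l2norm_ge0 // /trunc l2norm_fin_sum.
exact: wsum_le_l2norm.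
Qed.

(** On words of length at most [n] the solution is [f] plus the image under
    [Lrow w] of the solution on shorter words, whence a geometric bound. *)
Lemma resolvent_fun_bound w f n : enorm w < 1 ->
  l2norm (\sum_(v <- wordsB d n) resolvent_fun w f v *: xi R v) <= l2norm f / (1 - enorm w).
Proof.
move=> w1; have w1' : 0 < 1 - enorm w by rewrite subr_gt0.
elim: n => [|n IH].
  rewrite sum_wordsB0 (_ : l2norm 0 = 0); last exact: (snorm0 (l2sip R d)).
  by rewrite divr_ge0 ?l2norm_ge0 // ltW.
set g := \sum_(v <- wordsB d n) _ in IH *.
have -> : \sum_(v <- wordsB d n.+1) resolvent_fun w f v *: xi R v = trunc n.+1 f + Lrow w g.
  apply: l2_ext => -[|j u]; rewrite l2DE /trunc !fin_sumE.
    by rewrite Lrow_nil addr0.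
  by rewrite Lrow_cons /g fin_sumE /= ltnS; case: ifP; rewrite // mulr0 addr0.
apply: le_trans (ler_l2normD _ _) _; rewrite l2norm_Lrow.
apply: le_trans (lerD (l2norm_trunc _ _) (ler_wpM2l (enorm_ge0 w) IH)) _.
rewrite le_eqVlt; apply/orP; left; apply/eqP; field; rewrite gt_eqF //.
Qed.

Fact resolvent_fun_subproof w f : enorm w < 1 -> resolvent_fun w f \in @sq_summableb R d.
Proof.
move=> w1; apply/sq_summablebP; exists ((l2norm f / (1 - enorm w)) ^+ 2) => n.
rewrite -l2norm_fin_sum ler_sqr ?nnegrE ?l2norm_ge0 //; first exact: resolvent_fun_bound.
by rewrite divr_ge0 ?l2norm_ge0 // subr_ge0 ltW.
Qed.

Definition resolvent (w : cball R d) : op :=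
  fun f => L2 (@resolvent_fun_subproof (pt w) f (pt_lt1 w)).

Section Resolvent.
Variable w : cball R d.
Local Notation w0 := (pt w).

Lemma resolvent_nil f : resolvent w f [::] = f [::]. Proof. by []. Qed.

Lemma resolvent_cons f j u : resolvent w f (j :: u) = f (j :: u) + (w0 0 j)^* * resolvent w f u.
Proof. by []. Qed.

Lemma resolventE f : resolvent w f = f + Lrow w0 (resolvent w f).
Proof.
apply: l2_ext => -[|j u]; first by rewrite l2DE Lrow_nil addr0.
by rewrite l2DE Lrow_cons resolvent_cons.
Qed.

Lemma resolvent_Lrow f : resolvent w (f - Lrow w0 f) = f.
Proof.
apply: l2_ext; elim=> [|j u IH].
  by rewrite resolvent_nil l2DE l2NE Lrow_nil subr0.
by rewrite resolvent_cons l2DE l2NE Lrow_cons IH subrK.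
Qed.

Lemma resolvent_opnorm : opnorm_le (resolvent w) (1 - enorm w0)^-1.
Proof.
move=> f; have w1 : 0 < 1 - enorm w0 by rewrite subr_gt0 pt_lt1.
apply: l2norm_le => [|n]; first by rewrite mulr_ge0 ?l2norm_ge0 ?invr_ge0 ?ltW.
rewrite -l2norm_fin_sum ler_sqr ?nnegrE ?l2norm_ge0 //; last first.
  by rewrite mulr_ge0 ?l2norm_ge0 ?invr_ge0 ?ltW.
by rewrite mulrC; apply: resolvent_fun_bound; apply: pt_lt1.
Qed.

Lemma bop_resolvent : bounded_operator (resolvent w).
Proof.
split; last by exists (1 - enorm w0)^-1; apply: resolvent_opnorm.
move=> c f g; apply: l2_ext; elim=> [|j u IH].
  by rewrite l2DE l2ZE !resolvent_nil l2DE l2ZE.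
by rewrite resolvent_cons IH !l2DE !l2ZE !resolvent_cons; ring.
Qed.

Lemma resolvent_partial n : resolvent w = \sum_(m < n) Lpow w0 m + (Lpow w0 n \o resolvent w).
Proof.
elim: n => [|n IH]; first by rewrite big_ord0 add0r.
rewrite big_ord_recr /= {1}IH -addrA; congr (_ + _).
apply/funext => f; rewrite opDE.
rewrite -[LHS]/(Lpow w0 n (resolvent w f)) -[X in _ + X]/(Lrow w0 (Lpow w0 n (resolvent w f))).
by rewrite [in LHS]resolventE (bopD (bop_Lpow _ _)) LpowC.
Qed.

Lemma resolvent_partial_opnorm n :
  opnorm_le (Lpow w0 n \o resolvent w) (enorm w0 ^+ n * (1 - enorm w0)^-1).
Proof.
apply: opnorm_comp; first by rewrite exprn_ge0 ?enorm_ge0.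
  exact: opnorm_Lpow.
exact: resolvent_opnorm.
Qed.

(** Taking adjoints turns the inverse of [1 - Lrow z] into the one of
    [1 - zLadj z]. *)
Lemma opinv_zLadj : opinv (op1 - zLadj w0) = adj (resolvent w).
Proof.
have bL := bop_Lrow w0; have bk := bop_resolvent.
have b1L : bounded_operator (op1 - Lrow w0).
  by apply: (subspB (@bop_subsp R d)) => //; apply: bop1.
have E : op1 - zLadj w0 = adj (op1 - Lrow w0).
  by rewrite zLadjE adjB ?adj1 //; apply: bop1.
have h1 : (op1 - Lrow w0) \o resolvent w = op1.
  by apply/funext => f; rewrite /= opDE opNE {1}resolventE addrK.
have h2 : resolvent w \o (op1 - Lrow w0) = op1.
  by apply/funext => f; rewrite /= opDE opNE resolvent_Lrow.
have a1 : adj (resolvent w) \o (op1 - zLadj w0) = op1 by rewrite E -adj_comp // h1 adj1.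
have a2 : (op1 - zLadj w0) \o adj (resolvent w) = op1 by rewrite E -adj_comp // h2 adj1.
rewrite /opinv; case: xgetP => [B _ [_ Ba]|/(_ (adj (resolvent w)))[]//].
apply/funext => f.
have a2f : (op1 - zLadj w0) (adj (resolvent w) f) = f.
  exact: (congr1 (fun F : op => F f) a2).
rewrite -{1}a2f; exact: (congr1 (fun F : op => F (adj (resolvent w) f)) Ba).
Qed.

End Resolvent.

(** The inner product of the ball inherits Cauchy-Schwarz from the Fock space
    through [l2dot_Lrow]. *)
Lemma cdot_neq1 (z w : cball R d) : 1 - cdot (pt z) (pt w) != 0.
Proof.
rewrite subr_eq0; apply/eqP => /(congr1 (@normc R)).
rewrite normc1 => E.
have xi1 : l2dot (xi R ([::] : word)) (xi R [::]) = 1 by rewrite l2dot_xi.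
have := l2_CauchySchwarz (Lrow (pt w) (xi R [::])) (Lrow (pt z) (xi R [::])).
rewrite l2dot_Lrow xi1 mulr1 -E !l2norm_Lrow !l2norm_xi !mulr1.
apply/negP; rewrite -ltNge -[ltRHS]mulr1.
apply: (@le_lt_trans _ _ (enorm (pt w))); last by rewrite mulr1 pt_lt1.
by rewrite ler_piMr ?enorm_ge0 // ltW // pt_lt1.
Qed.

(** As the adjoint of [Lrow z] composed with [Lrow w] is the scalar
    [c = cdot z w], expanding both resolvents once gives
    [(1 - c) k_z' k_w = k_z' + k_w - 1], with [k_z'] the adjoint of [k_z].  This
    is why the Gram matrix of the resolvents for a state only depends on the
    values of the state at resolvents. *)
Lemma adj_resolvent_comp (z w : cball R d) :
  adj (resolvent z) \o resolvent w =
  (1 - cdot (pt z) (pt w))^-1 *: (adj (resolvent z) + resolvent w - op1).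
Proof.
have c1 := cdot_neq1 z w.
apply/funext => f; apply: l2dot_inj => h.
rewrite /= opZE !opDE opNE l2dotZl -[LHS](mulKf c1); congr (_ * _).
rewrite !l2dotBl !l2dotDl !(is_adjointC (adjP (bop_resolvent z))).
rewrite mulrBl mul1r -l2dot_Lrow.
have ew : Lrow (pt w) (resolvent w f) = resolvent w f - f.
  by rewrite {2}resolventE addrAC subrr add0r.
have ez : Lrow (pt z) (resolvent z h) = resolvent z h - h.
  by rewrite {2}resolventE addrAC subrr add0r.
by rewrite ew ez !l2dotBl !l2dotBr; ring.
Qed.

End Fock.

(** * The symmetric operator space is spanned by the resolvents *)

Section Sym.
Variables (R : realType) (d : nat).
Local Notation C := R[i].
Local Notation word := (seq 'I_d).
Local Notation l2 := (l2 R d).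
Local Notation op := (l2 -> l2).
Local Notation op1 := (@op1 R d).
Local Notation symop := (@symop R d).
Local Notation symop0 := (@symop0 R d).
Local Notation SSadj := (@SSadj R d).
Implicit Types (A B D : op) (f g : l2).

Lemma LsymE n : @Lsym R d n =
  \sum_(s <- words d (mweight n) | [forall i, count_mem i s == n i]) Lword s.
Proof.
rewrite [RHS]big_mkcond -(sum_tuple _ (fun s : word =>
  if [forall i, count_mem i s == n i] then @Lword R d s else 0)).
exact: big_mkcond.
Qed.

Lemma bop_Lsym n : bounded_operator (@Lsym R d n).
Proof. by rewrite LsymE; apply: (subsp_sum (@bop_subsp R d)) => s _; apply: bop_Lword. Qed.

Lemma sum_count (s : word) : (\sum_(i < d) count_mem i s)%N = size s.
Proof.
elim: s => [|j s IH] /=; first by rewrite big1.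
by rewrite big_split IH /= (bigD1 j) //= eqxx big1 // => i /negPf; rewrite eq_sym => ->.
Qed.

Lemma wpow_count (w : 'rV[C]_d) (s : word) :
  wpow w s = \prod_(i < d) w 0 i ^+ count_mem i s.
Proof.
rewrite /wpow; elim: s => [|j s IH]; first by rewrite big_nil big1.
rewrite big_cons IH /= [RHS](eq_bigr (fun i =>
  (if i == j then w 0 j else 1) * w 0 i ^+ count_mem i s)) => [|i _].
  by rewrite big_split /= -big_mkcond big_pred1_eq.
by rewrite exprD [j == i]eq_sym; case: eqP => [->|] /=; rewrite ?expr1 ?expr0.
Qed.

(** The coefficient of [Lword s] in a power of [Lrow w] only depends on the
    letter counts of [s]. *)
Lemma Lpow_opspan w m (G : set op) :
  (forall n, mweight n = m -> G (@Lsym R d n)) -> opspan G (Lpow w m).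
Proof.
move=> GL; have sG := opspan_subsp G.
pose p (s : word) : {ffun 'I_d -> 'I_m.+1} := [ffun i => inord (count_mem i s)].
rewrite LpowE (partition_big p predT) //=; apply: (subsp_sum sG) => q _.
pose n : {ffun 'I_d -> nat} := [ffun i => val (q i)].
have pq s : size s = m -> (p s == q) = [forall i, count_mem i s == n i].
  move=> sm; apply/eqP/forallP => [pe i|h].
    by rewrite /n ffunE -pe ffunE /= inordK // ltnS -sm count_size.
  apply/ffunP => i; apply/val_inj; rewrite /p ffunE /= inordK.
    by have /eqP := h i; rewrite /n ffunE.
  by rewrite ltnS -sm count_size.
have [nm|nm] := eqVneq (mweight n) m; last first.
  rewrite big1_seq; first exact: sG.1.
  move=> s /andP[/[swap]]; rewrite mem_words => /eqP sm.
  rewrite pq // => /forallP h; case/eqP: nm; rewrite -sm -sum_count.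
  by apply: eq_bigr => i _; rewrite (eqP (h i)).
pose c : C := (\prod_(i < d) w 0 i ^+ n i)^*.
suff -> : \sum_(s <- words d m | p s == q) (wpow w s)^* *: Lword s = c *: @Lsym R d n.
  by apply/(subspZ sG)/opspan_incl/GL.
rewrite LsymE nm scaler_sumr big_seq_cond [RHS]big_seq_cond.
apply: congr_big => // [s|s /andP[]].
  by case: (boolP (s \in _)) => //=; rewrite mem_words => /eqP /pq ->.
rewrite mem_words => /eqP sm; rewrite pq // => /forallP h; congr (_^* *: _).
by rewrite wpow_count; apply: eq_bigr => i _; rewrite (eqP (h i)).
Qed.

Lemma symop_subsp : subsp symop.
Proof. exact/opclosure_subsp/opspan_subsp. Qed.

Lemma symop_bop A : symop A -> bounded_operator A. Proof. exact: opclosure_bop. Qed.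

Lemma opspan_Lsym_symop : opspan (range (@Lsym R d)) `<=` symop.
Proof.
move=> A GA; apply: opclosure_incl => //.
apply: (opspan_min (@bop_subsp R d)) GA => _ [n _ <-]; exact: bop_Lsym.
Qed.

Lemma symop0_symop : symop0 `<=` symop.
Proof.
apply: (opspan_min symop_subsp) => _ [n _ ->].
by apply/opspan_Lsym_symop/opspan_incl; exists n.
Qed.

Lemma symop0_subsp : subsp symop0. Proof. exact: opspan_subsp. Qed.

Lemma symop_Lpow w m : symop (Lpow w m).
Proof.
by apply/opspan_Lsym_symop/Lpow_opspan => n _; exists n.
Qed.

Lemma symop1 : symop op1. Proof. exact: (symop_Lpow 0 0). Qed.

(** Partial sums of the geometric series approximate the resolvent. *)
Lemma resolvent_sub1_symop0 (w : cball R d) : opclosure symop0 (resolvent w - op1).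
Proof.
split; first by apply: (subspB (@bop_subsp R d)); [exact: bop_resolvent|exact: bop1].
move=> e e0.
have [n le] := geometric_small (1 - enorm (pt w))^-1 (enorm_ge0 _) (pt_lt1 w) e0.
exists (\sum_(m < n) Lpow (pt w) m.+1).
  apply: (subsp_sum symop0_subsp) => m _; apply: Lpow_opspan => k km.
  by exists k; rewrite ?km.
set S := \sum_(m < n) _; set A : op := Lpow (pt w) n.+1 \o resolvent w.
have kE : resolvent w = op1 + (S + A).
  by rewrite {1}(resolvent_partial w n.+1) big_ord_recl addrA.
have -> : resolvent w - op1 - S = A by rewrite kE [op1 + _]addrC addrK addrC addKr.
by apply: opnorm_le_trans le _; apply: resolvent_partial_opnorm.
Qed.

Lemma resolvent_symop (w : cball R d) : symop (resolvent w).
Proof.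
rewrite -[resolvent w](subrK op1); apply: (subspD symop_subsp _ symop1).
apply: opclosure_min (resolvent_sub1_symop0 w).
exact: symop0_symop.
Qed.

Definition resolvent_span : set op := opspan (range (@resolvent R d)).

Lemma resolvent_span_subsp : subsp resolvent_span. Proof. exact: opspan_subsp. Qed.

Lemma resolvent_span_symop : resolvent_span `<=` symop.
Proof. by apply: (opspan_min symop_subsp) => _ [w _ <-]; apply: resolvent_symop. Qed.

Lemma resolvent_span_closure_subsp : subsp (opclosure resolvent_span).
Proof. exact/opclosure_subsp/resolvent_span_subsp. Qed.

Lemma resolvent_span_lincomb A : resolvent_span A -> exists r, A = lincomb (@resolvent R d) r.
Proof.
move: A; suff : resolvent_span `<=` [set A | exists r, A = lincomb (@resolvent R d) r] by [].
apply: opspan_min => [|_ [w _ <-]]; last first.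
  by exists [:: (1, w)]; rewrite lincomb1 scale1r.
split; first by exists [::]; rewrite /lincomb big_nil.
move=> c _ _ [r ->] [t ->]; exists (cscale c r ++ t).
by rewrite lincomb_cat lincomb_scale.
Qed.

(** Once the coefficients below [k] are known to lie in the closed subspace, the
    [k]th one is the limit at [t = 0] of [F] minus these terms, divided by
    [t ^ k]. *)
Lemma coef_in_closure (P : set op) (F : R -> op) (A : nat -> op) : subsp P ->
  (forall k, bounded_operator (A k)) ->
  (forall t, 0 < t -> t < 1 -> opclosure P (F t)) ->
  (forall k, exists D : R, forall t, 0 < t -> t < 1 ->
     opnorm_le (F t - \sum_(i < k) (t ^+ i)%:C%C *: A i) (D * t ^+ k)) ->
  forall k, opclosure P (A k).
Proof.
move=> sP bA PF rem; have sc := opclosure_subsp sP; elim/ltn_ind => k IH.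
apply: opclosure_closed => // e e0; have [D hD] := rem k.+1.
pose t := Num.min (2^-1) (e / (`|D| + 1)).
have D1 : 0 < `|D| + 1 by rewrite ltr_wpDl.
have t0 : 0 < t by rewrite lt_min invr_gt0 ltr0n divr_gt0.
have t1 : t < 1 by rewrite gt_min invf_lt1 ?ltr1n ?ltr0n.
have te : t * D <= e.
  have : t <= e / (`|D| + 1) by rewrite ge_min lexx orbT.
  rewrite ler_pdivlMr // => h; apply: le_trans h.
  by rewrite ler_wpM2l ?ltW //; have := ler_norm D; lra.
pose c := ((t ^+ k)^-1)%:C%C : C.
exists (c *: (F t - \sum_(i < k) (t ^+ i)%:C%C *: A i)).
  apply: (subspZ sc); apply: (subspB sc); first exact: PF.
  by apply: (subsp_sum sc) => i _; apply: (subspZ sc); apply: IH.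
have c1 : c * (t ^+ k)%:C%C = 1.
  by rewrite -rmorphM mulVf ?rmorph1 // expf_neq0 // gt_eqF.
have -> : A k - c *: (F t - \sum_(i < k) (t ^+ i)%:C%C *: A i) =
   - (c *: (F t - \sum_(i < k.+1) (t ^+ i)%:C%C *: A i)).
  rewrite big_ord_recr /= opprD addrA [in RHS]scalerBr scalerA c1 scale1r.
  by rewrite opprB.
apply: opnormN; apply: opnorm_le_trans (opnormZ c (hD t t0 t1)).
rewrite /c normc_real normfV ger0_norm ?exprn_ge0 ?(ltW t0) //.
rewrite exprSr mulrCA [_ * (_ * t)]mulrA mulVf ?mul1r; last by rewrite expf_neq0 // gt_eqF.
by rewrite mulrC.
Qed.

(** The powers of [Lrow w] are the coefficients of the resolvent at [t w]. *)
Lemma Lpow_resolvent_span (w : 'rV[C]_d) m : enorm w < 1 -> opclosure resolvent_span (Lpow w m).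
Proof.
move=> w1.
have tw1 (t : R) : 0 < t -> t < 1 -> enorm (t%:C%C *: w) < 1.
  move=> t0 t1; rewrite enormZ ?ltW //; apply: le_lt_trans t1.
  by rewrite ler_piMr ?ltW.
pose F t := match pselect (enorm (t%:C%C *: w) < 1) with
  | left h => resolvent (exist (fun z : 'rV[C]_d => enorm z < 1) _ h) | right _ => 0 end.
apply: (coef_in_closure (F := F) (A := Lpow w)) m => [|k|t t0 t1|k].
- exact: resolvent_span_subsp.
- exact: bop_Lpow.
- rewrite /F; case: pselect => [h|]; last by have := tw1 t t0 t1.
  apply: opclosure_incl; first exact: bop_resolvent.
  by apply: opspan_incl; exists (exist (fun z : 'rV[C]_d => enorm z < 1) _ h).
exists (1 - enorm w)^-1 => t t0 t1.
rewrite /F; case: pselect => [h|]; last by have := tw1 t t0 t1.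
set z : cball R d := exist _ _ _.
rewrite (resolvent_partial z k) addrAC.
rewrite (_ : \sum_(m < k) _ = \sum_(i < k) (t ^+ i)%:C%C *: Lpow w i).
  rewrite subrr add0r; apply: opnorm_le_trans (@resolvent_partial_opnorm _ _ z k).
  have zE : enorm (pt z) = t * enorm w by rewrite -enormZ ?ltW.
  rewrite zE exprMn mulrC ler_pM //.
  - by rewrite invr_ge0 -zE subr_ge0 ltW // pt_lt1.
  - by rewrite mulr_ge0 // exprn_ge0 ?enorm_ge0 ?ltW.
  - rewrite lef_pV2 ?posrE ?subr_gt0 // -?zE ?pt_lt1 // zE lerD2l lerN2.
    by rewrite ler_piMl ?enorm_ge0 ?ltW.
  by rewrite ler_piMr ?exprn_ge0 ?(ltW t0) // exprn_ile1 ?enorm_ge0 ?ltW.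
by apply: eq_bigr => i _; rewrite -LpowZ.
Qed.

Lemma digits_inj (N k : nat) (a b : 'I_k -> nat) :
  (forall i, a i < N)%N -> (forall i, b i < N)%N ->
  (\sum_(i < k) a i * N ^ i = \sum_(i < k) b i * N ^ i)%N -> a =1 b.
Proof.
elim: k a b => [|k IH] a b aN bN; first by move=> _ [].
have N0 : (0 < N)%N by apply: leq_trans (aN ord0).
have split0 (c : 'I_k.+1 -> nat) : (\sum_(i < k.+1) c i * N ^ i =
    (\sum_(i < k) c (lift ord0 i) * N ^ i) * N + c ord0)%N.
  rewrite big_ord_recl expn0 muln1 addnC; congr (_ + _)%N.
  by rewrite big_distrl; apply: eq_bigr => i _; rewrite expnSr mulnA.
rewrite !split0 => E.
have E0 : a ord0 = b ord0.
  by have := congr1 (modn^~ N) E; rewrite !modnMDl !modn_small.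
have ES : (\sum_(i < k) a (lift ord0 i) * N ^ i = \sum_(i < k) b (lift ord0 i) * N ^ i)%N.
  by have := congr1 (divn^~ N) E; rewrite !divnMDl // !divn_small // !addn0.
move=> i; case: (unliftP ord0 i) => [j ->|->] //.
exact: (IH (fun i => a (lift ord0 i)) (fun i => b (lift ord0 i))).
Qed.

(** Kronecker substitution: with [c t^(N^j)] as the [j]th coordinate, words of
    equal length below [N] and different letter counts come with different powers
    of [t], so that [Lsym n] is a coefficient of a power of [Lrow]. *)
Lemma Lsym_resolvent_span n : opclosure resolvent_span (@Lsym R d n).
Proof.
pose m := mweight n; pose N := m.+1.
pose code (s : word) := (\sum_(i < d) count_mem i s * N ^ i)%N.
pose A k : op := \sum_(s <- words d m | code s == k) Lword s.
have -> : @Lsym R d n = A (\sum_(i < d) n i * N ^ i)%N.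
  rewrite LsymE /A -/m big_seq_cond [RHS]big_seq_cond; apply: eq_bigl => s.
  case: (boolP (s \in _)) => //=; rewrite mem_words => /eqP sm.
  apply/forallP/eqP => [h|h i]; first by apply: eq_bigr => i _; rewrite (eqP (h i)).
  apply/eqP; apply: (@digits_inj N d (fun i => count_mem i s) n) => // j.
    by rewrite ltnS -sm count_size.
  by rewrite ltnS /m /mweight (bigD1 j) //= leq_addr.
(* small enough for the points to stay in the ball: [d * c ^ 2 < 1] *)
pose c : R := (d.+1)%:R^-1.
have c0 : 0 < c by rewrite invr_gt0 ltr0n.
pose w (t : R) : 'rV[C]_d := \row_j (c * t ^+ (N ^ j))%:C%C.
pose F t := ((c ^+ m)^-1)%:C%C *: Lpow (w t) m.
have cm0 : c ^+ m != 0 by rewrite expf_neq0 // gt_eqF.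
have FE t : F t = \sum_(s <- words d m) (t ^+ code s)%:C%C *: Lword s.
  rewrite /F LpowE scaler_sumr; apply: eq_big_seq => s; rewrite mem_words => /eqP sm.
  rewrite scalerA; congr (_ *: _); rewrite wpow_count.
  rewrite (_ : \prod_(i < d) _ = (c ^+ m * t ^+ code s)%:C%C).
    by rewrite conjC_real -rmorphM mulKf.
  rewrite -sm -(sum_count s) /code !expr_sum -big_split rmorph_prod.
  by apply: eq_bigr => i _; rewrite mxE -rmorphXn exprMn -exprM mulnC.
apply: (coef_in_closure (F := F) (A := A)) => [|k|t t0 t1|k].
- exact: resolvent_span_subsp.
- by apply: (subsp_sum (@bop_subsp R d)) => s _; apply: bop_Lword.
- apply: (subspZ resolvent_span_closure_subsp); apply: Lpow_resolvent_span.
  rewrite -ltr_sqr ?nnegrE ?enorm_ge0 // expr1n enorm_sqr.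
  apply: (@le_lt_trans _ _ (\sum_(j < d) c ^+ 2)).
    apply: ler_sum => j _; rewrite mxE normc_real ler_sqr ?nnegrE ?(ltW c0) //.
    rewrite ger0_norm ?mulr_ge0 ?exprn_ge0 ?(ltW c0) ?(ltW t0) //.
    by rewrite ler_piMr ?(ltW c0) // exprn_ile1 ?ltW.
  rewrite sumr_const card_ord -mulr_natl /c exprVn ltr_pdivrMr ?mul1r ?exprn_gt0 //.
  by rewrite -natrX ltr_nat expnS expn1; nia.
exists (\sum_(s <- words d m) 1) => t t0 t1.
have -> : \sum_(i < k) (t ^+ i)%:C%C *: A i =
    \sum_(s <- words d m | (code s < k)%N) (t ^+ code s)%:C%C *: Lword s.
  under eq_bigr => i _ do rewrite /A scaler_sumr big_mkcond.
  rewrite exchange_big [RHS]big_mkcond; apply: eq_bigr => s _ /=.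
  rewrite -big_mkcond /=; case: ltnP => sk.
    by rewrite (big_pred1 (Ordinal sk)).
  by rewrite big1 // => i /eqP si; move: sk; rewrite si leqNgt ltn_ord.
rewrite FE (bigID (fun s => code s < k)%N) /= addrAC subrr add0r.
rewrite mulr_suml [X in opnorm_le _ X](bigID (fun s => code s < k)%N) /=.
apply: (@opnorm_le_trans _ _ _ (\sum_(s <- words d m | ~~ (code s < k)%N) 1 * t ^+ k)).
  by rewrite lerDr sumr_ge0 // => s _; rewrite mulr_ge0 ?exprn_ge0 ?(ltW t0).
apply: opnorm_sum => s; rewrite -leqNgt => ks.
apply: opnorm_le_trans (opnormZ _ (@opnorm_Lword R d s)).
rewrite mulr1 mul1r normc_real ger0_norm ?exprn_ge0 ?(ltW t0) //.
by rewrite ler_wiXn2l // ltW.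
Qed.

Lemma symopE : symop = opclosure resolvent_span.
Proof.
apply/seteqP; split; apply: opclosure_min; last exact: resolvent_span_symop.
by apply: (opspan_min resolvent_span_closure_subsp) => _ [n _ <-]; apply: Lsym_resolvent_span.
Qed.

(** A nonempty word moves the vacuum vector to an orthogonal one. *)
Lemma symop0_vacuum (p : op) : symop0 p -> p (xi R [::]) [::] = 0.
Proof.
suff : symop0 `<=` [set p : op | p (xi R [::]) [::] = 0] by apply.
apply: opspan_min => [|_ [n n1 ->]].
  split=> // c A B A0 B0.
  have {}A0 : A (xi R [::]) [::] = 0 by [].
  have {}B0 : B (xi R [::]) [::] = 0 by [].
  suff : c * A (xi R [::]) [::] + B (xi R [::]) [::] = 0 by [].
  by rewrite A0 B0 mulr0 addr0.
suff : (Lsym n : op) (xi R [::]) [::] = 0 by [].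
rewrite LsymE op_sumE l2_sumE big1_seq // => a /andP[_].
rewrite mem_words Lword_xi cats0 => /eqP an.
by rewrite xiE; case: a an => // an; move: n1; rewrite -an.
Qed.

(** * The operator system *)

Local Notation SS := [set A | exists p q, [/\ symop p, symop q & A = p + adj q]].

Lemma symop_adj_subsp : subsp SS.
Proof.
split; first by exists 0, 0; rewrite adj0 addr0; split=> //; apply: symop_subsp.1.
move=> c _ _ [p [q [Sp Sq ->]]] [p' [q' [Sp' Sq' ->]]].
exists (c *: p + p'), (c^* *: q + q'); split.
- exact: symop_subsp.2.
- exact: symop_subsp.2.
by rewrite adj_lin ?conjCK; [rewrite scalerDr addrACA|exact: symop_bop..].
Qed.

Lemma SSadj_subsp : subsp SSadj. Proof. exact/opclosure_subsp/symop_adj_subsp. Qed.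

Lemma SSadj_bop A : SSadj A -> bounded_operator A. Proof. exact: opclosure_bop. Qed.

Lemma SSadj_symop A : symop A -> SSadj A.
Proof.
move=> SA; apply: opclosure_incl; first exact: symop_bop.
exists A, 0; split; [exact: SA|exact: symop_subsp.1|by rewrite adj0 addr0].
Qed.

Lemma SSadj_adj_symop A : symop A -> SSadj (adj A).
Proof.
move=> SA; apply: opclosure_incl; first exact/bop_adj/symop_bop.
exists 0, A; split; [exact: symop_subsp.1|exact: SA|by rewrite add0r].
Qed.

Lemma SSadj1 : SSadj op1. Proof. exact/SSadj_symop/symop1. Qed.

Lemma SSadj_adj A : SSadj A -> SSadj (adj A).
Proof.
move=> [bA clA]; split; first exact: bop_adj.
move=> e e0; have [_ [p [q [Sp Sq ->]]] le] := clA _ e0.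
have bp := symop_bop Sp; have bq := symop_bop Sq.
have bpq : bounded_operator (p + adj q).
  by apply: (subspD (@bop_subsp R d)) => //; apply: bop_adj.
exists (q + adj p).
  by exists q, p.
rewrite (_ : q + adj p = adj (p + adj q)).
  rewrite -adjB //; apply: adj_opnorm => //; last exact: ltW.
  exact: (subspB (@bop_subsp R d)).
by rewrite adjD ?adjK 1?addrC //; apply: bop_adj.
Qed.

Lemma adj_comp_resolvent_span p q : resolvent_span p -> resolvent_span q -> SSadj (adj q \o p).
Proof.
have bk r : resolvent_span r -> bounded_operator r by move=> /resolvent_span_symop/symop_bop.
suff H : resolvent_span `<=` [set r | bounded_operator r /\
    forall t, resolvent_span t -> SSadj (adj t \o r)] by move=> /H[_]; apply.
clear p q; apply: opspan_min.
  split=> [|c A B [bA hA] [bB hB]].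
    split=> [|q kq]; first exact: (@bop_subsp R d).1.
    rewrite (_ : _ \o _ = 0); first exact: SSadj_subsp.1.
    by apply/funext => f; rewrite /= (bop_0 (bop_adj (bk _ kq))).
  split=> [|q kq]; first exact: (@bop_subsp R d).2.
  rewrite comp_linr; last exact/bop_adj/bk.
  by apply: SSadj_subsp.2; [apply: hA|apply: hB].
move=> _ [w _ <-]; split; first exact: bop_resolvent.
move=> q [n [c [B [kB ->]]]].
have bB i : bounded_operator (B i) by have [z _ <-] := kB i; apply: bop_resolvent.
rewrite adj_sum => [|i _]; last exact: (subspZ (@bop_subsp R d)).
rewrite (_ : _ \o _ = \sum_i (c i)^* *: (adj (B i) \o resolvent w)); last first.
  apply/funext => f; rewrite /= !op_sumE; apply: eq_bigr => i _.
  by rewrite adjZ.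
apply: (subsp_sum SSadj_subsp) => i _; apply: (subspZ SSadj_subsp).
have [z _ <-] := kB i; rewrite adj_resolvent_comp; apply: (subspZ SSadj_subsp).
apply: (subspB SSadj_subsp); last exact: SSadj1.
apply: (subspD SSadj_subsp); last exact/SSadj_symop/resolvent_symop.
exact/SSadj_adj_symop/resolvent_symop.
Qed.

(** For resolvents this is the content of [adj_resolvent_comp]; it extends by
    density, since the resolvents span [symop]. *)
Lemma SSadj_adj_comp p q : symop p -> symop q -> SSadj (adj q \o p).
Proof.
move=> Sp Sq; have bp := symop_bop Sp; have bq := symop_bop Sq.
move: Sp Sq; rewrite symopE => -[_ clp] [_ clq].
have [M M0 pM] := bop_norm bp; have [N N0 qN] := bop_norm bq.
apply: opclosure_closed; first by apply: bop_comp => //; apply: bop_adj.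
move=> e e0; pose K := N + M + 1.
have K0 : 0 < K by rewrite ltr_wpDl ?addr_ge0.
pose ep := Num.min 1 (e / K).
have ep0 : 0 < ep by rewrite lt_min ltr01 divr_gt0.
have [p' kp' pp'] := clp _ ep0; have [q' kq' qq'] := clq _ ep0.
have bk r : resolvent_span r -> bounded_operator r by move=> /resolvent_span_symop/symop_bop.
exists (adj q' \o p'); first exact: adj_comp_resolvent_span.
have -> : (adj q \o p) - (adj q' \o p') = (adj q \o (p - p')) + (adj (q - q') \o p').
  apply/funext => f; rewrite adjB //; last exact: bk.
  rewrite !opDE !opNE /= !opDE !opNE (bopB (bop_adj bq)).
  by rewrite -[RHS]addrA addKr.
have p'M : opnorm_le p' (ep + M).
  rewrite -[p'](subrK p); apply: opnormD => //.
  by rewrite -opprB; apply: opnormN.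
have bqq : bounded_operator (q - q') by apply: (subspB (@bop_subsp R d)) => //; apply: bk.
apply: (@opnorm_le_trans _ _ _ (N * ep + ep * (ep + M))); last first.
  apply: opnormD; apply: opnorm_comp => //; first exact: adj_opnorm.
    exact: ltW.
  by apply: adj_opnorm => //; apply: ltW.
apply: (@le_trans _ _ (ep * K)).
  have : ep <= 1 by rewrite ge_min lexx.
  move=> ep1; rewrite [N * _]mulrC -mulrDr; apply: ler_wpM2l; first exact: ltW.
  by rewrite /K -addrA lerD2l [ep + M]addrC lerD2l.
by rewrite -ler_pdivlMr // ge_min lexx orbT.
Qed.

End Sym.

(** * States on the operator system *)

Section State.
Variables (R : realType) (d : nat).
Local Notation C := R[i].
Local Notation word := (seq 'I_d).
Local Notation l2 := (l2 R d).
Local Notation op := (l2 -> l2).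
Local Notation op1 := (@op1 R d).
Local Notation symop := (@symop R d).
Local Notation symop0 := (@symop0 R d).
Local Notation SSadj := (@SSadj R d).
Local Notation bop := (@bounded_operator R d).
Implicit Types (A B : op) (f g : l2) (p q : op).

Section Fixed.
Variables (mu : op -> C) (st : is_state mu).

Lemma stateD A B : SSadj A -> SSadj B -> mu (A + B) = mu A + mu B.
Proof. by move=> hA hB; have := st.1 1 A B hA hB; rewrite scale1r mul1r. Qed.

Lemma state0 : mu 0 = 0.
Proof.
have S0 := (@SSadj_subsp R d).1.
by apply: (addrI (mu 0)); rewrite -stateD // !addr0.
Qed.

Lemma stateZ c A : SSadj A -> mu (c *: A) = c * mu A.
Proof.
by move=> hA; have := st.1 c A 0 hA (@SSadj_subsp R d).1; rewrite state0 !addr0.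
Qed.

Lemma stateN A : SSadj A -> mu (- A) = - mu A.
Proof. by move=> hA; rewrite -scaleN1r stateZ // mulN1r. Qed.

Lemma stateB A B : SSadj A -> SSadj B -> mu (A - B) = mu A - mu B.
Proof.
by move=> hA hB; rewrite (stateD hA (subspN (@SSadj_subsp R d) hB)) (stateN hB).
Qed.

Lemma state1_ge0 : 0 <= mu op1.
Proof. by apply: st.2; [exact: SSadj1|move=> f; apply: l2dot_ge0]. Qed.

Lemma conjC_fixed (x : C) : x^* = x -> x = (complex.Re x)%:C%C.
Proof.
by case: x => a b [] h; rewrite (_ : b = 0) //; lra.
Qed.

(** A selfadjoint operator is the difference of two positive operators, one of
    them a multiple of the identity. *)
Lemma state_selfadjoint A : SSadj A -> is_adjoint A A -> (mu A)^* = mu A.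
Proof.
move=> hA sA; have bA := SSadj_bop hA; have [M M0 AM] := bop_norm bA.
have S1 := @SSadj1 R d.
have SM : SSadj (M%:C%C *: op1) by apply: (subspZ (@SSadj_subsp R d)).
have pos : positive_operator (A + M%:C%C *: op1).
  move=> f; rewrite opDE opZE l2dotDl l2dotZl -[op1 f]/f l2dotE.
  rewrite [l2dot (A f) f]conjC_fixed -?l2dotC ?sA //.
  rewrite -rmorphM -rmorphD ler0c.
  have := le_trans (Re_le_normc _) (l2_CauchySchwarz (A f) f).
  have := ler_wpM2r (l2norm_ge0 f) (AM f); rewrite ler_norml -mulrA -expr2 sA.
  by move=> h1 /andP[h2 _]; lra.
have SA := subspD (@SSadj_subsp R d) hA SM.
have h1 : 0 <= mu (A + M%:C%C *: op1) by exact: st.2 SA pos.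
have -> : mu A = mu (A + M%:C%C *: op1) - M%:C%C * mu op1.
  by rewrite (stateD hA SM) (stateZ _ S1) addrK.
rewrite conjCB conjCM conjC_real.
by have [-> _] := ge0_complexE h1; have [-> _] := ge0_complexE state1_ge0; rewrite !conjC_real.
Qed.

Lemma state_adj A : SSadj A -> mu (adj A) = (mu A)^*.
Proof.
move=> hA; have bA := SSadj_bop hA; have hA' := SSadj_adj hA.
have aA := adjP bA; have aA' := is_adjointC aA.
have sH : is_adjoint (A + adj A) (A + adj A).
  by move=> f g; rewrite !opDE l2dotDl l2dotDr aA aA' addrC.
have sK : is_adjoint ('i *: (A - adj A)) ('i *: (A - adj A)).
  move=> f g; rewrite !opZE !opDE !opNE l2dotZl l2dotZr l2dotBl l2dotBr aA aA' conjCi.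
  by rewrite mulNr -mulrN opprB.
have SH : SSadj (A + adj A) by apply: (subspD (@SSadj_subsp R d)).
have SK0 : SSadj (A - adj A) by apply: (subspB (@SSadj_subsp R d)).
have SK : SSadj ('i *: (A - adj A)) by apply: (subspZ (@SSadj_subsp R d)).
have := state_selfadjoint SH sH; have := state_selfadjoint SK sK.
rewrite stateZ // stateB // stateD // conjCM conjCi conjCB conjCD mulNr -mulrN.
move=> /(mulfI (neq0Ci _)) e1 e2.
have : 2 * mu (adj A) = 2 * (mu A)^*.
  rewrite -[LHS](_ : mu A + mu (adj A) - (mu A - mu (adj A)) = _); last by ring.
  by rewrite -e2 -e1; ring.
by move/mulfI; apply; rewrite pnatr_eq0.
Qed.

Lemma Sdot_linear c p q r : symop p -> symop q -> symop r ->
  Sdot mu (c *: p + q) r = c * Sdot mu p r + Sdot mu q r.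
Proof.
move=> Sp Sq Sr; rewrite /Sdot comp_linr; last exact/bop_adj/symop_bop.
exact: (st.1 _ _ _ (SSadj_adj_comp Sp Sr) (SSadj_adj_comp Sq Sr)).
Qed.

Lemma SdotC p q : symop p -> symop q -> Sdot mu q p = (Sdot mu p q)^*.
Proof.
move=> Sp Sq; have bp := symop_bop Sp; have bq := symop_bop Sq.
rewrite /Sdot -state_adj; last exact: SSadj_adj_comp.
by rewrite adj_comp ?adjK //; apply: bop_adj.
Qed.

Lemma Sdot_ge0 p : symop p -> 0 <= Sdot mu p p.
Proof.
move=> Sp; apply: (st.2 _ (SSadj_adj_comp Sp Sp)) => f.
rewrite /= (is_adjointC (adjP (symop_bop Sp))); exact: l2dot_ge0.
Qed.

Definition Ssip : sip op := @Sip R op symop (Sdot mu)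
  (@symop_subsp R d).1 (@symop_subsp R d).2 Sdot_linear SdotC Sdot_ge0.

Lemma SnormE p : Snorm mu p = snorm Ssip p. Proof. by []. Qed.

Lemma Snorm_ge0 p : 0 <= Snorm mu p. Proof. exact: sqrtr_ge0. Qed.

(** Positivity of [M ^ 2 - p' p], with [p'] the adjoint of [p]. *)
Lemma Snorm_le p M : symop p -> 0 <= M -> opnorm_le p M ->
  Snorm mu p <= M * Num.sqrt (complex.Re (mu op1)).
Proof.
move=> Sp M0 pM; have S1 := @SSadj1 R d; have Spp := SSadj_adj_comp Sp Sp.
have SM : SSadj ((M ^+ 2)%:C%C *: op1) by apply: (subspZ (@SSadj_subsp R d)).
have pos : positive_operator ((M ^+ 2)%:C%C *: op1 - (adj p \o p)).
  move=> f; rewrite opDE opZE opNE l2dotBl l2dotZl -[op1 f]/f l2dotE /=.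
  rewrite (is_adjointC (adjP (symop_bop Sp))) l2dotE -rmorphM -rmorphB ler0c.
  by rewrite subr_ge0 -exprMn ler_sqr ?nnegrE ?mulr_ge0 ?l2norm_ge0.
have := st.2 _ (subspB (@SSadj_subsp R d) SM Spp) pos.
rewrite (stateB SM Spp) (stateZ _ S1) -[mu (adj p \o p)]/(Sdot mu p p) subr_ge0.
have [mE m0] := ge0_complexE state1_ge0; rewrite {1}mE -[Sdot mu p p]/(sdot Ssip p p).
rewrite (snormE (s := Ssip) Sp) -rmorphM lecR -SnormE => le.
rewrite -ler_sqr ?nnegrE ?mulr_ge0 ?sqrtr_ge0 ?Snorm_ge0 // exprMn.
by rewrite [X in _ <= _ * X]sqr_sqrtr.
Qed.

Lemma zLadj_resolvent (z : cball R d) : zLadj (pt z) \o adj (resolvent z) = adj (resolvent z) - op1.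
Proof.
apply/funext => f; apply: l2dot_inj => g.
rewrite opDE opNE /= zLadjE l2dotBl.
rewrite (is_adjointC (adjP (bop_Lrow _))) !(is_adjointC (adjP (bop_resolvent z))).
have -> : resolvent z (Lrow (pt z) g) = resolvent z g - g.
  by rewrite -{3}(resolvent_Lrow z g) (bopB (bop_resolvent z)) opprB addrC subrK.
by rewrite l2dotBr.
Qed.

Lemma herglotz_op (z : cball R d) :
  (op1 + zLadj (pt z)) \o opinv (op1 - zLadj (pt z)) = 2 *: adj (resolvent z) - op1.
Proof.
rewrite opinv_zLadj; apply/funext => f.
have E : zLadj (pt z) (adj (resolvent z) f) = adj (resolvent z) f - f.
  exact: (congr1 (fun A : op => A f) (zLadj_resolvent z)).
rewrite -[LHS]/(adj (resolvent z) f + zLadj (pt z) (adj (resolvent z) f)) E.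
by rewrite opDE opNE opZE addrA scaler_nat mulr2n.
Qed.

Lemma resolvent0 : resolvent (cball0 R d) = op1.
Proof.
apply/funext => f; rewrite resolventE -[RHS]addr0; congr (_ + _).
by apply: l2norm_eq0; rewrite l2norm_Lrow pt0 -(scale0r 0) enormZ // !mul0r.
Qed.

Lemma state_herglotz (z : cball R d) :
  mu ((op1 + zLadj (pt z)) \o opinv (op1 - zLadj (pt z))) =
  2 * mu (adj (resolvent z)) - mu op1.
Proof.
have Sa : SSadj (adj (resolvent z)) by apply/SSadj_adj_symop/resolvent_symop.
have S1 := @SSadj1 R d.
have S2 : SSadj (2 *: adj (resolvent z)) by apply: (subspZ (@SSadj_subsp R d)).
by rewrite herglotz_op (stateB S2 S1) (stateZ _ Sa).
Qed.

(** The reproducing kernel of the space of quotients [f / (1 - b)] with [f] in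
    H(b), written in terms of the Cayley transform of [b]. *)
Definition clark_kernel (b : cball R d -> C) (z w : cball R d) : C :=
  (cayley b z + (cayley b w)^*) / 2 / (1 - cdot (pt z) (pt w)).

Lemma state_resolvent b (z : cball R d) : represents mu b ->
  mu (adj (resolvent z)) = (cayley b z + (cayley b (cball0 R d))^*) / 2.
Proof.
move=> rep; have hz := rep z; have h0 := rep (cball0 R d).
rewrite state_herglotz in hz; rewrite state_herglotz resolvent0 adj1 in h0.
have m1 : mu op1 = 'Re (cayley b (cball0 R d)).
  move: h0; rewrite {1}[cayley b (cball0 R d)]Crect => /addIr ->; ring.
have two : (2 : C) != 0 by rewrite pnatr_eq0.
have G0J : (cayley b (cball0 R d))^* =
    'Re (cayley b (cball0 R d)) - 'i * 'Im (cayley b (cball0 R d)).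
  by rewrite {1}[cayley b (cball0 R d)]Crect conjC_rect ?Creal_Re ?Creal_Im.
apply: (mulIf two); rewrite divfK // hz G0J m1; ring.
Qed.

(** The class of the resolvent at [w] plays in the Hilbert space of the state the
    role of the kernel at [w]. *)
Lemma Sdot_resolvent b (z w : cball R d) : represents mu b ->
  Sdot mu (resolvent w) (resolvent z) = clark_kernel b z w.
Proof.
move=> rep; rewrite /Sdot adj_resolvent_comp.
have Sk := SSadj_symop (resolvent_symop w); have Sa := SSadj_adj_symop (resolvent_symop z).
have S1 := @SSadj1 R d; have Sak := subspD (@SSadj_subsp R d) Sa Sk.
have Saw := SSadj_adj_symop (resolvent_symop w).
rewrite stateZ; last exact: (subspB (@SSadj_subsp R d)).
rewrite (stateB Sak S1) (stateD Sa Sk).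
have -> : mu (resolvent w) = (mu (adj (resolvent w)))^*.
  by rewrite -state_adj // adjK //; apply: bop_resolvent.
have -> : mu op1 = mu (adj (resolvent (cball0 R d))) by rewrite resolvent0 adj1.
rewrite !(state_resolvent _ rep) /clark_kernel mulrC; congr (_ / _).
rewrite conjCM conjCV conjCD conjCK (_ : 2^* = 2 :> C); last exact: rmorph_nat.
by field.
Qed.

Lemma opspan_Lsym_split A : opspan (range (@Lsym R d)) A ->
  exists c p, symop0 p /\ A = c *: op1 + p.
Proof.
have s0 := @symop0_subsp R d.
move=> GA; suff : opspan (range (@Lsym R d)) `<=`
  [set A | exists c p, symop0 p /\ A = c *: op1 + p] by apply.
apply: opspan_min => [|_ [n _ <-]].
  split; first by exists 0, 0; rewrite scale0r addr0; split=> //; apply: s0.1.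
  move=> c _ _ [c1 [p1 [sp1 ->]]] [c2 [p2 [sp2 ->]]].
  exists (c * c1 + c2), (c *: p1 + p2); split; first exact: s0.2.
  by rewrite scalerDr scalerA scalerDl addrACA.
have [n0|n0] := posnP (mweight n); last first.
  exists 0, (Lsym n); split; last by rewrite scale0r add0r.
  by apply: opspan_incl; exists n.
exists 1, 0; split; first exact: s0.1.
rewrite scale1r addr0 LsymE n0 big_mkcond sum_words0 ifT //.
apply/forallP => i /=; rewrite eq_sym -leqn0 -n0 /mweight (bigD1 i) //=.
exact: leq_addr.
Qed.

(** Modulo [symop0] the space [symop] is spanned by the unit, so quasi-extremity
    only concerns the class of the unit. *)
Lemma quasi_extremeE : quasi_extreme_state mu <->
  forall e : R, 0 < e -> exists2 p, symop0 p & Snorm mu (op1 - p) < e.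
Proof.
have s0 := @symop0_subsp R d; have sS := @symop_subsp R d.
split=> [qe e e0|approx].
  have P1 : P2 mu (P2class op1).
    split=> [n|e' e'0]; first exact: symop1.
    by exists 0%N => m n _ _; rewrite subrr SnormE snorm0.
  move: P1; rewrite -qe => -[_ /(_ e e0)[p sp lt]]; exists p => //.
  have E : P2dist mu (P2class op1) (P2class p) = Snorm mu (op1 - p).
    apply: cvg_lim; first exact: Rhausdorff.
    rewrite (_ : (fun n => _) = fun=> Snorm mu (op1 - p)); first exact: cvg_cst.
    by apply/funext.
  by rewrite -E.
apply/seteqP; split=> [u []//|u [Su cu]]; split=> // e e0.
have e4 : 0 < e / 4 by rewrite divr_gt0.
have [N hN] := cu _ e4.
pose m1 := Num.sqrt (complex.Re (mu op1)).
have m10 : 0 < m1 + 1 by rewrite ltr_wpDl ?sqrtr_ge0.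
have [_ /(_ _ (divr_gt0 e4 m10))[q Gq uq]] := Su N.
have [c [q0 [sq0 qE]]] := opspan_Lsym_split Gq.
have c0 : 0 < normc c + 1 by rewrite ltr_wpDl ?normc_ge0.
have [p1 sp1 lt1] := approx _ (divr_gt0 e4 c0).
exists (c *: p1 + q0); first exact: s0.2.
have Sp : symop (c *: p1 + q0) by apply/symop0_symop/s0.2.
have Sq : symop q by apply: opspan_Lsym_symop.
have le n : (N <= n)%N -> Snorm mu (u n - (c *: p1 + q0)) <= 3 / 4 * e.
  move=> Nn; have h1 := hN n N Nn (leqnn _).
  have h2 : Snorm mu (u N - q) <= e / 4.
    apply: le_trans (Snorm_le (subspB sS (Su N) Sq) _ uq) _.
      by rewrite divr_ge0 ?ltW.
    rewrite -/m1 mulrAC ler_pdivrMr // ler_wpM2l ?(ltW e4) //.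
    by rewrite lerDl.
  have S1p : symop (op1 - p1).
    by apply: (subspB sS); [exact: symop1|apply: symop0_symop].
  have h3 : Snorm mu (q - (c *: p1 + q0)) <= e / 4.
    have -> : q - (c *: p1 + q0) = c *: (op1 - p1).
      by rewrite qE opprD addrACA subrr addr0 scalerBr.
    rewrite SnormE (snormZ (s := Ssip) _ S1p).
    apply: le_trans (_ : normc c * (e / 4 / (normc c + 1)) <= _).
      by rewrite ler_wpM2l ?normc_ge0 // ltW.
    rewrite mulrA ler_pdivrMr // mulrC ler_wpM2l ?(ltW e4) //.
    by rewrite lerDl.
  have t1 := @snorm_dist _ _ Ssip (u n) (u N) _ (Su n) (Su N) Sp.
  have t2 := @snorm_dist _ _ Ssip (u N) q _ (Su N) Sq Sp.
  move: t1 t2; rewrite -!SnormE; lra.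
apply: (@le_lt_trans _ _ (3 / 4 * e)); last by lra.
apply: limr_le; last by exists N.
apply/cauchy_cvgP/cauchy_exP => ep ep0; have [N' hN'] := cu _ ep0.
exists (Snorm mu (u N' - (c *: p1 + q0))); exists N' => // n /= N'n.
rewrite -ball_normE /=; apply: le_lt_trans (hN' n N' N'n (leqnn _)).
have t1 := @snorm_dist _ _ Ssip (u n) (u N') _ (Su n) (Su N') Sp.
have t2 := @snorm_dist _ _ Ssip (u N') (u n) _ (Su N') (Su n) Sp.
move: t1 t2; rewrite (snormC (s := Ssip) (Su N') (Su n)) -!SnormE ler_norml.
move=> t1 t2; apply/andP; split; lra.
Qed.

End Fixed.

End State.

(** * States from column-isometric families *)

Section WordState.
Variables (R : realType) (d : nat).
Local Notation C := R[i].
Local Notation word := (seq 'I_d).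
Local Notation l2 := (l2 R d).
Local Notation op := (l2 -> l2).
Local Notation op1 := (@op1 R d).
Local Notation symop := (@symop R d).
Local Notation SSadj := (@SSadj R d).
Local Notation bop := (@bounded_operator R d).
Implicit Types (A B : op).

Variables (V : lmodType C) (s : sip V) (x : word -> V).
Hypothesis Dx : forall a, sdom s (x a).
Hypothesis x_isometric : forall a b,
  \sum_(j < d) sdot s (x (rcons a j)) (x (rcons b j)) = sdot s (x a) (x b).
Local Notation G a b := (sdot s (x a) (x b)).

(** The isometry property iterated along the last [k] letters. *)
Lemma gram_level a b k : \sum_(u <- words d k) G (a ++ u) (b ++ u) = G a b.
Proof.
elim: k => [|k IH]; first by rewrite sum_words0 !cats0.
rewrite sum_words_rcons -[RHS]IH; apply: eq_bigr => u _.
by rewrite -x_isometric; apply: eq_bigr => j _; rewrite !rcons_cat.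
Qed.

(** The functional to be constructed sends [Lword a] to [G [::] a].  Its Fejer
    means make sense for every operator and are positive: they pair a compression
    of the operator entrywise with a Gram matrix. *)
Definition fejer (n : nat) A : C :=
  n.+1%:R^-1 * \sum_(u <- wordsB d n.+1) \sum_(v <- wordsB d n.+1)
    A (xi R u) v * G u v.

Lemma fejer_lin n c A B : fejer n (c *: A + B) = c * fejer n A + fejer n B.
Proof.
rewrite /fejer mulrCA -mulrDr; congr (_ * _).
rewrite mulr_sumr -big_split; apply: eq_bigr => u _.
rewrite mulr_sumr -big_split; apply: eq_bigr => v _.
by rewrite opDE opZE l2DE l2ZE mulrDl mulrA.
Qed.

Lemma fejerB n A B : fejer n (A - B) = fejer n A - fejer n B.
Proof. by rewrite addrC -scaleN1r fejer_lin mulN1r addrC. Qed.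

(** Schur's argument: factoring the Gram matrix writes the mean of [A] as a sum
    of values [<A f, f>], and the isometry property controls the total length of
    the vectors [f]. *)
Lemma fejer_factor n : exists Bs : seq (word -> C),
  (forall A, bop A -> fejer n A = n.+1%:R^-1 *
    \sum_(B <- Bs) l2dot (A (\sum_(u <- wordsB d n.+1) B u *: xi R u))
                         (\sum_(u <- wordsB d n.+1) B u *: xi R u)) /\
  (\sum_(B <- Bs) l2norm (\sum_(u <- wordsB d n.+1) B u *: xi R u) ^+ 2 =
   n.+1%:R * snorm s (x [::]) ^+ 2).
Proof.
have [Bs BsP] := gram_factor (wordsB d n.+1) Dx; exists Bs; split=> [A bA|].
  rewrite /fejer; congr (_ * _).
  transitivity (\sum_(u <- wordsB d n.+1) \sum_(v <- wordsB d n.+1)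
     \sum_(B <- Bs) (B v)^* * (B u * A (xi R u) v)).
    apply: eq_big_seq => u Xu; apply: eq_big_seq => v Xv.
    by rewrite BsP // mulr_sumr; apply: eq_bigr => B _; ring.
  under eq_bigr => u _ do rewrite exchange_big.
  rewrite exchange_big; apply: eq_bigr => B _.
  rewrite l2dot_fin_sumr exchange_big; apply: eq_bigr => v _.
  rewrite (bop_sum bA) l2_sumE mulr_sumr; apply: eq_bigr => u _.
  by rewrite (bopZ bA) l2ZE.
under eq_bigr => B _ do rewrite l2norm_fin_sum.
apply: (@complexI R); rewrite rmorph_sum.
transitivity (\sum_(u <- wordsB d n.+1) G u u).
  under eq_bigr => B _ do rewrite rmorph_sum.
  rewrite exchange_big; apply: eq_big_seq => u Xu.
  by rewrite BsP //; apply: eq_bigr => B _; rewrite mul_conj.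
rewrite sum_wordsB; under eq_bigr => m _ do rewrite (gram_level [::] [::] m).
by rewrite sumr_const card_ord (snormE (Dx _)) mulr_natl (rmorphMn (real_complex R)).
Qed.

Lemma fejer_ge0 n A : bop A -> positive_operator A -> 0 <= fejer n A.
Proof.
move=> bA pA; have [Bs [E _]] := fejer_factor n; rewrite E //.
by rewrite mulr_ge0 ?invr_ge0 ?ler0n // sumr_ge0.
Qed.

Lemma fejer_bound n A M : bop A -> opnorm_le A M ->
  normc (fejer n A) <= M * snorm s (x [::]) ^+ 2.
Proof.
move=> bA AM; have [Bs [E F]] := fejer_factor n; rewrite E //.
rewrite (_ : n.+1%:R^-1 = (n.+1%:R^-1)%:C%C :> C); last by rewrite fmorphV rmorph_nat.
rewrite normcM normc_real ger0_norm ?invr_ge0 ?ler0n // mulrC ler_pdivrMr ?ltr0n //.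
rewrite mulrAC -mulrA -F mulr_sumr; apply: le_trans (normc_sum _ _ _) _.
apply: ler_sum => B _; apply: le_trans (l2_CauchySchwarz _ _) _.
by rewrite expr2 mulrA ler_wpM2r ?l2norm_ge0.
Qed.

Lemma fejer_adj n A : bop A -> fejer n (adj A) = (fejer n A)^*.
Proof.
move=> bA; rewrite /fejer conjCM conjCV (_ : _%:R^* = n.+1%:R :> C); last exact: rmorph_nat.
congr (_ * _); rewrite conjC_sum exchange_big; apply: eq_bigr => v _.
rewrite conjC_sum; apply: eq_bigr => u _; rewrite conjCM -sdotC; [|exact: Dx..].
congr (_ * _).
by rewrite -[LHS]l2dot_xi (is_adjointC (adjP bA)) l2dotC l2dot_xi.
Qed.

(** Only the pairs [(u, a ++ u)] contribute, and those with [u] of a given length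
    contribute [G [::] a] in total. *)
Lemma fejer_Lword n a :
  fejer n (Lword a) = (n.+1 - size a)%:R / n.+1%:R * G [::] a.
Proof.
rewrite /fejer mulrAC mulrC; congr (_ / _).
transitivity (\sum_(u <- wordsB d n.+1)
    if (size a + size u < n.+1)%N then G u (a ++ u) else 0).
  apply: eq_bigr => u _; rewrite Lword_xi -size_cat.
  rewrite -(sum_wordsB_delta n.+1 (a ++ u) (fun v => G u v)) [RHS]big_mkcond.
  by apply: eq_bigr => v _; rewrite xiE; case: eqP; rewrite ?mul1r ?mul0r.
rewrite sum_wordsB.
transitivity (\sum_(k < n.+1) if (size a + k < n.+1)%N then G [::] a else 0).
  apply: eq_bigr => k _; rewrite -(gram_level [::] a k).
  case: ifP => ak; last first.
    by rewrite big1_seq // => u; rewrite mem_words => /eqP ->; rewrite ak.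
  by apply: eq_big_seq => u; rewrite mem_words => /eqP ->; rewrite ak.
elim: (n.+1) => [|m IH]; first by rewrite big_ord0 sub0n mul0r.
have [am|ma] := leqP (size a) m.
  rewrite big_ord_recl addn0 ltnS am subSn // mulrS mulrDl mul1r -IH.
  by congr (_ + _); apply: eq_bigr => k _; rewrite /= /bump /= addnS ltnS.
rewrite (eqP (ma : m.+1 - size a == 0)%N) mul0r big1 // => k _.
by rewrite ltnNge (leq_trans ma (leq_addr _ _)).
Qed.

Definition word_state A : C := xget 0 [set l | clim (fejer^~ A) l].

Definition fejer_cvg A := bop A /\ exists l, clim (fejer^~ A) l.

Lemma word_stateE A l : clim (fejer^~ A) l -> word_state A = l.
Proof.
move=> Al; rewrite /word_state; case: xgetP => [l' _ Al'|/(_ l)]; last by [].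
exact: clim_unique Al' Al.
Qed.

Lemma word_stateP A : fejer_cvg A -> clim (fejer^~ A) (word_state A).
Proof. by move=> [_ [l Al]]; rewrite (word_stateE Al). Qed.

Lemma fejer_cvg_subsp : subsp fejer_cvg.
Proof.
have lin c A B : fejer_cvg A -> fejer_cvg B -> fejer_cvg (c *: A + B).
  move=> [bA [l Al]] [bB [m Bm]]; split; first exact: (@bop_subsp R d).2.
  exists (c * l + m); rewrite (_ : fejer^~ _ = fun n => c * fejer n A + fejer n B).
    exact/climD/Bm/climZ.
  by apply/funext => n; rewrite fejer_lin.
split=> //; split; first exact: (@bop_subsp R d).1.
exists 0; rewrite (_ : fejer^~ _ = fun=> 0); first exact: clim_cst.
by apply/funext => n; rewrite -(subrr 0) fejerB subrr.
Qed.

(** The means are bounded uniformly by [fejer_bound], so convergence passes to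
    norm limits. *)
Lemma fejer_cvg_closure A : opclosure fejer_cvg A -> fejer_cvg A.
Proof.
move=> [bA clA]; split=> //; apply: clim_complete => e e0.
pose K := snorm s (x [::]) ^+ 2 + 1.
have K0 : 0 < K by rewrite ltr_wpDl ?sqr_ge0.
have e4 : 0 < e / 4 by rewrite divr_gt0.
have [B [bB [l Bl]] AB] := clA _ (divr_gt0 e4 K0).
have [N hN] := Bl _ e4; exists N => m n /hN hm /hN hn.
have bAB : bop (A - B) by apply: (subspB (@bop_subsp R d)).
have small k : normc (fejer k (A - B)) <= e / 4.
  apply: le_trans (fejer_bound _ bAB AB) _.
  rewrite mulrAC ler_pdivrMr // ler_wpM2l ?(ltW e4) //.
  by rewrite lerDl.
have -> : fejer m A - fejer n A = fejer m (A - B) + ((fejer m B - l) + (l - fejer n B))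
    - fejer n (A - B) by rewrite !fejerB; ring.
have := le_normcD (fejer m (A - B) + ((fejer m B - l) + (l - fejer n B))) (- fejer n (A - B)).
have := le_normcD (fejer m (A - B)) ((fejer m B - l) + (l - fejer n B)).
have := le_normcD (fejer m B - l) (l - fejer n B).
rewrite normcN; have := small m; have := small n; move: hn; rewrite normcB; lra.
Qed.

Lemma clim_fejer_Lword a : clim (fejer^~ (Lword a)) (G [::] a).
Proof.
move=> e e0; pose D := (size a)%:R * normc (G [::] a) + 1.
have D0 : 0 < D by rewrite ltr_wpDl // mulr_ge0 ?normc_ge0.
have [N hN] := small_inv (divr_gt0 e0 D0); exists (maxn N (size a)) => n.
rewrite geq_max => /andP[/hN]; rewrite ltr_pdivlMr // => small na.
have -> : fejer n (Lword a) - G [::] a =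
    - ((n.+1%:R^-1 : R)%:C%C * ((size a)%:R : R)%:C%C * G [::] a).
  rewrite fejer_Lword natrB; last exact: leq_trans na (leqnSn _).
  rewrite fmorphV !rmorph_nat; field.
  by rewrite (_ : 1 + n%:R = n.+1%:R) ?pnatr_eq0 // mulrS.
rewrite normcN !normcM !normc_real !ger0_norm ?invr_ge0 //.
apply: le_lt_trans small; rewrite -mulrA ler_wpM2l ?invr_ge0 // /D.
by rewrite lerDl.
Qed.

Lemma fejer_cvg_Lword a : fejer_cvg (Lword a).
Proof. by split; [exact: bop_Lword|exists (G [::] a); exact: clim_fejer_Lword]. Qed.

Lemma fejer_cvg_adj A : fejer_cvg A -> fejer_cvg (adj A).
Proof.
move=> [bA [l Al]]; split; first exact: bop_adj.
exists (l^*); rewrite (_ : fejer^~ _ = fun n => (fejer n A)^*); first exact: climJ.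
by apply/funext => n; apply: fejer_adj.
Qed.

Lemma fejer_cvg_symop A : symop A -> fejer_cvg A.
Proof.
move=> [bA clA]; apply: fejer_cvg_closure; split=> // e /clA[B GB AB].
exists B => //; apply: (opspan_min fejer_cvg_subsp) GB => _ [n _ <-].
by rewrite LsymE; apply: (subsp_sum fejer_cvg_subsp) => u _; apply: fejer_cvg_Lword.
Qed.

Lemma fejer_cvg_SSadj A : SSadj A -> fejer_cvg A.
Proof.
move=> [bA clA]; apply: fejer_cvg_closure; split=> // e /clA[B [p [q [Sp Sq ->]]] AB].
exists (p + adj q) => //; apply: (subspD fejer_cvg_subsp).
  exact: fejer_cvg_symop.
exact/fejer_cvg_adj/fejer_cvg_symop.
Qed.

Lemma word_state_lin c A B : fejer_cvg A -> fejer_cvg B ->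
  word_state (c *: A + B) = c * word_state A + word_state B.
Proof.
move=> hA hB; apply: word_stateE.
rewrite (_ : fejer^~ _ = fun n => c * fejer n A + fejer n B).
  by apply: climD; [apply: climZ|]; apply: word_stateP.
by apply/funext => n; rewrite fejer_lin.
Qed.

Lemma word_state_is_state : is_state word_state.
Proof.
split=> [c A B /fejer_cvg_SSadj hA /fejer_cvg_SSadj hB|A /fejer_cvg_SSadj hA pA].
  exact: word_state_lin.
by apply: clim_ge0 (word_stateP hA) _ => n; apply: fejer_ge0 => //; case: hA.
Qed.

Lemma word_state_bound A M : fejer_cvg A -> opnorm_le A M ->
  normc (word_state A) <= M * snorm s (x [::]) ^+ 2.
Proof.
move=> hA AM; rewrite -subr_le0; apply: (@le0_eps _ _ 1) => e e0.
have [N /(_ N (leqnn _))] := word_stateP hA e0.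
have := fejer_bound N hA.1 AM; have := le_normcD (word_state A - fejer N A) (fejer N A).
rewrite subrK normcB; lra.
Qed.

Lemma word_state_sum I (r : seq I) (F : I -> op) : (forall i, fejer_cvg (F i)) ->
  word_state (\sum_(i <- r) F i) = \sum_(i <- r) word_state (F i).
Proof.
move=> hF; apply: word_stateE; rewrite (_ : fejer^~ _ = fun n => \sum_(i <- r) fejer n (F i)).
  by apply: clim_sum => i; apply: word_stateP.
apply/funext => n; apply: (big_morph (fejer n)) => [A B|].
  by have := fejer_lin n 1 A B; rewrite scale1r mul1r.
by rewrite -(subrr 0) fejerB subrr.
Qed.

Lemma word_state_resolvent (w : cball R d) :
  clim (fun n => \sum_(m < n) \sum_(a <- words d m) (wpow (pt w) a)^* * G [::] a)
       (word_state (resolvent w)).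
Proof.
have hP m : fejer_cvg (Lpow (pt w) m) by apply/fejer_cvg_symop/symop_Lpow.
have hk : fejer_cvg (resolvent w) by apply/fejer_cvg_symop/resolvent_symop.
have PE m : word_state (Lpow (pt w) m) = \sum_(a <- words d m) (wpow (pt w) a)^* * G [::] a.
  rewrite LpowE word_state_sum => [|a]; last first.
    by apply: (subspZ fejer_cvg_subsp); apply: fejer_cvg_Lword.
  apply: eq_bigr => a _; apply: word_stateE.
  rewrite (_ : fejer^~ _ = fun n => (wpow (pt w) a)^* * fejer n (Lword a)).
    exact/climZ/clim_fejer_Lword.
  apply/funext => n; rewrite -[_ *: _]addr0 fejer_lin (_ : fejer n 0 = 0) ?addr0 //.
  by rewrite -(subrr 0) fejerB subrr.
move=> e e0; set D := (1 - enorm (pt w))^-1 * snorm s (x [::]) ^+ 2.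
have e2 : 0 < e / 2 by rewrite divr_gt0.
have [N hN] := geometric_small D (enorm_ge0 _) (pt_lt1 w) e2; exists N.+1 => n Nn.
have -> : \sum_(m < n) \sum_(a <- words d m) (wpow (pt w) a)^* * G [::] a =
    word_state (\sum_(m < n) Lpow (pt w) m).
  by rewrite word_state_sum //; apply: eq_bigr => m _; rewrite PE.
have hA : fejer_cvg (Lpow (pt w) n \o resolvent w).
  have -> : Lpow (pt w) n \o resolvent w = resolvent w - \sum_(m < n) Lpow (pt w) m.
    by rewrite {2}(resolvent_partial w n) addrC addKr.
  by apply: (subspB fejer_cvg_subsp) => //; apply: (subsp_sum fejer_cvg_subsp).
have -> : word_state (\sum_(m < n) Lpow (pt w) m) - word_state (resolvent w) =
    - word_state (Lpow (pt w) n \o resolvent w).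
  have hS : fejer_cvg (\sum_(m < n) Lpow (pt w) m) by apply: (subsp_sum fejer_cvg_subsp).
  have := word_state_lin 1 hS hA; rewrite scale1r mul1r -(resolvent_partial w n) => ->.
  by rewrite opprD addrA subrr add0r.
rewrite normcN; apply: le_lt_trans (word_state_bound hA (@resolvent_partial_opnorm _ _ w n)) _.
apply: (@le_lt_trans _ _ (e / 2)); last by lra.
apply: le_trans hN; rewrite -mulrA ler_wpM2r //.
  by rewrite mulr_ge0 ?sqr_ge0 // invr_ge0 subr_ge0 ltW // pt_lt1.
by rewrite ler_wiXn2l ?enorm_ge0 // ltW // pt_lt1.
Qed.

End WordState.

(** * De Branges-Rovnyak spaces *)

Section Rkhs.
Variables (R : realType) (X : Type) (k : X -> X -> R[i]) (H : rkhs k).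

Definition rkhs_sip : sip (X -> R[i]) :=
  @Sip R (X -> R[i]) (fspace H) (fip H) (fspace0 H) (@fspaceP _ _ _ H)
    (@fip_linear _ _ _ H) (@fip_conj _ _ _ H) (@fip_ge0 _ _ _ H).

Lemma rkhs_complete : complete_sip rkhs_sip.
Proof. exact: (@fspace_complete _ _ _ H). Qed.

End Rkhs.

Section DBR.
Variables (R : realType) (d : nat).
Local Notation C := R[i].
Local Notation word := (seq 'I_d).
Local Notation op := (l2 R d -> l2 R d).
Local Notation op1 := (@op1 R d).
Local Notation ball := (cball R d).
Local Notation zero := (cball0 R d).
Variables (b : ball -> C) (Hb : rkhs (dbr_kernel b)).
Hypothesis b_nonconst : ~ exists c : C, forall z, b z = c.
Local Notation S := (rkhs_sip Hb).
Local Notation D := (fspace Hb).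
Local Notation "<< f , g >>" := (fip Hb f g).
Local Notation "`[ f ]" := (snorm S f).
Local Notation K := (clark_kernel b).
Implicit Types (f g : ball -> C).

(** If [b z = 1], then the kernel function at [z] has norm 0, hence vanishes,
    which forces [b] to be constant. *)
Lemma b_neq1 z : 1 - b z != 0.
Proof.
rewrite subr_eq0; apply/eqP => bz; apply: b_nonconst; exists 1 => w.
have kz : (fun w => dbr_kernel b w z) = fun=> 0.
  apply: (fip_eq0 (fspace_kernel Hb z)).
  rewrite fip_kernel; last exact: fspace_kernel.
  by rewrite /dbr_kernel -bz conjC1 mulr1 subrr mul0r.
have /eqP := congr1 (fun f => f w) kz.
rewrite /dbr_kernel -bz conjC1 mulr1 mulf_eq0 invr_eq0 (negPf (cdot_neq1 w z)) orbF.
by rewrite subr_eq0 => /eqP.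
Qed.

Lemma b_neq1J z : 1 - (b z)^* != 0.
Proof. by rewrite -conjC1 -conjCB fmorph_eq0 b_neq1. Qed.

(** The kernel function at [w], normalized so as to represent the functional
    [f |-> f w / (1 - b w)]. *)
Definition nkernel (w : ball) : ball -> C :=
  (1 - (b w)^*)^-1 *: (fun z => dbr_kernel b z w).

Lemma fspace_nkernel w : D (nkernel w).
Proof. by apply: (sdomZ (s := S)); apply: fspace_kernel. Qed.

Lemma fip_nkernel f w : D f -> <<f, nkernel w>> = f w / (1 - b w).
Proof.
move=> Df; rewrite -[LHS]/(sdot S f (nkernel w)) sdotZr //=; last exact: fspace_kernel.
by rewrite fip_kernel // conjCV conjCB conjC1 conjCK mulrC.
Qed.

Lemma fip_nkernel2 z w : <<nkernel w, nkernel z>> = K z w.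
Proof.
rewrite fip_nkernel; last exact: fspace_nkernel.
rewrite /nkernel /clark_kernel /cayley /dbr_kernel.
rewrite -[(_ *: _) z]/((1 - (b w)^*)^-1 * ((1 - b z * (b w)^*) / (1 - cdot (pt z) (pt w)))).
rewrite conjCM conjCV conjCD conjCB conjC1.
by field; rewrite b_neq1 b_neq1J cdot_neq1.
Qed.

Lemma nkernelE z w : nkernel w z = (1 - b z) * K z w.
Proof.
by rewrite -fip_nkernel2 (fip_nkernel z (fspace_nkernel w)) mulrCA divff ?mulr1 // b_neq1.
Qed.

(** Multiplied by [1 - cdot z w] the kernel is a sum of a function of [z] and a
    function of [w]. *)
Lemma clark_gleason z w :
  (1 - cdot (pt z) (pt w)) * K z w = K z zero + K zero w - K zero zero.
Proof.
rewrite /clark_kernel pt0 !cdot_0l !cdot_0r subr0 !divr1 mulrC divfK ?cdot_neq1 //.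
by field.
Qed.

Lemma clarkC z w : K w z = (K z w)^*.
Proof. by rewrite -!fip_nkernel2 (fip_conj (fspace_nkernel _) (fspace_nkernel _)). Qed.

Definition ndiff (w : ball) := nkernel w - nkernel zero.
Definition ncoord (j : 'I_d) (w : ball) := (pt w 0 j)^* *: nkernel w.

Lemma fspace_ndiff w : D (ndiff w).
Proof. exact: (sdomB (s := S) (fspace_nkernel w) (fspace_nkernel zero)). Qed.

Lemma fspace_ncoord j w : D (ncoord j w). Proof. exact: (sdomZ (s := S) _ (fspace_nkernel w)). Qed.

Lemma fip_ndiff f w : D f -> <<f, ndiff w>> = f w / (1 - b w) - f zero / (1 - b zero).
Proof.
move=> Df; rewrite -[LHS]/(sdot S f (ndiff w)) /ndiff.
by rewrite (sdotBr (s := S) (fspace_nkernel w) (fspace_nkernel zero) Df) /= !fip_nkernel.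
Qed.

Lemma fip_ncoord f j w : D f -> <<f, ncoord j w>> = pt w 0 j * <<f, nkernel w>>.
Proof.
move=> Df; rewrite -[LHS]/(sdot S f (ncoord j w)) /ncoord.
by rewrite (sdotZr (s := S) _ (fspace_nkernel w) Df) conjCK.
Qed.

(** Both sides are [cdot z w * K z w], by [clark_gleason]. *)
Lemma ncoord_isometric w z : \sum_(j < d) << ncoord j w, ncoord j z>> = <<ndiff w, ndiff z>>.
Proof.
have -> : <<ndiff w, ndiff z>> = cdot (pt z) (pt w) * K z w.
  rewrite -[LHS]/(sdot S (ndiff w) (ndiff z)) /ndiff.
  rewrite (sdotBl (s := S) (fspace_nkernel w) (fspace_nkernel zero) (fspace_ndiff z)) /=.
  rewrite -[fip Hb (nkernel w) _]/(sdot S (nkernel w) (ndiff z)).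
  rewrite -[fip Hb (nkernel zero) _]/(sdot S (nkernel zero) (ndiff z)) /ndiff.
  rewrite !(sdotBr (s := S) (fspace_nkernel z) (fspace_nkernel zero)); [|exact: fspace_nkernel..].
  have -> : cdot (pt z) (pt w) * K z w = K z w - (K z zero + K zero w - K zero zero).
    by rewrite -clark_gleason; ring.
  by rewrite /= !fip_nkernel2; ring.
rewrite /cdot mulr_suml; apply: eq_bigr => j _.
rewrite fip_ncoord; last exact: fspace_ncoord.
rewrite -[fip Hb _ _]/(sdot S (ncoord j w) (nkernel z)) /ncoord.
by rewrite (sdotZl (s := S) _ (fspace_nkernel w) (fspace_nkernel z)) /= fip_nkernel2 mulrA.
Qed.

(** The kernel function at 0 is an affine function of [b]. *)
Lemma fspace_b_iff : D b <-> D (fun z => 1 - b z).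
Proof.
have kz := fspace_kernel Hb zero.
have kE : (fun z => dbr_kernel b z zero) = (fun z => 1 - b z * (b zero)^*).
  by apply/funext => z; rewrite /dbr_kernel pt0 cdot_0r subr0 divr1.
split=> Db.
  have -> : (fun z => 1 - b z) = (fun z => dbr_kernel b z zero) + ((b zero)^* - 1) *: b.
    rewrite kE; apply/funext => z.
    by rewrite -[RHS]/(1 - b z * (b zero)^* + ((b zero)^* - 1) * b z); ring.
  by apply: (sdomD (s := S)) => //; apply: (sdomZ (s := S)).
have := sdomZ (s := S) (1 - (b zero)^*)^-1 (sdomB (s := S) kz Db).
congr (D _); rewrite kE; apply/funext => z.
rewrite -[LHS]/((1 - (b zero)^*)^-1 * ((1 - b z * (b zero)^*) - (1 - b z))).
by field; apply: b_neq1J.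
Qed.

Local Notation h := (fun z => 1 - b z).

Lemma fip_nkernel_1b w : D h -> <<nkernel w, h>> = 1.
Proof.
by move=> Dh; rewrite (fip_conj Dh (fspace_nkernel w)) fip_nkernel // divff ?conjC1 ?b_neq1.
Qed.

(** By [clark_gleason], the function
    [ndiff w - \sum_j conj (w_j) z_j (nkernel w)] is [1 - b] times the constant
    [K 0 w - K 0 0], which is nonzero for some [w] because [b] is not
    constant. *)
Lemma fspace_1b_of_shift_invariant :
  (forall (j : 'I_d) f, D f -> D (fun z => pt z 0 j * f z)) -> D h.
Proof.
move=> inv.
have [w Kw] : exists w, K zero w - K zero zero != 0.
  apply/not_existsP => Keq; apply: b_nonconst; exists (b zero) => w.
  have /negP/negPn := Keq w; rewrite /clark_kernel pt0 !cdot_0l subr0 !divr1 -mulrBl.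
  rewrite mulf_eq0 invr_eq0 pnatr_eq0 orbF opprD addrACA subrr add0r -conjCB.
  rewrite fmorph_eq0 subr_eq0 /cayley => /eqP.
  move=> /(congr1 (fun x => x * ((1 - b w) * (1 - b zero)))).
  have -> : (1 + b w) / (1 - b w) * ((1 - b w) * (1 - b zero)) = (1 + b w) * (1 - b zero).
    by field; apply: b_neq1.
  have -> : (1 + b zero) / (1 - b zero) * ((1 - b w) * (1 - b zero)) =
     (1 + b zero) * (1 - b w) by field; apply: b_neq1.
  move=> E; have : 2 * b w = 2 * b zero.
    apply/eqP; rewrite -subr_eq0; apply/eqP.
    by rewrite -[LHS]/(2 * b w - 2 * b zero) -[RHS](subrr ((1 + b zero) * (1 - b w))) -{1}E; ring.
  by move/mulfI; apply; rewrite pnatr_eq0.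
have Dsum : D (ndiff w - \sum_(j < d) (pt w 0 j)^* *: (fun z => pt z 0 j * nkernel w z)).
  apply: (sdomB (s := S) (fspace_ndiff w)); apply: (sdom_sum (s := S)) => j _.
  by apply: (sdomZ (s := S)); apply: inv; apply: fspace_nkernel.
have -> : h = (K zero w - K zero zero)^-1 *:
    (ndiff w - \sum_(j < d) (pt w 0 j)^* *: (fun z => pt z 0 j * nkernel w z)).
  apply/funext => z.
  have -> : ((K zero w - K zero zero)^-1 *:
    (ndiff w - \sum_(j < d) (pt w 0 j)^* *: (fun z => pt z 0 j * nkernel w z))) z =
    (K zero w - K zero zero)^-1 * (nkernel w z - nkernel zero z - cdot (pt z) (pt w) * nkernel w z).
    rewrite -[LHS]/((K zero w - K zero zero)^-1 * (nkernel w z - nkernel zero z -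
       (\sum_(j < d) (pt w 0 j)^* *: (fun z => pt z 0 j * nkernel w z)) z)).
    congr (_ * (_ - _)); rewrite fct_sumE /cdot mulr_suml; apply: eq_bigr => j _.
    by rewrite -[LHS]/((pt w 0 j)^* * (pt z 0 j * nkernel w z)) mulrA [_^* * _]mulrC.
  rewrite !nkernelE.
  have -> : (1 - b z) * K z w - (1 - b z) * K z zero - cdot (pt z) (pt w) * ((1 - b z) * K z w)
    = (1 - b z) * ((1 - cdot (pt z) (pt w)) * K z w - K z zero) by ring.
  rewrite clark_gleason.
  by rewrite [K z zero + _]addrC addrAC addrK mulrC mulfK.
exact: (sdomZ (s := S)).
Qed.

(** As [1 - b] has inner product 1 with every [nkernel w], it represents the sum
    of the coefficients, which is therefore bounded. *)
Lemma lval1_le r : D h -> normc (lval (fun=> 1) r) <= `[h] * `[lincomb nkernel r].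
Proof.
move=> Dh; have DK : sdom S (lincomb nkernel r) by apply: sdom_lincomb; apply: fspace_nkernel.
have -> : lval (fun=> 1) r = <<lincomb nkernel r, h>>.
  rewrite -[RHS]/(sdot S (lincomb nkernel r) h) sdot_lincombl //; last exact: fspace_nkernel.
  by apply: eq_bigr => p _ /=; rewrite fip_nkernel_1b.
by rewrite mulrC; apply: (CauchySchwarz (s := S)).
Qed.

(** The functional that [z_j f] should represent is
    [nkernel w |-> <ncoord j w, f>].  It is bounded, because the [ncoord j]
    combinations are dominated by the [ndiff] combinations, which differ from the
    [nkernel] combinations by the sum of the coefficients times [nkernel 0]. *)
Lemma shift_invariant_of_1b : D h ->
  forall (j : 'I_d) f, D f -> D (fun z => pt z 0 j * f z).
Proof.
move=> Dh j f Df.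
have [r|g [Dg gP _]] := @riesz _ _ S _ nkernel (fun w => <<ncoord j w, f>>)
    ((1 + `[h] * `[nkernel zero]) * `[f]) (@rkhs_complete _ _ _ Hb) fspace_nkernel.
  have DFr : sdom S (lincomb (ncoord j) r) by apply: sdom_lincomb; apply: fspace_ncoord.
  have DK : sdom S (lincomb nkernel r) by apply: sdom_lincomb; apply: fspace_nkernel.
  have -> : lval (fun w => <<ncoord j w, f>>) r = sdot S (lincomb (ncoord j) r) f.
    by rewrite sdot_lincombl //; apply: fspace_ncoord.
  apply: le_trans (CauchySchwarz DFr Df) _.
  rewrite [leRHS]mulrAC ler_wpM2r ?snorm_ge0 //.
  apply: le_trans (lincomb_contractive (s := S) fspace_ndiff fspace_ncoord ncoord_isometric j r) _.
  rewrite lincomb_shift; have D0 := fspace_nkernel zero.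
  apply: le_trans (ler_snormB DK (sdomZ (s := S) _ D0)) _.
  rewrite mulrDl mul1r lerD2l (snormZ (s := S) _ D0) mulrAC.
  by rewrite ler_wpM2r ?snorm_ge0 ?lval1_le.
suff -> : (fun z => pt z 0 j * f z) = g by [].
apply/funext => w; have := gP w; rewrite -[sdot S _ _]/(fip Hb _ _).
rewrite (fip_conj Dg (fspace_nkernel w)) (fip_conj Df (fspace_ncoord j w)).
rewrite fip_ncoord // !fip_nkernel //.
move=> /(can_inj conjCK) E; apply: (mulIf (invr_neq0 (b_neq1 w))).
by rewrite E mulrA.
Qed.

Lemma Snorm_lincomb (mu : op -> C) (st : is_state mu) r : represents mu b ->
  Snorm mu (lincomb (@resolvent R d) r) = `[lincomb nkernel r].
Proof.
move=> rep; apply: (@snorm_lincomb_eq R _ _ (Ssip st) S) => [w|w|w z].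
- exact: resolvent_symop.
- exact: fspace_nkernel.
by rewrite /= fip_nkernel2; apply: Sdot_resolvent.
Qed.

(** The coefficient of the unit, read off at the vacuum vector, is 1 on
    [1 - p] for [p] in [symop0].  On combinations of resolvents it is the sum of
    the coefficients, so [lval1_le] bounds it by the seminorm of the state, and
    [1 - p] cannot be small. *)
Lemma not_quasi_extreme_of_1b : D h -> ~ quasi_extreme b.
Proof.
move=> Dh [mu [st rep /(quasi_extremeE st) qe]].
pose m1 := Num.sqrt (complex.Re (mu op1)).
have m10 : 0 <= m1 by apply: sqrtr_ge0.
suff : (1 : R) <= 0 by rewrite ler10.
apply: (@le0_eps _ _ (1 + `[h] * (1 + m1))) => e e0.
have [p sp lt] := qe e e0.
have Sp : symop (op1 - p).
  by apply: (subspB (@symop_subsp R d) (@symop1 R d)); apply: symop0_symop.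
have : opclosure (@resolvent_span R d) (op1 - p) by rewrite -symopE.
move=> [_ /(_ e e0)[q kq pq]].
have Sq : symop q by apply: resolvent_span_symop.
have [r qE] := resolvent_span_lincomb kq.
have qv : q (xi R [::]) [::] = lval (fun=> 1) r.
  rewrite qE /lincomb op_sumE l2_sumE; apply: eq_bigr => c _.
  by rewrite opZE l2ZE resolvent_nil.
have h1 : normc (1 - lval (fun=> 1) r) <= e.
  have := pq (xi R [::]); rewrite l2norm_xi mulr1; apply: le_trans.
  have := l2_CauchySchwarz ((op1 - p - q) (xi R [::])) (xi R ([::] : word)).
  have ev : ((op1 - p - q) (xi R [::])) [::] = 1 - lval (fun=> 1) r.
    rewrite -[LHS]/(xi R ([::] : word) [::] - p (xi R [::]) [::] - q (xi R [::]) [::]).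
    by rewrite symop0_vacuum // qv subr0.
  by rewrite l2dot_xi l2norm_xi mulr1 ev.
have h2 := lval1_le r Dh; rewrite -(Snorm_lincomb st r rep) -qE in h2.
have Spq := subspB (@symop_subsp R d) Sp Sq.
have h3 := Snorm_le st Spq (ltW e0) pq.
have h4 : Snorm mu q <= e + e * m1.
  have := ler_snormB (s := Ssip st) Sp Spq; rewrite opprB addrC subrK -!SnormE.
  move: h3; rewrite -/m1; lra.
have h5 := le_normcD (1 - lval (fun=> 1) r) (lval (fun=> 1) r).
rewrite subrK normc1 in h5.
have h6 : `[h] * Snorm mu q <= `[h] * (e + e * m1) by rewrite ler_wpM2l ?snorm_ge0.
lra.
Qed.

(** A function [g] orthogonal to all [ndiff w] has [g / (1 - b)] constant. *)
Lemma ndiff_dense : ~ D h ->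
  forall f, D f -> forall e, 0 < e -> exists r, `[f - lincomb ndiff r] < e.
Proof.
move=> Dh f Df.
have [r|g [Dg gP gap]] := @riesz _ _ S _ ndiff (fun w => <<ndiff w, f>>) `[f]
    (@rkhs_complete _ _ _ Hb) fspace_ndiff.
  have DEr : sdom S (lincomb ndiff r) by apply: sdom_lincomb; apply: fspace_ndiff.
  rewrite -(sdot_lincombl (s := S) r fspace_ndiff Df) mulrC; exact: CauchySchwarz.
have DG : D (f - g) by apply: (sdomB (s := S)).
suff -> : f = g by [].
have E w : (f - g) w = (f - g) zero / (1 - b zero) * (1 - b w).
  have : <<f - g, ndiff w>> = 0.
    rewrite -[LHS]/(sdot S (f - g) (ndiff w)) (sdotBl (s := S) Df Dg (fspace_ndiff w)).
    rewrite (sdotC (s := S) (fspace_ndiff w) Df) (sdotC (s := S) (fspace_ndiff w) Dg).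
    by rewrite gP -conjCB subrr conjC0.
  rewrite fip_ndiff // => /eqP; rewrite subr_eq0 => /eqP <-.
  by rewrite divfK // b_neq1.
have [c0|c0] := eqVneq ((f - g) zero / (1 - b zero)) 0.
  apply/funext => w; apply/eqP; rewrite -subr_eq0; apply/eqP.
  by rewrite -[LHS]/((f - g) w) (E w) c0 mul0r.
case: Dh; rewrite (_ : h = ((f - g) zero / (1 - b zero))^-1 *: (f - g)).
  exact: (sdomZ (s := S)).
apply/funext => w.
rewrite -[RHS]/(((f - g) zero / (1 - b zero))^-1 * (f - g) w) (E w).
by rewrite mulrA mulVf ?mul1r.
Qed.

(** The classes of the resolvents and the [nkernel w] have the same Gram matrix,
    so the unit is as close to the span of the differences [k_w - 1] as
    [nkernel 0] is to the span of the [ndiff w]. *)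
Lemma quasi_extreme_of_dense (mu : op -> C) : is_state mu -> represents mu b ->
  (forall f, D f -> forall e, 0 < e -> exists r, `[f - lincomb ndiff r] < e) ->
  quasi_extreme_state mu.
Proof.
move=> st rep dense; apply/(quasi_extremeE st) => e e0.
have e2 : 0 < e / 2 by rewrite divr_gt0.
have [r lt] := dense _ (fspace_nkernel zero) _ e2.
pose m1 := Num.sqrt (complex.Re (mu op1)).
have m10 : 0 < m1 + 1 by rewrite ltr_wpDl ?sqrtr_ge0.
pose A := lincomb (fun w => resolvent w - op1) r.
have sS := @symop_subsp R d; have S1 := @symop1 R d.
have SA : symop A.
  apply: (subsp_sum sS) => p _; apply: (subspZ sS).
  exact: (subspB sS (resolvent_symop p.2) S1).
have h1 : Snorm mu (op1 - A) < e / 2.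
  pose r' := (1, zero) :: cscale (-1) r ++ [:: (lval (fun=> 1) r, zero)].
  have cons_E (V : lmodType C) (u : ball -> V) :
      lincomb u r' = u zero - lincomb (fun w => u w - u zero) r.
    rewrite /r' -cat1s !lincomb_cat !lincomb1 lincomb_scale scale1r scaleN1r.
    by rewrite lincomb_shift opprB addrA [_ - lincomb u r + _]addrAC addrA.
  have -> : op1 - A = lincomb (@resolvent R d) r' by rewrite cons_E /A resolvent0.
  by rewrite Snorm_lincomb // cons_E.
have [_ /(_ _ (divr_gt0 e2 m10))[p sp Ap]] : opclosure (@symop0 R d) A.
  apply: (subsp_sum (opclosure_subsp (@symop0_subsp R d))) => p _.
  apply: (subspZ (opclosure_subsp (@symop0_subsp R d))); exact: resolvent_sub1_symop0.
exists p => //.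
have Sp : symop p by apply: symop0_symop.
have SAp := subspB sS SA Sp.
have h2 : Snorm mu (A - p) <= e / 2.
  apply: le_trans (Snorm_le st SAp _ Ap) _; first by rewrite divr_ge0 ?ltW.
  by rewrite -/m1 mulrAC ler_pdivrMr // ler_wpM2l ?(ltW e2) // lerDl.
have := snorm_dist (s := Ssip st) S1 SA Sp; rewrite -!SnormE; lra.
Qed.

(** The extension [B] of the isometry [ndiff w |-> (ncoord j w)_j] solves
    [<f, nkernel w> = <f, nkernel 0> + \sum_j w_j <B_j f, nkernel w>].  The vectors
    obtained from [nkernel 0] by applying the [B_j] along words are
    column-isometric, and iterating this equation from [nkernel 0] expands
    [K w 0] into a power series whose coefficients are the values of the
    associated state at the adjoints of the words. *)
Lemma exists_state : ~ D h -> exists mu : op -> C, is_state mu /\ represents mu b.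
Proof.
move=> Dh.
have [B [DB Biso BE]] := isometric_extension (s := S) fspace_ndiff fspace_ncoord ncoord_isometric
  (@rkhs_complete _ _ _ Hb) (ndiff_dense Dh).
pose x (a : word) : ball -> C := foldl (fun f j => B j f) (nkernel zero) a.
have Dx a : sdom S (x a).
  elim/last_ind: a => [|a j IH]; first exact: fspace_nkernel.
  by rewrite /x foldl_rcons; apply: DB.
have x_iso a a' : \sum_(j < d) sdot S (x (rcons a j)) (x (rcons a' j)) = sdot S (x a) (x a').
  rewrite -(Biso _ _ (Dx a) (Dx a')); apply: eq_bigr => j _.
  by rewrite /x !foldl_rcons.
pose mu := word_state S x; have st : is_state mu by apply: word_state_is_state.
exists mu; split=> //.
have step w a : <<x a, nkernel w>> = <<x a, nkernel zero>> +
    \sum_(j < d) pt w 0 j * <<x (rcons a j), nkernel w>>.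
  have DXa : D (x a) := Dx a.
  rewrite [<<x a, nkernel w>>]fip_nkernel // [<<x a, nkernel zero>>]fip_nkernel //.
  have := BE _ w DXa; rewrite -[sdot S _ (ndiff w)]/(<<x a, ndiff w>>) fip_ndiff // => E.
  rewrite [X in _ = _ + X](_ : _ = x a w / (1 - b w) - x a zero / (1 - b zero)).
    by rewrite [RHS]addrC subrK.
  rewrite -E; apply: eq_bigr => j _.
  rewrite -[RHS]/(<<B j (x a), ncoord j w>>) fip_ncoord; last exact: DB.
  by rewrite /x foldl_rcons.
have expand w n : <<nkernel zero, nkernel w>> =
    \sum_(m < n) \sum_(a <- words d m) wpow (pt w) a * <<x a, nkernel zero>> +
    \sum_(a <- words d n) wpow (pt w) a * <<x a, nkernel w>>.
  elim: n => [|n ->]; first by rewrite big_ord0 add0r sum_words0 /wpow big_nil mul1r.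
  rewrite big_ord_recr -addrA; congr (_ + _).
  rewrite sum_words_rcons -big_split; apply: eq_bigr => a _ /=.
  rewrite {1}step mulrDr mulr_sumr; congr (_ + _); apply: eq_bigr => j _.
  by rewrite wpow_rcons mulrA.
have rem w n : normc (\sum_(a <- words d n) wpow (pt w) a * <<x a, nkernel w>>) <=
    enorm (pt w) ^+ n * (`[nkernel zero] * `[nkernel w]).
  apply: le_trans (normc_sum _ _ _) _.
  under eq_bigr => a _ do rewrite normcM.
  rewrite -ler_sqr ?nnegrE; last 2 first.
  - by apply: sumr_ge0 => a _; rewrite mulr_ge0 ?normc_ge0.
  - by rewrite !mulr_ge0 ?exprn_ge0 ?enorm_ge0 ?snorm_ge0.
  apply: le_trans (sum_CauchySchwarz _ _ _) _.
  rewrite sum_wpow exprMn ler_wpM2l ?sqr_ge0 //.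
  apply: (@le_trans _ _ (\sum_(a <- words d n) `[x a] ^+ 2 * `[nkernel w] ^+ 2)).
    apply: ler_sum => a _; rewrite -exprMn ler_sqr ?nnegrE ?normc_ge0 ?mulr_ge0 ?snorm_ge0 //.
    by apply: (CauchySchwarz (s := S)); [apply: Dx|apply: fspace_nkernel].
  rewrite -mulr_suml exprMn ler_wpM2r ?sqr_ge0 //.
  have : (\sum_(a <- words d n) `[x a] ^+ 2)%:C%C = (`[nkernel zero] ^+ 2)%:C%C.
    rewrite rmorph_sum -(snormE (s := S) (Dx [::])) -(gram_level x_iso [::] [::] n).
    by apply: eq_bigr => a _; rewrite (snormE (s := S) (Dx a)).
  by move=> /complexI ->.
have mu_resolvent w : mu (resolvent w) = K zero w.
  apply: (clim_unique (word_state_resolvent Dx x_iso w)).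
  rewrite clarkC -fip_nkernel2.
  have lim : clim (fun n => \sum_(m < n) \sum_(a <- words d m)
      wpow (pt w) a * <<x a, nkernel zero>>)
      (<<nkernel zero, nkernel w>>).
    have r0 : clim (fun n => - \sum_(a <- words d n) wpow (pt w) a * <<x a, nkernel w>>) 0.
      apply: (clim_geometric (enorm_ge0 _) (pt_lt1 w)) => n.
      by rewrite normcN; apply: rem.
    have := climD (clim_cst <<nkernel zero, nkernel w>>) r0; rewrite addr0.
    rewrite (_ : (fun n => _ + _) = fun n => \sum_(m < n) \sum_(a <- words d m)
       wpow (pt w) a * <<x a, nkernel zero>>) //.
    by apply/funext => n; rewrite {1}(expand w n) addrK.
  have := climJ lim; congr (clim _ _); apply/funext => n.
  rewrite conjC_sum; apply: eq_bigr => m _; rewrite conjC_sum; apply: eq_bigr => a _.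
  by rewrite conjCM -(sdotC (s := S) (Dx a) (fspace_nkernel zero)).
move=> z; rewrite state_herglotz //.
rewrite state_adj //; last exact/SSadj_symop/resolvent_symop.
rewrite -resolvent0 !mu_resolvent -clarkC /clark_kernel pt0 !cdot_0l !cdot_0r subr0 !divr1.
set G0 := cayley b zero; have G0E := Crect G0.
have G0J : G0^* = 'Re G0 - 'i * 'Im G0.
  by rewrite {1}G0E conjC_rect ?Creal_Re ?Creal_Im.
move: ('Re G0) ('Im G0) G0E G0J => x0 y0 G0E G0J; rewrite G0J G0E.
by field.
Qed.

Lemma fspace_1b_of_not_quasi_extreme : ~ quasi_extreme b -> D h.
Proof.
move=> nqe; apply: contrapT => Dh; apply: nqe.
have [mu [st rep]] := exists_state Dh; exists mu; split=> //.
by apply: quasi_extreme_of_dense => //; apply: ndiff_dense.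
Qed.

End DBR.

Theorem corollary4p5 (R : realType) (d : nat) (d_gt0 : (0 < d)%N)
    (b : cball R d -> R[i])
    (H2 : rkhs (@drury_arveson_kernel R d)) (Hb : rkhs (dbr_kernel b))
    (b_mult : contractive_multiplier H2 b)
    (b_nonconst : ~ exists c : R[i], forall z, b z = c) :
  [<-> forall (j : 'I_d) (f : cball R d -> R[i]),
         fspace Hb f -> fspace Hb (fun z => pt z 0 j * f z);
       fspace Hb b;
       ~ quasi_extreme b].
Proof.
have bh := fspace_b_iff Hb b_nonconst.
tfae.
- by move=> inv; apply/bh/fspace_1b_of_shift_invariant.
- by move=> /bh; apply: not_quasi_extreme_of_1b.
- by move=> nqe; apply: shift_invariant_of_1b => //; apply: fspace_1b_of_not_quasi_extreme.
Qed.
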